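(* Let $p\ge1$ and let $n,s$ be integers with $0\le n\le p$, $0\le s\le p-1$ and $\kappa:=s-n\ge-2$. Let $\mathbf{a}_1\in(\mathbb{C}\setminus\mathbb{Z})^{n}$, $\mathbf{a}_2\in\mathbb{C}^{p-n}$, $\mathbf{a}=(\mathbf{a}_1,\mathbf{a}_2)\in\mathbb{C}^{p}$, $\mathbf{b}_1\in(\mathbb{C}\setminus\mathbb{Z})^{s}$, $\mathbf{b}_2\in\mathbb{C}^{p-1-s}$, $\mathbf{b}=(\mathbf{b}_1,\mathbf{b}_2)\in\mathbb{C}^{p-1}$, assume $\Re\big(\sum_{b\in\mathbf{b}}b-\sum_{a\in\mathbf{a}}a\big)>0$, and assume the parameters are generic (components of $\mathbf{a}_2$ non-integer and pairwise distinct modulo $\mathbb{Z}$, components of $\mathbf{b}_1$ pairwise distinct modulo $\mathbb{Z}$, and more generally all Gamma factors below finite). Let $z=(-1)^{\kappa}$. Then \begin{multline*} \sum_{k=0}^{\infty}\frac{(\mathbf{a})_{k}z^{k}}{\pi(\mathbf{b})_{k}k!}\Big[\sum_{b\in\mathbf{b}}\psi(b+k)+\psi(1+k)-\sum_{a\in\mathbf{a}}\psi(a+k)\Big] =\Big\{\sum_{a\in\mathbf{a}_1}\cot(\pi a)-\sum_{b\in\mathbf{b}_1}\cot(\pi b)\Big\}{}_{p}F_{p-1}\!\left(\left.\begin{matrix}\mathbf{a}\\\mathbf{b}\end{matrix}\right|z\right)\\ -\frac{z\,(1-\mathbf{b})_{1}}{\pi(1-\mathbf{a})_{1}}\,{}_{p+1}F_{p}\!\left(\left.\begin{matrix}1,1,2-\mathbf{b}\\2-\mathbf{a}\end{matrix}\right|z\right)\\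 +\frac{\Gamma(1-\mathbf{a}_1)\Gamma(\mathbf{b}_2)}{\Gamma(1-\mathbf{b}_1)\Gamma(\mathbf{a}_2)}\sum_{a_k\in\mathbf{a}_2}\frac{\Gamma(a_k)\Gamma(\mathbf{a}_{2[k]}-a_k)\Gamma(1-\mathbf{b}_1+a_k)}{\sin(\pi a_k)\Gamma(\mathbf{b}_2-a_k)\Gamma(1-\mathbf{a}_1+a_k)}\,{}_{p}F_{p-1}\!\left(\left.\begin{matrix}a_k,\,1-\mathbf{b}+a_k\\1-\mathbf{a}_{[k]}+a_k\end{matrix}\right|z\right)\\ +\frac{\Gamma(1-\mathbf{a}_1)\Gamma(\mathbf{b}_2)}{\Gamma(1-\mathbf{b}_1)\Gamma(\mathbf{a}_2)}\sum_{b_k\in\mathbf{b}_1}\frac{\Gamma(b_k-1)\Gamma(b_k-\mathbf{b}_{1[k]})\Gamma(1-b_k+\mathbf{a}_2)}{\sin(\pi b_k)\Gamma(b_k-\mathbf{a}_1)\Gamma(1-b_k+\mathbf{b}_2)}\,{}_{p}F_{p-1}\!\left(\left.\begin{matrix}1-b_k+\mathbf{a}\\2-b_k,\,1-b_k+\mathbf{b}_{[k]}\end{matrix}\right|z\right). \end{multline*} Here, for $a_k\in\mathbf{a}_2$, $\mathbf{a}_{2[k]}$ and $\mathbf{a}_{[k]}$ denote $\mathbf{a}_2$, resp. $\mathbf{a}$, with that component $a_k$ removed; similarly for $b_k\in\mathbf{b}_1$, $\mathbf{b}_{1[k]}$ and $\mathbf{b}_{[k]}$ denote $\mathbf{b}_1$,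 resp. $\mathbf{b}$, with $b_k$ removed.
   Context: $\psi=\Gamma'/\Gamma$ is the digamma function and $(x)_k=\Gamma(x+k)/\Gamma(x)$ the Pochhammer symbol. For a vector $\mathbf{a}=(a_1,\dots,a_q)$ and scalar $\beta$: $\Gamma(\mathbf{a})=\prod_i\Gamma(a_i)$ (empty product $=1$), $(\mathbf{a})_k=\prod_i(a_i)_k$, $\mathbf{a}+\beta=(a_1+\beta,\dots,a_q+\beta)$, $\beta-\mathbf{a}=(\beta-a_1,\dots,\beta-a_q)$, $\mathbf{a}_{[k]}$ is $\mathbf{a}$ with the $k$-th component removed, and $\sum_{a\in\mathbf{a}}$ runs over the components of $\mathbf{a}$. ${}_pF_q(\mathbf{a};\mathbf{b};z)=\sum_{k\ge0}\frac{(\mathbf{a})_k}{(\mathbf{b})_k}\frac{z^k}{k!}$. Listing several vectors/scalars separated by commas in a parameter row means concatenation. *)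

(* Defs.v *)
From Stdlib Require Import Reals List ZArith ClassicalEpsilon.
From Coquelicot Require Import Coquelicot.
Open Scope C_scope.

Definition Cexp (z : C) : C :=
  (exp (Re z) * cos (Im z), exp (Re z) * sin (Im z))%R.
Definition Csin (z : C) : C := (Cexp (Ci * z) - Cexp (- (Ci * z))) / (2 * Ci).
Definition Ccos (z : C) : C := (Cexp (Ci * z) + Cexp (- (Ci * z))) / 2.
Definition Ccot (z : C) : C := Ccos z / Csin z.

Definition Cnatpow (N : nat) (z : C) : C := Cexp (z * RtoC (ln (INR N))).

(* limit of a complex sequence (meaningful when it converges) *)
Definition CLim (u : nat -> C) : C :=
  (real (Lim_seq (fun N => Re (u N))), real (Lim_seq (fun N => Im (u N)))).

Fixpoint csum (n : nat) (f : nat -> C) : C :=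
  match n with O => 0 | S m => csum m f + f m end.
Fixpoint cprod (n : nat) (f : nat -> C) : C :=
  match n with O => 1 | S m => cprod m f * f m end.

Definition CSeries (u : nat -> C) : C := CLim (fun N => csum (S N) u).

(* Euler's Gamma function (Gauss' product formula) *)
Definition CGamma (z : C) : C :=
  CLim (fun N => RtoC (INR (fact N)) * Cnatpow N z
                 / cprod (S N) (fun j => z + RtoC (INR j))).

Definition CGamma' (z : C) : C :=
  epsilon (inhabits (RtoC 0)) (fun l => is_derive CGamma z l).
Definition digamma (z : C) : C := CGamma' z / CGamma z.

Definition poch (x : C) (k : nat) : C := cprod k (fun j => x + RtoC (INR j)).

Definition vsum (v : list C) : C := fold_right Cplus 0 v.
Definition vprod (v : list C) : C := fold_right Cmult 1 v.
Definition vpoch (v : list C) (k : nat) : C := vprod (map (fun x => poch x k) v).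
Definition vGamma (v : list C) : C := vprod (map CGamma v).
Definition removeAt (k : nat) (v : list C) : list C := firstn k v ++ skipn (S k) v.

Definition hyp_term (as_ bs : list C) (z : C) (k : nat) : C :=
  vpoch as_ k / vpoch bs k * z ^ k / RtoC (INR (fact k)).
Definition pFq (as_ bs : list C) (z : C) : C := CSeries (hyp_term as_ bs z).

Definition nonint (w : C) : Prop := forall m : Z, w <> RtoC (IZR m).
Definition notpole (w : C) : Prop := forall m : nat, w <> - RtoC (INR m).
Definition distinct_modZ (v : list C) : Prop :=
  forall i j, (i < length v)%nat -> (j < length v)%nat -> i <> j ->
    nonint (nth i v 0 - nth j v 0).

(* Main.v *)
Require Import Defs.
From Stdlib Require Import Reals List ZArith Lra Lia Psatz ClassicalEpsilon.
From Stdlib Require FinFun.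
From Coquelicot Require Import Coquelicot.
Import ListNotations.
Open Scope C_scope.

(** Let
      Phi(t) = prod_(u in U) Gamma(u+t) prod_(v in V) Gamma(v-t)
               / (prod_(w in W) Gamma(w+t) prod_(x in X) Gamma(x-t))
    with U = (1, a2), V = (0, 0, 1-b1), W = b2 and X = 1-a1.  The identity says
    that the residues of Phi sum to zero: the double poles t = k >= 0 give the
    digamma series and the cotangents, the simple poles t = -1-k, t = -a_k-j
    and t = 1-b_k+j give the other three kinds of series.

    No contour integral is used.  Since |U|+|X| = |V|+|W|, replacing every Gamma
    factor by its Gauss product with M factors turns Phi into a rational function
    (the powers M^t cancel).  It is multiplied by the regulator
      (tau-1)^A (tau+1)^A / prod_(l=1..2A+2) (tau - i l),   tau = t/(M+1),
    which makes its degree at most -2 and damps the residues near the ends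
    |t| = M of the truncated pole sequences.  The residues of such a rational
    function sum to zero by partial fractions; as M grows the residues at the
    poles of Phi are dominated by a multiple of k^(-1-sigma) (times a logarithm
    at the double poles), where sigma = Re(sum b - sum a) > 0, and those at the
    poles of the regulator tend to zero. *)

(** The number m = |U| - |W| = |V| - |X| equals kappa + 2, so kappa >= -2 says m >= 0. This enters
    twice: the rational function has degree -2mM - 2, and the estimates contain the factor (M!^2 /
    ((M+k)! (M-k)!))^m, at most 1 because the factorial is log-convex. For m = 0 the factorials gain
    nothing: the degree -2 comes from the two additional poles of the regulator, and convergence
    rests on sigma alone. The obstacle is the range of k close to M, where a truncated residue can
    exceed the majorant by a power of (M+1)/(M-k+1) whose exponent depends on the parameters. A is
    taken at least that large, and one larger at the double poles, where a logarithm of the same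
    quotient appears. The poles of the regulator are put on the imaginary axis because there |t+j| =
    |t-j|: all Gauss products then have comparable moduli and cancel up to M!^(2m). The factor z^k
    collects the signs of reversed products; it is the same for all families of poles because |V| +
    |X| and |U| + |W| both have the parity of kappa. *)

Notation natC n := (RtoC (INR n)).

(** * Limits of complex sequences *)

(** [CLim] has a value even for a divergent sequence, so every limit is first proved in this form
    and only then transferred by [ccv_CLim]. *)
Definition ccv (u : nat -> C) (l : C) : Prop :=
  forall eps : R, (0 < eps)%R ->
  exists N : nat, forall n, (N <= n)%nat -> (Cmod (u n - l) < eps)%R.

Lemma Cmod_triangle_minus (x y : C) : (Cmod x - Cmod y <= Cmod (x - y))%R.
Proof.
  pose proof (Cmod_triangle (x - y) y) as H.
  replace (x - y + y) with x in H by ring. lra.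
Qed.

Lemma Cmod_minus_sym (x y : C) : Cmod (x - y) = Cmod (y - x).
Proof. rewrite <- Cmod_opp. f_equal. ring. Qed.

Lemma Cmod_minus_le (x y : C) : (Cmod (x - y) <= Cmod x + Cmod y)%R.
Proof.
  unfold Cminus. eapply Rle_trans; [apply Cmod_triangle|]. rewrite Cmod_opp. lra.
Qed.

Lemma ccv_squeeze (u : nat -> C) (l : C) (b : nat -> R) (N : nat) :
  (forall n, (N <= n)%nat -> (Cmod (u n - l) <= b n)%R) ->
  is_lim_seq b 0%R -> ccv u l.
Proof.
  intros Hle Hb eps He. apply is_lim_seq_spec in Hb.
  destruct (Hb (mkposreal eps He)) as [N' HN']. exists (max N N'). intros n Hn.
  eapply Rle_lt_trans; [apply Hle; lia|]. specialize (HN' n ltac:(lia)). simpl in HN'.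
  rewrite Rminus_0_r in HN'. eapply Rle_lt_trans; [apply Rle_abs|exact HN'].
Qed.

Lemma ccv_ext_loc (u v : nat -> C) (l : C) (N : nat) :
  (forall n, (N <= n)%nat -> u n = v n) -> ccv u l -> ccv v l.
Proof.
  intros H Hu eps He. destruct (Hu eps He) as [M HM]. exists (max M N). intros n Hn.
  rewrite <- H by lia. apply HM; lia.
Qed.

Lemma ccv_ext (u v : nat -> C) (l : C) : (forall n, u n = v n) -> ccv u l -> ccv v l.
Proof. intros H. apply ccv_ext_loc with (N := O). auto. Qed.

Lemma ccv_const (c : C) : ccv (fun _ => c) c.
Proof.
  intros eps He. exists O. intros n _. replace (c - c) with (RtoC 0) by ring.
  now rewrite Cmod_0.
Qed.

Lemma ccv_plus (u v : nat -> C) (l m : C) :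
  ccv u l -> ccv v m -> ccv (fun n => u n + v n) (l + m).
Proof.
  intros Hu Hv eps He. destruct (Hu (eps / 2)%R ltac:(lra)) as [N HN].
  destruct (Hv (eps / 2)%R ltac:(lra)) as [M HM]. exists (max N M). intros n Hn.
  replace (u n + v n - (l + m)) with ((u n - l) + (v n - m)) by ring.
  eapply Rle_lt_trans; [apply Cmod_triangle|].
  specialize (HN n ltac:(lia)). specialize (HM n ltac:(lia)). lra.
Qed.

Lemma ccv_bounded (u : nat -> C) (l : C) :
  ccv u l -> exists B, (0 < B)%R /\ forall n, (Cmod (u n) <= B)%R.
Proof.
  intros Hu. destruct (Hu 1%R ltac:(lra)) as [N HN].
  assert (Hfin : exists B, (0 <= B)%R /\ forall n, (n < N)%nat -> (Cmod (u n) <= B)%R).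
  { clear HN. induction N as [|N [B [HB0 HB]]].
    - exists 0%R. split; [lra|]. intros n Hn; lia.
    - exists (Rmax B (Cmod (u N))). split.
      + eapply Rle_trans; [exact HB0|apply Rmax_l].
      + intros n Hn. destruct (Nat.eq_dec n N) as [->|Hne]; [apply Rmax_r|].
        eapply Rle_trans; [apply HB; lia|apply Rmax_l]. }
  destruct Hfin as [B [HB0 HB]]. exists (B + (1 + Cmod l))%R.
  pose proof (Cmod_ge_0 l). split; [lra|]. intros n.
  destruct (le_lt_dec N n) as [H1|H1].
  - specialize (HN n H1). pose proof (Cmod_triangle_minus (u n) l). lra.
  - specialize (HB n H1). lra.
Qed.

Lemma ccv_mult (u v : nat -> C) (l m : C) :
  ccv u l -> ccv v m -> ccv (fun n => u n * v n) (l * m).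
Proof.
  intros Hu Hv. destruct (ccv_bounded v m Hv) as [B [HB0 HB]].
  intros eps He. pose proof (Cmod_ge_0 l) as Hl.
  destruct (Hu (eps / (2 * B))%R) as [N HN].
  { apply Rdiv_lt_0_compat; lra. }
  destruct (Hv (eps / (2 * (Cmod l + 1)))%R) as [M HM].
  { apply Rdiv_lt_0_compat; lra. }
  exists (max N M). intros n Hn.
  replace (u n * v n - l * m) with ((u n - l) * v n + l * (v n - m)) by ring.
  eapply Rle_lt_trans; [apply Cmod_triangle|]. rewrite !Cmod_mult.
  specialize (HN n ltac:(lia)). specialize (HM n ltac:(lia)). specialize (HB n).
  assert (E1 : (Cmod (u n - l) * Cmod (v n) <= Cmod (u n - l) * B)%R)
    by (apply Rmult_le_compat_l; [apply Cmod_ge_0|exact HB]).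
  assert (E2 : (Cmod (u n - l) * B < eps / (2 * B) * B)%R)
    by (apply Rmult_lt_compat_r; lra).
  assert (E3 : (Cmod l * Cmod (v n - m) <= (Cmod l + 1) * Cmod (v n - m))%R)
    by (apply Rmult_le_compat_r; [apply Cmod_ge_0|lra]).
  assert (E4 : ((Cmod l + 1) * Cmod (v n - m) < (Cmod l + 1) * (eps / (2 * (Cmod l + 1))))%R)
    by (apply Rmult_lt_compat_l; lra).
  replace (eps / (2 * B) * B)%R with (eps / 2)%R in E2 by (field; lra).
  replace ((Cmod l + 1) * (eps / (2 * (Cmod l + 1))))%R with (eps / 2)%R in E4 by (field; lra).
  lra.
Qed.

Lemma ccv_scal (c : C) (u : nat -> C) (l : C) : ccv u l -> ccv (fun n => c * u n) (c * l).
Proof. intros H. apply ccv_mult; [apply ccv_const|exact H]. Qed.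

Lemma ccv_opp (u : nat -> C) (l : C) : ccv u l -> ccv (fun n => - u n) (- l).
Proof.
  intros H. apply (ccv_scal (-1)) in H. replace (- l) with (-1 * l) by ring.
  eapply ccv_ext; [|exact H]. intros n. simpl. ring.
Qed.

Lemma ccv_minus (u v : nat -> C) (l m : C) :
  ccv u l -> ccv v m -> ccv (fun n => u n - v n) (l - m).
Proof. intros Hu Hv. apply ccv_plus; [exact Hu|now apply ccv_opp]. Qed.

Lemma ccv_Cmod_ge (u : nat -> C) (l : C) :
  ccv u l -> l <> 0 -> exists N, forall n, (N <= n)%nat -> (Cmod l / 2 <= Cmod (u n))%R.
Proof.
  intros Hu Hl. apply Cmod_gt_0 in Hl. destruct (Hu (Cmod l / 2)%R ltac:(lra)) as [N HN].
  exists N. intros n Hn. specialize (HN n Hn).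
  rewrite Cmod_minus_sym in HN. pose proof (Cmod_triangle_minus l (u n)). lra.
Qed.

Lemma ccv_inv (u : nat -> C) (l : C) : ccv u l -> l <> 0 -> ccv (fun n => / u n) (/ l).
Proof.
  intros Hu Hl. destruct (ccv_Cmod_ge u l Hu Hl) as [N HN].
  assert (Hl' := proj1 (Cmod_gt_0 l) Hl).
  intros eps He. destruct (Hu (eps * (Cmod l / 2 * Cmod l))%R) as [M HM].
  { repeat apply Rmult_lt_0_compat; lra. }
  exists (max N M). intros n Hn. specialize (HN n ltac:(lia)). specialize (HM n ltac:(lia)).
  assert (Hun : u n <> 0). { apply Cmod_gt_0. lra. }
  replace (/ u n - / l) with (- (u n - l) / (u n * l)) by (field; auto).
  rewrite Cmod_div, Cmod_opp, Cmod_mult by (apply Cmult_neq_0; auto).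
  apply Rmult_lt_reg_r with (Cmod (u n) * Cmod l)%R; [apply Rmult_lt_0_compat; lra|].
  unfold Rdiv. rewrite Rmult_assoc, Rinv_l, Rmult_1_r
    by (apply Rgt_not_eq, Rmult_lt_0_compat; lra).
  eapply Rlt_le_trans; [exact HM|]. apply Rmult_le_compat_l; [lra|].
  apply Rmult_le_compat_r; lra.
Qed.

Lemma ccv_div (u v : nat -> C) (l m : C) :
  ccv u l -> ccv v m -> m <> 0 -> ccv (fun n => u n / v n) (l / m).
Proof. intros Hu Hv Hm. apply ccv_mult; [exact Hu|now apply ccv_inv]. Qed.

Lemma ccv_Cmod_le (u : nat -> C) (l : C) (B : R) (N : nat) :
  (forall n, (N <= n)%nat -> (Cmod (u n) <= B)%R) -> ccv u l -> (Cmod l <= B)%R.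
Proof.
  intros Hle Hu. apply Rnot_lt_le. intros Hlt.
  destruct (Hu (Cmod l - B)%R ltac:(lra)) as [M HM].
  specialize (HM (max N M) ltac:(lia)). specialize (Hle (max N M) ltac:(lia)).
  rewrite Cmod_minus_sym in HM. pose proof (Cmod_triangle_minus l (u (max N M))). lra.
Qed.

Lemma ccv_unique (u : nat -> C) (l m : C) : ccv u l -> ccv u m -> l = m.
Proof.
  intros Hu Hv. pose proof (ccv_minus u u l m Hu Hv) as H.
  apply Ceq_minus, Cmod_eq_0. apply Rle_antisym; [|apply Cmod_ge_0].
  apply (ccv_Cmod_le _ _ 0%R O) in H; [exact H|]. intros n _.
  replace (u n - u n) with (RtoC 0) by ring. rewrite Cmod_0. lra.
Qed.

Lemma ccv_subseq (u : nat -> C) (l : C) (f : nat -> nat) :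
  (forall n, (n <= f n)%nat) -> ccv u l -> ccv (fun n => u (f n)) l.
Proof.
  intros Hf Hu eps He. destruct (Hu eps He) as [N HN]. exists N. intros n Hn.
  apply HN. specialize (Hf n). lia.
Qed.

Lemma ccv_shift (u : nat -> C) (l : C) (k : nat) :
  ccv (fun n => u (n + k)%nat) l -> ccv u l.
Proof.
  intros Hu eps He. destruct (Hu eps He) as [N HN]. exists (N + k)%nat. intros n Hn.
  replace n with ((n - k) + k)%nat by lia. apply HN. lia.
Qed.

Lemma ccv_RtoC (u : nat -> R) (l : R) : is_lim_seq u l -> ccv (fun n => RtoC (u n)) (RtoC l).
Proof.
  intros H eps He. apply is_lim_seq_spec in H. destruct (H (mkposreal eps He)) as [N HN].
  exists N. intros n Hn. rewrite <- RtoC_minus, Cmod_R. apply (HN n Hn).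
Qed.

Lemma Re_minus (x y : C) : Re (x - y) = (Re x - Re y)%R.
Proof. reflexivity. Qed.
Lemma Im_minus (x y : C) : Im (x - y) = (Im x - Im y)%R.
Proof. reflexivity. Qed.

Lemma im_le_Cmod (c : C) : (Rabs (Im c) <= Cmod c)%R.
Proof. eapply Rle_trans; [apply Rmax_r|apply Rmax_Cmod]. Qed.

Lemma ccv_CLim (u : nat -> C) (l : C) : ccv u l -> CLim u = l.
Proof.
  intros H. unfold CLim.
  assert (H1 : is_lim_seq (fun N => Re (u N)) (Re l)).
  { apply is_lim_seq_spec. intros eps. destruct (H eps (cond_pos eps)) as [N HN].
    exists N. intros n Hn. rewrite <- Re_minus.
    eapply Rle_lt_trans; [apply re_le_Cmod|auto]. }
  assert (H2 : is_lim_seq (fun N => Im (u N)) (Im l)).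
  { apply is_lim_seq_spec. intros eps. destruct (H eps (cond_pos eps)) as [N HN].
    exists N. intros n Hn. rewrite <- Im_minus.
    eapply Rle_lt_trans; [apply im_le_Cmod|auto]. }
  rewrite (is_lim_seq_unique _ _ H1), (is_lim_seq_unique _ _ H2). simpl.
  now destruct l.
Qed.

(** * Finite sums, series and dominated convergence *)

Lemma csum_ext (n : nat) (f g : nat -> C) :
  (forall k, (k < n)%nat -> f k = g k) -> csum n f = csum n g.
Proof.
  induction n as [|n IH]; intros H; simpl; [easy|].
  rewrite IH, H by (auto; intros; apply H; lia). reflexivity.
Qed.

Lemma csum_plus (n : nat) (f g : nat -> C) :
  csum n (fun k => f k + g k) = csum n f + csum n g.
Proof. induction n as [|n IH]; simpl; [ring|rewrite IH; ring]. Qed.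

Lemma csum_scal (n : nat) (c : C) (f : nat -> C) :
  csum n (fun k => c * f k) = c * csum n f.
Proof. induction n as [|n IH]; simpl; [ring|rewrite IH; ring]. Qed.

Lemma csum_add (m n : nat) (f : nat -> C) :
  csum (m + n) f = csum m f + csum n (fun k => f (m + k)%nat).
Proof.
  induction n as [|n IH]; [rewrite Nat.add_0_r; simpl; ring|].
  rewrite Nat.add_succ_r. simpl. rewrite IH. ring.
Qed.

Lemma csum_rev (n : nat) (f : nat -> C) :
  csum n (fun k => f (n - 1 - k)%nat) = csum n f.
Proof.
  induction n as [|n IH]; [easy|].
  transitivity (csum (1 + n) (fun k => f (S n - 1 - k)%nat)); [reflexivity|].
  rewrite csum_add. change (csum (S n) f) with (csum n f + f n). rewrite <- IH.
  rewrite (csum_ext n (fun k => f (S n - 1 - (1 + k))%nat) (fun k => f (n - 1 - k)%nat)).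
  - change (csum 1 (fun k => f (S n - 1 - k)%nat)) with (0 + f (S n - 1 - 0)%nat).
    replace (S n - 1 - 0)%nat with n by lia. ring.
  - intros k Hk. f_equal. lia.
Qed.

Fixpoint rsum (n : nat) (f : nat -> R) : R :=
  match n with O => 0%R | S m => (rsum m f + f m)%R end.

Lemma sum_n_rsum (n : nat) (f : nat -> R) : sum_n f n = rsum (S n) f.
Proof.
  induction n as [|n IH]; [rewrite sum_O; simpl; ring|].
  rewrite sum_Sn, IH. reflexivity.
Qed.

Lemma rsum_le (n : nat) (f g : nat -> R) :
  (forall k, (k < n)%nat -> (f k <= g k)%R) -> (rsum n f <= rsum n g)%R.
Proof.
  induction n as [|n IH]; intros H; simpl; [lra|].
  specialize (IH (fun k Hk => H k ltac:(lia))). specialize (H n ltac:(lia)). lra.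
Qed.

Lemma rsum_scal (n : nat) (c : R) (f : nat -> R) :
  rsum n (fun k => c * f k)%R = (c * rsum n f)%R.
Proof. induction n as [|n IH]; simpl; [ring|rewrite IH; ring]. Qed.

Lemma Cmod_csum (n : nat) (f : nat -> C) :
  (Cmod (csum n f) <= rsum n (fun k => Cmod (f k)))%R.
Proof.
  induction n as [|n IH]; simpl; [rewrite Cmod_0; lra|].
  eapply Rle_trans; [apply Cmod_triangle|lra].
Qed.

Lemma sum_n_csum (n : nat) (f : nat -> C) : sum_n f n = csum (S n) f.
Proof.
  induction n as [|n IH]; [rewrite sum_O; symmetry; apply Cplus_0_l|].
  rewrite sum_Sn, IH. reflexivity.
Qed.

Lemma is_series_ccv (u : nat -> C) (l : C) :
  ccv (fun n => csum n u) l -> is_series u l.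
Proof.
  intros H. unfold is_series. apply filterlim_locally. intros eps.
  destruct (H eps (cond_pos eps)) as [N HN]. exists N. intros n Hn.
  (* The balls of C are those of a product of two lines; the compatibility lemma passes from the
     modulus to them. [sum_n] at n has n + 1 terms, hence [S n]. *)
  rewrite sum_n_csum. apply C_NormedModule_mixin_compat1. apply (HN (S n)). lia.
Qed.

Lemma ccv_is_series (u : nat -> C) (l : C) :
  is_series u l -> ccv (fun n => csum n u) l.
Proof.
  intros H. apply (ccv_shift _ _ 1). unfold is_series in H.
  assert (H' := proj1 (filterlim_locally_ball_norm _ _) H).
  intros eps He. specialize (H' (mkposreal eps He)).
  destruct H' as [N HN]. exists N. intros n Hn. specialize (HN n Hn).
  rewrite Nat.add_1_r, <- sum_n_csum. exact HN.
Qed.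

Lemma CSeries_ccv (u : nat -> C) (l : C) : ccv (fun n => csum n u) l -> CSeries u = l.
Proof.
  intros H. apply ccv_CLim. apply (ccv_subseq _ _ S) in H; [exact H|auto].
Qed.

Lemma ccv_csum_le (u : nat -> C) (b : nat -> R) :
  (forall n, (Cmod (u n) <= b n)%R) -> ex_series b -> exists l, ccv (fun n => csum n u) l.
Proof.
  intros Hle Hb.
  assert (H : @ex_series C_AbsRing C_CompleteNormedModule u).
  { apply ex_series_le with (b := b); [exact Hle|exact Hb]. }
  destruct H as [l Hl]. exists l. apply ccv_is_series. exact Hl.
Qed.

Lemma rsum_le_Series (b : nat -> R) (n : nat) :
  (forall k, (0 <= b k)%R) -> ex_series b -> (rsum n b <= Series b)%R.
Proof.
  intros Hb Hs. destruct n as [|n].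
  - eapply Rle_trans; [|apply (is_lim_seq_incr_compare (sum_n b) (Series b) (Series_correct _ Hs)) with (n := O)].
    + rewrite sum_O. apply Hb.
    + intros k. rewrite sum_Sn. specialize (Hb (S k)). unfold plus; simpl. lra.
  - rewrite <- sum_n_rsum. apply (is_lim_seq_incr_compare (sum_n b) (Series b)).
    + apply Series_correct, Hs.
    + intros k. rewrite sum_Sn. specialize (Hb (S k)). unfold plus; simpl. lra.
Qed.

Lemma tail_small (b : nat -> R) :
  (forall k, (0 <= b k)%R) -> ex_series b -> forall eps : R, (0 < eps)%R ->
  exists N, forall n, (rsum (N + n) b - rsum N b <= eps)%R.
Proof.
  intros Hb Hs eps He. pose proof (Series_correct _ Hs) as H.
  assert (H' : is_lim_seq (sum_n b) (Series b)) by exact H.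
  apply is_lim_seq_spec in H'. destruct (H' (mkposreal eps He)) as [N HN].
  exists (S N). intros n. specialize (HN N (le_n N)). simpl in HN.
  rewrite sum_n_rsum in HN. pose proof (rsum_le_Series b (S N + n) Hb Hs) as H1.
  apply Rabs_def2 in HN. lra.
Qed.

(** Dominated convergence for sums whose length grows with the parameter: beyond a fixed K the
    majorant makes all tails small at once, and the first K terms converge one by one. The majorant
    is asked for k < M only, the range in which the truncated Gamma quotients can be estimated. *)
Lemma Tannery (f : nat -> nat -> C) (g : nat -> C) (b : nat -> R) (M0 : nat) :
  (forall k, ccv (fun M => f M k) (g k)) ->
  (forall M k, (M0 <= M)%nat -> (k < M)%nat -> (Cmod (f M k) <= b k)%R) ->
  ex_series b ->
  exists l, ccv (fun n => csum n g) l /\ ccv (fun M => csum M (f M)) l.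
Proof.
  intros Hc Hle Hb.
  (* For fixed k the bound holds as soon as M exceeds k, so it passes to the limit. *)
  assert (Hg : forall k, (Cmod (g k) <= b k)%R).
  { intros k. apply (ccv_Cmod_le (fun M => f M k) _ _ (max M0 (S k))); [|apply Hc].
    intros M HM. apply Hle; lia. }
  assert (Hb0 : forall k, (0 <= b k)%R).
  { intros k. eapply Rle_trans; [apply Cmod_ge_0|apply Hg]. }
  destruct (ccv_csum_le g b Hg Hb) as [l Hl]. exists l. split; [exact Hl|].
  intros eps He. destruct (tail_small b Hb0 Hb (eps / 4)%R ltac:(lra)) as [K HK].
  assert (Hfin : ccv (fun M => csum K (f M)) (csum K g)).
  { clear HK. induction K as [|K IH]; simpl; [apply ccv_const|].
    apply ccv_plus; [exact IH|apply Hc]. }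
  destruct (Hfin (eps / 4)%R ltac:(lra)) as [N1 HN1].
  destruct (Hl (eps / 4)%R ltac:(lra)) as [N2 HN2].
  exists (max (max M0 K) (max N1 N2)). intros M HM.
  specialize (HN1 M ltac:(lia)). specialize (HN2 M ltac:(lia)).
  assert (Htail : forall h : nat -> C, (forall k, (k < M)%nat -> (Cmod (h k) <= b k)%R) ->
    (Cmod (csum M h - csum K h) <= eps / 4)%R).
  { intros h Hh. replace M with (K + (M - K))%nat by lia. rewrite csum_add.
    match goal with |- (Cmod ?z <= _)%R =>
      replace z with (csum (M - K) (fun k => h (K + k)%nat)) by ring end.
    eapply Rle_trans; [apply Cmod_csum|].
    eapply Rle_trans; [|apply (HK (M - K)%nat)].
    assert (Hr : forall m, rsum (K + m) b = (rsum K b + rsum m (fun k => b (K + k)%nat))%R).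
    { induction m as [|m IHm]; [rewrite Nat.add_0_r; simpl; ring|].
      rewrite Nat.add_succ_r. simpl. rewrite IHm. ring. }
    rewrite Hr. ring_simplify. apply rsum_le. intros k Hk. apply Hh. lia. }
  pose proof (Htail (f M) (fun k Hk => Hle M k ltac:(lia) Hk)) as T1.
  pose proof (Htail g (fun k Hk => Hg k)) as T2.
  replace (csum M (f M) - l) with
    ((csum M (f M) - csum K (f M)) + ((csum K (f M) - csum K g)
      + ((csum K g - csum M g) + (csum M g - l)))) by ring.
  eapply Rle_lt_trans; [apply Cmod_triangle|].
  pose proof (Cmod_triangle (csum K (f M) - csum K g) ((csum K g - csum M g) + (csum M g - l))).
  pose proof (Cmod_triangle (csum K g - csum M g) (csum M g - l)).
  rewrite (Cmod_minus_sym (csum K g)) in *. lra.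
Qed.

(** * Products and the complex exponential *)

(** Powers of n + 1 are written exp (c * lnS n), which turns products of estimates into linear
    inequalities between logarithms. The shift by one keeps the logarithm nonnegative from n = 0
    on. *)
Definition lnS (n : nat) : R := ln (INR (S n)).

Lemma lnS_0 : lnS 0 = 0%R.
Proof. apply ln_1. Qed.

Lemma exp_lnS (n : nat) : exp (lnS n) = INR (S n).
Proof. apply exp_ln, lt_0_INR. lia. Qed.

Lemma lnS_le (m n : nat) : (m <= n)%nat -> (lnS m <= lnS n)%R.
Proof.
  intros H. unfold lnS. apply ln_le; [apply lt_0_INR; lia|apply le_INR; lia].
Qed.

Lemma lnS_ge0 (n : nat) : (0 <= lnS n)%R.
Proof. rewrite <- lnS_0. apply lnS_le. lia. Qed.

Lemma ln_le_minus1 (x : R) : (0 < x)%R -> (ln x <= x - 1)%R.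
Proof.
  intros Hx. pose proof (exp_ineq1_le (ln x)). rewrite exp_ln in H by exact Hx. lra.
Qed.

Lemma lnS_incr_ub (n : nat) : (lnS (S n) - lnS n <= / INR (S n))%R.
Proof.
  assert (H : (0 < INR (S n))%R) by (apply lt_0_INR; lia).
  unfold lnS. rewrite (S_INR (S n)), <- ln_div by lra.
  eapply Rle_trans; [apply ln_le_minus1, Rdiv_lt_0_compat; lra|].
  apply Req_le. field. lra.
Qed.

Lemma lnS_incr_lb (n : nat) : (/ INR (S (S n)) <= lnS (S n) - lnS n)%R.
Proof.
  assert (H : (0 < INR (S n))%R) by (apply lt_0_INR; lia).
  unfold lnS. rewrite (S_INR (S n)).
  apply Ropp_le_cancel. rewrite Ropp_minus_distr, <- ln_div by lra.
  eapply Rle_trans; [apply ln_le_minus1, Rdiv_lt_0_compat; lra|].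
  apply Req_le. field. lra.
Qed.

(** * Convergent series and infinite products *)

Lemma ex_series_bounded (b : nat -> R) (B : R) :
  (forall k, (0 <= b k)%R) -> (forall n, (rsum n b <= B)%R) -> ex_series b.
Proof.
  intros Hb HB. destruct (ex_finite_lim_seq_incr (sum_n b) B) as [l Hl].
  - intros n. rewrite sum_Sn. specialize (Hb (S n)). unfold plus; simpl. lra.
  - intros n. rewrite sum_n_rsum. apply HB.
  - exists l. exact Hl.
Qed.

Lemma exp_le_mono (a b : R) : (a <= b)%R -> (exp a <= exp b)%R.
Proof. intros [H|H]; [left; now apply exp_increasing|right; now rewrite H]. Qed.

(** Telescoping replaces the integral test: s (n+2)^(-1-s) <= (n+1)^(-s) - (n+2)^(-s), by exp x >= 1
    + x and ln(n+2) - ln(n+1) >= 1/(n+2). *)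
Lemma p_series (s : R) : (0 < s)%R -> ex_series (fun k => exp ((-1 - s) * lnS k)).
Proof.
  intros Hs. apply ex_series_bounded with (B := (1 + / s)%R).
  - intros k. left. apply exp_pos.
  - intros n.
    assert (H : (rsum (S n) (fun k => exp ((-1 - s) * lnS k))
                 <= 1 + / s * (1 - exp (- s * lnS n)))%R).
    { induction n as [|n IH].
      - simpl. rewrite lnS_0, !Rmult_0_r, exp_0. lra.
      - change (rsum (S (S n)) (fun k => exp ((-1 - s) * lnS k)))
          with (rsum (S n) (fun k => exp ((-1 - s) * lnS k)) + exp ((-1 - s) * lnS (S n)))%R.
        eapply Rle_trans; [apply Rplus_le_compat_r, IH|].
        enough (s * exp ((-1 - s) * lnS (S n)) <= exp (- s * lnS n) - exp (- s * lnS (S n)))%R.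
        { apply (Rmult_le_compat_l (/ s)) in H; [|left; apply Rinv_0_lt_compat; lra].
          rewrite <- Rmult_assoc, Rinv_l, Rmult_1_l in H by lra. lra. }
        replace ((-1 - s) * lnS (S n))%R with (- s * lnS (S n) + - lnS (S n))%R by ring.
        rewrite exp_plus, exp_Ropp, exp_lnS.
        replace (- s * lnS n)%R with (- s * lnS (S n) + s * (lnS (S n) - lnS n))%R at 1 by ring.
        rewrite exp_plus. pose proof (exp_pos (- s * lnS (S n))) as He.
        pose proof (exp_ineq1_le (s * (lnS (S n) - lnS n))) as H1.
        pose proof (lnS_incr_lb n) as H2.
        assert (H3 : (s * / INR (S (S n)) <= s * (lnS (S n) - lnS n))%R)
          by (apply Rmult_le_compat_l; lra).
        assert (H4 : (exp (- s * lnS (S n)) * (s * / INR (S (S n)))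
          <= exp (- s * lnS (S n)) * (exp (s * (lnS (S n) - lnS n)) - 1))%R)
          by (apply Rmult_le_compat_l; lra).
        lra. }
    pose proof (exp_pos (- s * lnS n)). pose proof (Rinv_0_lt_compat s Hs).
    assert (rsum n (fun k => exp ((-1 - s) * lnS k)) <= rsum (S n) (fun k => exp ((-1 - s) * lnS k)))%R.
    { simpl. pose proof (exp_pos ((-1 - s) * lnS n)). lra. }
    nra.
Qed.

Lemma ex_series_inv_sq : ex_series (fun k => / (INR (S k)) ^ 2)%R.
Proof.
  eapply ex_series_ext; [|apply (p_series 1); lra].
  intros n. simpl. replace ((-1 - 1) * lnS n)%R with (- lnS n + - lnS n)%R by ring.
  rewrite exp_plus, exp_Ropp, exp_lnS. rewrite Rmult_1_r, Rinv_mult. reflexivity.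
Qed.

Lemma series_cv_increments (u : nat -> C) (c : R) (N : nat) :
  (forall n, (N <= n)%nat -> (Cmod (u (S n) - u n) <= c * / (INR (S n)) ^ 2)%R) ->
  exists l, ccv u l.
Proof.
  intros H.
  assert (Hc : (0 <= c)%R).
  { specialize (H N (le_n N)). pose proof (Cmod_ge_0 (u (S N) - u N)).
    assert (0 < INR (S N))%R by (apply lt_0_INR; lia).
    assert (0 < / INR (S N) ^ 2)%R by (apply Rinv_0_lt_compat, pow_lt; lra). nra. }
  destruct (ccv_csum_le (fun k => u (S k + N)%nat - u (k + N)%nat)
             (fun k => c * / (INR (S k)) ^ 2)%R) as [l Hl].
  - intros n. eapply Rle_trans; [apply (H (n + N)%nat); lia|].
    apply Rmult_le_compat_l; [exact Hc|]. apply Rinv_le_contravar.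
    + apply pow_lt, lt_0_INR. lia.
    + apply pow_incr. split; [apply pos_INR|apply le_INR; lia].
  - apply ex_series_scal with (c := c) (a := fun k => (/ (INR (S k)) ^ 2)%R). apply ex_series_inv_sq.
  - exists (l + u N). apply (ccv_shift _ _ N).
    eapply ccv_ext; [|apply ccv_plus; [exact Hl|apply ccv_const]].
    intros n. cbv beta. induction n as [|n IH]; simpl; [ring|].
    replace (u (n + N)%nat) with (csum n (fun k => u (S k + N)%nat - u (k + N)%nat) + u N) by exact IH.
    simpl. ring.
Qed.

(** A discrete Gronwall estimate: each step multiplies the modulus by at most exp (c / (n+1)^2), and
    these exponents are summable. *)
Lemma product_bounded (u : nat -> C) (c : R) (N : nat) :
  (forall n, (N <= n)%nat -> (Cmod (u (S n) - u n) <= c * / (INR (S n)) ^ 2 * Cmod (u n))%R) ->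
  (0 <= c)%R ->
  exists B, (0 <= B)%R /\ forall n, (N <= n)%nat -> (Cmod (u n) <= B)%R.
Proof.
  intros H Hc.
  set (b := fun k => (/ (INR (S k)) ^ 2)%R).
  assert (Hb : forall k, (0 <= b k)%R).
  { intros k. left. apply Rinv_0_lt_compat, pow_lt, lt_0_INR. lia. }
  exists (Cmod (u N) * exp (c * Series b))%R. split.
  { apply Rmult_le_pos; [apply Cmod_ge_0|left; apply exp_pos]. }
  assert (H1 : forall k, (Cmod (u (N + k)%nat) <= Cmod (u N) * exp (c * rsum k b))%R).
  { induction k as [|k IH].
    - simpl. rewrite Nat.add_0_r, Rmult_0_r, exp_0. lra.
    - rewrite Nat.add_succ_r. change (rsum (S k) b) with (rsum k b + b k)%R.
      rewrite Rmult_plus_distr_l, exp_plus, <- Rmult_assoc.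
      specialize (H (N + k)%nat ltac:(lia)).
      pose proof (Cmod_triangle (u (S (N + k)) - u (N + k)%nat) (u (N + k)%nat)) as T.
      replace (u (S (N + k)) - u (N + k)%nat + u (N + k)%nat) with (u (S (N + k))) in T by ring.
      assert (Hk : (/ (INR (S (N + k))) ^ 2 <= b k)%R).
      { apply Rinv_le_contravar; [apply pow_lt, lt_0_INR; lia|].
        apply pow_incr. split; [apply pos_INR|apply le_INR; lia]. }
      pose proof (Cmod_ge_0 (u (N + k)%nat)) as H0.
      pose proof (exp_ineq1_le (c * b k)) as He.
      assert (A1 : (c * / INR (S (N + k)) ^ 2 * Cmod (u (N + k)%nat) <= c * b k * Cmod (u (N + k)%nat))%R).
      { apply Rmult_le_compat_r; [exact H0|]. apply Rmult_le_compat_l; lra. }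
      assert (A2 : ((1 + c * b k) * Cmod (u (N + k)%nat) <= exp (c * b k) * Cmod (u (N + k)%nat))%R).
      { apply Rmult_le_compat_r; lra. }
      assert (A3 : (exp (c * b k) * Cmod (u (N + k)%nat) <= exp (c * b k) * (Cmod (u N) * exp (c * rsum k b)))%R).
      { apply Rmult_le_compat_l; [left; apply exp_pos|exact IH]. }
      lra. }
  intros n Hn. replace n with (N + (n - N))%nat by lia.
  eapply Rle_trans; [apply H1|]. apply Rmult_le_compat_l; [apply Cmod_ge_0|].
  destruct (Req_dec (c * rsum (n - N) b) (c * Series b)) as [->|Hne]; [lra|].
  left. apply exp_increasing.
  pose proof (rsum_le_Series b (n - N) Hb ex_series_inv_sq). nra.
Qed.

Lemma product_cv (u : nat -> C) (c : R) (N : nat) :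
  (0 <= c)%R ->
  (forall n, (N <= n)%nat -> (Cmod (u (S n) - u n) <= c * / (INR (S n)) ^ 2 * Cmod (u n))%R) ->
  exists l, ccv u l.
Proof.
  intros Hc H. destruct (product_bounded u c N H Hc) as [B [HB0 HB]].
  apply (series_cv_increments u (c * B) N). intros n Hn.
  eapply Rle_trans; [apply H, Hn|].
  assert (0 <= c * / INR (S n) ^ 2)%R.
  { apply Rmult_le_pos; [exact Hc|]. left. apply Rinv_0_lt_compat, pow_lt, lt_0_INR. lia. }
  specialize (HB n Hn). nra.
Qed.

(** The inverses satisfy the same kind of bound with 2c once c / (n+1)^2 <= 1/2, for then |u (S n)|
    is at least half of |u n|. So they converge too, and the product of the two limits is 1. *)
Lemma product_cv_nonzero (u : nat -> C) (c : R) (N : nat) :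
  (0 <= c)%R -> (forall n, (N <= n)%nat -> u n <> 0) ->
  (forall n, (N <= n)%nat -> (Cmod (u (S n) - u n) <= c * / (INR (S n)) ^ 2 * Cmod (u n))%R) ->
  exists l, ccv u l /\ l <> 0.
Proof.
  intros Hc Hnz H. destruct (product_cv u c N Hc H) as [l Hl]. exists l. split; [exact Hl|].
  destruct (nfloor_ex (2 * c) ltac:(lra)) as [K [_ HK]].
  destruct (product_cv (fun n => / u n) (2 * c) (max N K)) as [l' Hl'].
  - lra.
  - intros n Hn. specialize (Hnz n ltac:(lia)) as H1. specialize (Hnz (S n) ltac:(lia)) as H2.
    specialize (H n ltac:(lia)).
    replace (/ u (S n) - / u n) with (- (u (S n) - u n) / (u (S n) * u n)) by (field; auto).
    rewrite Cmod_div, Cmod_opp, Cmod_mult, Cmod_inv by (try apply Cmult_neq_0; auto).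
    apply Cmod_gt_0 in H1, H2.
    set (q := (/ INR (S n) ^ 2)%R) in *.
    assert (HSn : (0 < INR (S n))%R) by (apply lt_0_INR; lia).
    assert (Hq : (0 < q)%R) by (apply Rinv_0_lt_compat, pow_lt; lra).
    assert (Hcq : (c * q <= / 2)%R).
    { assert (HKn : (2 * c <= INR (S n) ^ 2)%R).
      { assert (INR K + 1 <= INR (S n))%R by (rewrite S_INR; apply Rplus_le_compat_r, le_INR; lia).
        pose proof (pos_INR K).
        assert (1 <= INR (S n))%R by (rewrite S_INR; pose proof (pos_INR n); lra). nra. }
      assert (q * INR (S n) ^ 2 = 1)%R.
      { unfold q. apply Rinv_l. apply pow_nonzero. lra. }
      nra. }
    pose proof (Cmod_triangle_minus (u n) (u (S n))) as T. rewrite Cmod_minus_sym in T.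
    assert (Hhalf : (Cmod (u n) <= 2 * Cmod (u (S n)))%R) by nra.
    apply Rmult_le_reg_r with (Cmod (u (S n)) * Cmod (u n))%R; [apply Rmult_lt_0_compat; lra|].
    replace (Cmod (u (S n) - u n) / (Cmod (u (S n)) * Cmod (u n)) * (Cmod (u (S n)) * Cmod (u n)))%R
      with (Cmod (u (S n) - u n)) by (field; lra).
    replace (2 * c * q * / Cmod (u n) * (Cmod (u (S n)) * Cmod (u n)))%R
      with (2 * c * q * Cmod (u (S n)))%R by (field; lra).
    assert (0 <= c * q)%R by nra. nra.
  - intros E. subst l. pose proof (ccv_mult _ _ _ _ Hl Hl') as Hm.
    assert (H1 : ccv (fun n => u n * / u n) 1).
    { apply ccv_ext_loc with (u := fun _ => RtoC 1) (N := N); [|apply ccv_const].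
      intros n Hn. symmetry. apply Cinv_r. now apply Hnz. }
    pose proof (ccv_unique _ _ _ Hm H1) as E. rewrite Cmult_0_l in E.
    apply C1_nz. now rewrite <- E.
Qed.

(** * The complex exponential *)

Lemma Cexp_plus (z w : C) : Cexp (z + w) = Cexp z * Cexp w.
Proof.
  destruct z as [a b], w as [c d]. unfold Cexp, Cmult, Re, Im; simpl.
  rewrite exp_plus, cos_plus, sin_plus. f_equal; ring.
Qed.

Lemma Cexp_0 : Cexp 0 = 1.
Proof. unfold Cexp; simpl. rewrite exp_0, cos_0, sin_0. unfold RtoC. f_equal; ring. Qed.

Lemma Cexp_opp_r (z : C) : Cexp z * Cexp (- z) = 1.
Proof. rewrite <- Cexp_plus. replace (z + - z) with (RtoC 0) by ring. apply Cexp_0. Qed.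

Lemma Cexp_neq_0 (z : C) : Cexp z <> 0.
Proof.
  intros H. pose proof (Cexp_opp_r z) as E. rewrite H, Cmult_0_l in E.
  apply C1_nz. now rewrite <- E.
Qed.

Lemma Cexp_opp (z : C) : Cexp (- z) = / Cexp z.
Proof.
  pose proof (Cexp_neq_0 z) as H. pose proof (Cexp_opp_r z) as E.
  apply (f_equal (Cmult (/ Cexp z))) in E. rewrite Cmult_assoc, Cinv_l in E by exact H.
  rewrite Cmult_1_l, Cmult_1_r in E. exact E.
Qed.

Lemma Cexp_R (x : R) : Cexp (RtoC x) = RtoC (exp x).
Proof. unfold Cexp, RtoC; simpl. rewrite cos_0, sin_0. f_equal; ring. Qed.

Lemma Cmod_Cexp (z : C) : Cmod (Cexp z) = exp (Re z).
Proof.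
  unfold Cmod, Cexp; simpl. rewrite !Rmult_1_r.
  match goal with |- sqrt ?a = _ => replace a with (exp (Re z) * exp (Re z))%R end.
  - apply sqrt_square. left; apply exp_pos.
  - pose proof (sin2_cos2 (Im z)) as H. unfold Rsqr in H. nra.
Qed.

Lemma sin_abs_le (x : R) : (Rabs (sin x) <= Rabs x)%R.
Proof.
  assert (H : forall y, (0 <= y)%R -> (Rabs (sin y) <= y)%R).
  { intros y Hy. destruct (Rle_lt_dec y 1) as [H1|H1].
    - destruct (Req_dec y 0) as [->|Hne]; [rewrite sin_0, Rabs_R0; lra|].
      pose proof (sin_lt_x y ltac:(lra)). pose proof PI2_1.
      rewrite Rabs_pos_eq; [lra|]. apply sin_ge_0; lra.
    - pose proof (SIN_bound y). apply Rabs_le. lra. }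
  destruct (Rle_lt_dec 0 x) as [Hx|Hx].
  - rewrite (Rabs_pos_eq x) by exact Hx. now apply H.
  - rewrite <- (Rabs_Ropp (sin x)), <- sin_neg, (Rabs_left x) by exact Hx. apply H. lra.
Qed.

Lemma cos_minus1_le (x : R) : (0 <= 1 - cos x <= x ^ 2 / 2)%R.
Proof.
  pose proof (COS_bound x). split; [lra|].
  replace (cos x) with (cos (2 * (x / 2)))%R by (f_equal; lra). rewrite cos_2a_sin.
  pose proof (sin_abs_le (x / 2)) as Hs. apply Rsqr_le_abs_1 in Hs. unfold Rsqr in Hs. nra.
Qed.

Lemma sin_minus_id_le (x : R) : (Rabs x <= 1)%R -> (Rabs (sin x - x) <= x ^ 2 / 2)%R.
Proof.
  assert (H : forall y, (0 <= y <= 1)%R -> (Rabs (sin y - y) <= y ^ 2 / 2)%R).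
  { intros y [H0 H1]. pose proof PI2_1.
    destruct (pre_sin_bound y 0 H0 ltac:(lra)) as [Hl Hu].
    unfold sin_approx, sin_term in Hl; simpl in Hl.
    assert (Hl' : (y - y ^ 3 / 6 <= sin y)%R) by lra.
    assert (sin y <= y)%R.
    { destruct (Req_dec y 0) as [->|Hne]; [rewrite sin_0; lra|]. left. apply sin_lt_x. lra. }
    rewrite Rabs_left1 by lra. assert (y ^ 3 <= y ^ 2)%R by nra. nra. }
  intros Hx. destruct (Rle_lt_dec 0 x) as [H0|H0].
  - rewrite (Rabs_pos_eq x) in Hx by exact H0. apply H. lra.
  - rewrite (Rabs_left x) in Hx by exact H0. specialize (H (- x)%R ltac:(lra)).
    rewrite sin_neg in H. rewrite <- Rabs_Ropp.
    replace (- (sin x - x))%R with (- sin x - - x)%R by ring. replace (x ^ 2)%R with ((- x) ^ 2)%R by ring.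
    exact H.
Qed.

Lemma exp_minus1_le (x : R) : (Rabs x <= 1 / 2)%R -> (0 <= exp x - 1 - x <= 2 * x ^ 2)%R.
Proof.
  intros Hx. apply Rabs_le_between in Hx. pose proof (exp_ineq1_le x). pose proof (exp_ineq1_le (- x)) as H1.
  split; [lra|]. pose proof (exp_pos x). rewrite exp_Ropp in H1.
  assert (exp x * (1 - x) <= 1)%R.
  { apply (Rmult_le_compat_l (exp x)) in H1; [|lra]. rewrite Rinv_r in H1; lra. }
  nra.
Qed.

Lemma Cmod_le_abs (x y : R) : (Cmod (x, y) <= Rabs x + Rabs y)%R.
Proof.
  replace ((x, y) : C) with (RtoC x + Ci * RtoC y)
    by (unfold RtoC, Ci, Cplus, Cmult; simpl; f_equal; ring).
  eapply Rle_trans; [apply Cmod_triangle|]. rewrite Cmod_mult, Cmod_Ci, !Cmod_R. lra.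
Qed.

(** The only analytic information about [Cexp] used below: it yields its continuity, the factors 1 +
    O(1/n^2) in the Gauss product, and all complex derivatives. It is assembled from real
    second-order bounds on exp, cos and sin, which replace the power series. *)
Lemma Cexp_second_order (w : C) :
  (Cmod w <= 1 / 2)%R -> (Cmod (Cexp w - 1 - w) <= 5 * Cmod w ^ 2)%R.
Proof.
  intros Hw. pose proof (re_le_Cmod w) as Hx. pose proof (im_le_Cmod w) as Hy.
  pose proof (Cmod2_alt w) as E. destruct w as [x y]. cbn [Re Im fst snd] in *. rewrite E. clear E.
  pose proof (exp_minus1_le x ltac:(lra)) as [E1 E2].
  pose proof (cos_minus1_le y) as [C1 C2]. pose proof (sin_minus_id_le y ltac:(lra)) as S1.
  replace (Cexp (x, y) - 1 - (x, y)) with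
    ((exp x * (cos y - 1) + (exp x - 1 - x))%R, (exp x * (sin y - y) + y * (exp x - 1))%R)
    by (unfold Cexp, RtoC, Cminus, Cplus, Copp, Re, Im; simpl; f_equal; ring).
  assert (Hex : (exp x <= 2)%R).
  { assert (Rabs x <= 1 / 2)%R by lra. apply Rabs_le_between in H. nra. }
  pose proof (exp_pos x) as Hpos.
  assert (Hex1 : (Rabs (exp x - 1) <= 2 * Rabs x)%R).
  { replace (exp x - 1)%R with ((exp x - 1 - x) + x)%R by ring.
    eapply Rle_trans; [apply Rabs_triang|]. rewrite Rabs_pos_eq by lra.
    assert (2 * x ^ 2 <= Rabs x)%R.
    { rewrite <- Rsqr_pow2, Rsqr_abs. unfold Rsqr. pose proof (Rabs_pos x). nra. }
    lra. }
  eapply Rle_trans; [apply Cmod_le_abs|].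
  assert (B1 : (Rabs (exp x * (cos y - 1) + (exp x - 1 - x)) <= y ^ 2 + 2 * x ^ 2)%R).
  { apply Rabs_le. nra. }
  assert (B2 : (Rabs (exp x * (sin y - y) + y * (exp x - 1)) <= y ^ 2 + (x ^ 2 + y ^ 2))%R).
  { eapply Rle_trans; [apply Rabs_triang|]. rewrite !Rabs_mult, (Rabs_pos_eq (exp x)) by lra.
    pose proof (Rabs_pos (sin y - y)). pose proof (Rabs_pos y). pose proof (Rabs_pos x).
    assert (T : (Rabs y * Rabs (exp x - 1) <= Rabs y * (2 * Rabs x))%R)
      by (apply Rmult_le_compat_l; lra).
    assert (T2 : (Rabs y * (2 * Rabs x) <= x ^ 2 + y ^ 2)%R).
    { rewrite <- (Rsqr_pow2 x), <- (Rsqr_pow2 y), (Rsqr_abs x), (Rsqr_abs y). unfold Rsqr.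
      pose proof (pow2_ge_0 (Rabs x - Rabs y)). nra. }
    nra. }
  pose proof (pow2_ge_0 x). pose proof (pow2_ge_0 y). lra.
Qed.

Lemma Cnatpow_plus (N : nat) (z w : C) : Cnatpow N (z + w) = Cnatpow N z * Cnatpow N w.
Proof. unfold Cnatpow. rewrite <- Cexp_plus. f_equal. ring. Qed.

Lemma Cnatpow_neq_0 (N : nat) (z : C) : Cnatpow N z <> 0.
Proof. apply Cexp_neq_0. Qed.

Lemma Cnatpow_0_r (N : nat) : Cnatpow N 0 = 1.
Proof. unfold Cnatpow. rewrite Cmult_0_l. apply Cexp_0. Qed.

Lemma Cnatpow_opp (N : nat) (z : C) : Cnatpow N (- z) = / Cnatpow N z.
Proof. unfold Cnatpow. rewrite <- Cexp_opp. f_equal. ring. Qed.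

Lemma Cnatpow_minus (N : nat) (z w : C) : Cnatpow N (z - w) = Cnatpow N z / Cnatpow N w.
Proof. unfold Cminus, Cdiv. now rewrite Cnatpow_plus, Cnatpow_opp. Qed.

Lemma Cnatpow_1_r (N : nat) : (0 < N)%nat -> Cnatpow N 1 = natC N.
Proof.
  intros H. unfold Cnatpow. rewrite Cmult_1_l, Cexp_R, exp_ln; [reflexivity|].
  now apply lt_0_INR.
Qed.

Lemma Cmod_Cnatpow (n : nat) (z : C) : Cmod (Cnatpow (S n) z) = exp (Re z * lnS n).
Proof.
  unfold Cnatpow. rewrite Cmod_Cexp. f_equal. destruct z as [x y]. unfold lnS, Re, RtoC, Cmult. cbn [fst snd]. ring.
Qed.

Lemma INR_neq_0 (n : nat) : (0 < n)%nat -> natC n <> 0.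
Proof. intros H E. apply RtoC_inj in E. apply lt_0_INR in H. lra. Qed.

Lemma fact_neq_0_C (n : nat) : natC (fact n) <> 0.
Proof. apply INR_neq_0, lt_O_fact. Qed.

(** * The reciprocal Gamma function *)

(* With the normalisation n! (n+1)^(y-1), instead of n! n^y for n+1 factors, consecutive
   quotients are 1 + O(1/n^2) from n = 0 on and the limit rG is 1/Gamma for every y, zero
   at the poles of Gamma. *)
Definition rgn (n : nat) (y : C) : C :=
  poch y n / (natC (fact n) * Cnatpow (S n) (y - 1)).
Definition rG (y : C) : C := CLim (fun n => rgn n y).

Lemma poch_S (y : C) (n : nat) : poch y (S n) = poch y n * (y + natC n).
Proof. reflexivity. Qed.

Lemma cprod_ext (n : nat) (f g : nat -> C) :
  (forall k, (k < n)%nat -> f k = g k) -> cprod n f = cprod n g.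
Proof.
  induction n as [|n IH]; intros H; simpl; [easy|].
  rewrite IH, H by (auto; intros; apply H; lia). reflexivity.
Qed.

Lemma cprod_mult (n : nat) (f g : nat -> C) :
  cprod n (fun k => f k * g k) = cprod n f * cprod n g.
Proof. induction n as [|n IH]; simpl; [ring|rewrite IH; ring]. Qed.

Lemma cprod_add (m n : nat) (f : nat -> C) :
  cprod (m + n) f = cprod m f * cprod n (fun k => f (m + k)%nat).
Proof.
  induction n as [|n IH]; [rewrite Nat.add_0_r; simpl; ring|].
  rewrite Nat.add_succ_r. simpl. rewrite IH. ring.
Qed.

Lemma cprod_neq_0 (n : nat) (f : nat -> C) :
  (forall k, (k < n)%nat -> f k <> 0) -> cprod n f <> 0.
Proof.
  induction n as [|n IH]; intros H; simpl; [apply C1_nz|].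
  apply Cmult_neq_0; [apply IH; intros; apply H; lia|apply H; lia].
Qed.

Lemma notpole_neq_0 (y : C) (j : nat) : notpole y -> y + natC j <> 0.
Proof.
  intros H E. apply (H j). replace y with (y + natC j - natC j) by ring.
  rewrite E. ring.
Qed.

Lemma notpole_plus (y : C) (k : nat) : notpole y -> notpole (y + natC k).
Proof.
  intros H m E. apply (H (m + k)%nat). rewrite plus_INR, RtoC_plus.
  replace y with (y + natC k - natC k) by ring. rewrite E. ring.
Qed.

Lemma nonint_notpole (y : C) : nonint y -> notpole y.
Proof.
  intros H m E. apply (H (- Z.of_nat m)%Z). rewrite E, opp_IZR, <- INR_IZR_INZ, RtoC_opp.
  reflexivity.
Qed.

Lemma poch_neq_0 (y : C) (n : nat) : notpole y -> poch y n <> 0.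
Proof. intros H. apply cprod_neq_0. intros k _. now apply notpole_neq_0. Qed.

Lemma poch_add (y : C) (m n : nat) : poch y (m + n) = poch y m * poch (y + natC m) n.
Proof.
  unfold poch. rewrite cprod_add. f_equal. apply cprod_ext. intros k _.
  rewrite plus_INR, RtoC_plus. ring.
Qed.

Lemma poch_1 (y : C) : poch y 1 = y.
Proof. unfold poch; simpl. ring. Qed.

Lemma poch_Sl (y : C) (n : nat) : poch y (S n) = y * poch (y + 1) n.
Proof. rewrite <- Nat.add_1_l, poch_add, poch_1. reflexivity. Qed.

Lemma poch_1_fact (n : nat) : poch 1 n = natC (fact n).
Proof.
  induction n as [|n IH]; [reflexivity|].
  rewrite poch_S, IH, fact_simpl, mult_INR, S_INR, RtoC_mult, RtoC_plus. ring.
Qed.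

(** Read backwards, the factors y-k, ..., y-1 are the negatives of 1-y, ..., k-y. These signs are
    the origin of z^k in the hypergeometric terms. *)
Lemma poch_minus_k (y : C) (k : nat) : poch (y - natC k) k = (-1) ^ k * poch (1 - y) k.
Proof.
  induction k as [|k IH]; [unfold poch; simpl; ring|].
  rewrite poch_Sl, poch_S.
  replace (y - natC (S k) + 1) with (y - natC k) by (rewrite S_INR, RtoC_plus; ring).
  rewrite IH, Cpow_S, S_INR, RtoC_plus. ring.
Qed.

Lemma poch_minus (y : C) (k M : nat) : (k <= M)%nat ->
  poch (y - natC k) M = (-1) ^ k * poch (1 - y) k * poch y (M - k).
Proof.
  intros H. replace M with (k + (M - k))%nat at 1 by lia. rewrite poch_add, poch_minus_k.
  f_equal. f_equal. ring.
Qed.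

Lemma rgn_neq_0 (y : C) (n : nat) : notpole y -> rgn n y <> 0.
Proof.
  intros H. unfold rgn, Cdiv. apply Cmult_neq_0; [now apply poch_neq_0|].
  intros E. pose proof (Cmult_neq_0 _ _ (fact_neq_0_C n) (Cnatpow_neq_0 (S n) (y - 1))) as H1.
  apply C1_nz. rewrite <- (Cinv_r _ H1), E. ring.
Qed.

Lemma poch_rgn (y : C) (n : nat) :
  poch y n = rgn n y * (natC (fact n) * Cnatpow (S n) (y - 1)).
Proof.
  unfold rgn. field. split; [apply Cnatpow_neq_0|apply fact_neq_0_C].
Qed.

Lemma rgn_S (n : nat) (y : C) :
  rgn (S n) y = rgn n y * ((1 + (y - 1) * RtoC (/ INR (S n)))
                 * Cexp (- ((y - 1) * RtoC (lnS (S n) - lnS n)))).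
Proof.
  unfold rgn. rewrite poch_S, fact_simpl, mult_INR, RtoC_mult.
  assert (E : Cexp (- ((y - 1) * RtoC (lnS (S n) - lnS n)))
              = Cnatpow (S n) (y - 1) / Cnatpow (S (S n)) (y - 1)).
  { unfold Cnatpow. unfold Cdiv. rewrite <- Cexp_opp, <- Cexp_plus. f_equal.
    unfold lnS. rewrite RtoC_minus. ring. }
  rewrite E, RtoC_inv by (apply not_0_INR; lia).
  rewrite (S_INR n), RtoC_plus.
  assert (H : natC n + 1 <> 0).
  { rewrite <- RtoC_plus, <- S_INR. apply INR_neq_0. lia. }
  field. repeat split; try apply Cnatpow_neq_0; try apply fact_neq_0_C; exact H.
Qed.

Lemma nat_above (x : R) : exists N : nat, forall n, (N <= n)%nat -> (x <= INR n)%R.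
Proof.
  destruct (INR_unbounded x) as [N HN]. exists N. intros n Hn. apply le_INR in Hn. lra.
Qed.

Lemma INR_S_ge1 (n : nat) : (1 <= INR (S n))%R.
Proof. rewrite S_INR. pose proof (pos_INR n). lra. Qed.

Lemma lnS_gap (n : nat) :
  let h := (/ INR (S n))%R in let l := (lnS (S n) - lnS n)%R in
  (0 <= l <= h /\ h - l <= h ^ 2 /\ 0 < h <= 1)%R.
Proof.
  intros h l. pose proof (lnS_incr_ub n) as H1. pose proof (lnS_incr_lb n) as H2.
  pose proof (INR_S_ge1 n) as H3.
  assert (Hh : (0 < h <= 1)%R).
  { unfold h. split; [apply Rinv_0_lt_compat; lra|]. rewrite <- Rinv_1. apply Rinv_le_contravar; lra. }
  assert (H4 : (/ INR (S (S n)) = h / (1 + h))%R).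
  { unfold h. rewrite (S_INR (S n)). field. lra. }
  assert (H5 : (h - h ^ 2 <= h / (1 + h))%R).
  { apply Rmult_le_reg_r with (1 + h)%R; [lra|].
    unfold Rdiv. rewrite Rmult_assoc, Rinv_l by lra. nra. }
  fold h l in H1, H2. rewrite H4 in H2.
  repeat split; try lra.
  assert (0 < h / (1 + h))%R by (apply Rdiv_lt_0_compat; lra). lra.
Qed.

(** With h = 1/(n+1) and l = ln(n+2) - ln(n+1), consecutive values have the quotient (1 + (y-1) h)
    exp (-(y-1) l). The first-order terms cancel because 0 <= h - l <= h^2. *)
Lemma rgn_increment (y : C) : exists c N, (0 <= c)%R /\ forall n, (N <= n)%nat ->
  (Cmod (rgn (S n) y - rgn n y) <= c * / INR (S n) ^ 2 * Cmod (rgn n y))%R.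
Proof.
  set (c := y - 1). pose proof (Cmod_ge_0 c) as Hc0.
  (* |c| bounds the term c (h - l). The 9 exceeds 1 + 15/2: the 1 belongs to c^2 h l, and 15/2 to
     the remainder 5 |w|^2 multiplied by |1 + c h| <= 3/2. *)
  exists (Cmod c + 9 * Cmod c ^ 2)%R.
  destruct (nat_above (2 * Cmod c)) as [N HN]. exists N. split; [nra|].
  intros n Hn. rewrite rgn_S. fold c.
  destruct (lnS_gap n) as [[Hl0 Hl1] [Hl2 [Hh0 Hh1]]].
  set (h := (/ INR (S n))%R) in *. set (l := (lnS (S n) - lnS n)%R) in *.
  replace (/ INR (S n) ^ 2)%R with (h ^ 2)%R by (unfold h; apply pow_inv).
  specialize (HN n Hn).
  assert (Hch : (Cmod c * h <= 1 / 2)%R).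
  { assert (INR (S n) * h = 1)%R by (apply Rinv_r; pose proof (INR_S_ge1 n); lra).
    rewrite S_INR in H. nra. }
  set (w := - (c * RtoC l)).
  assert (Hw : (Cmod w <= Cmod c * h)%R).
  { unfold w. rewrite Cmod_opp, Cmod_mult, Cmod_R, Rabs_pos_eq by exact Hl0. nra. }
  pose proof (Cexp_second_order w ltac:(lra)) as HR.
  set (rr := Cexp w - 1 - w) in *.
  replace (rgn n y * ((1 + c * RtoC h) * Cexp w) - rgn n y) with
    ((c * RtoC (h - l) + (- (c * c * RtoC (h * l)) + (1 + c * RtoC h) * rr)) * rgn n y).
  2:{ replace (Cexp w) with (1 + w + rr) by (unfold rr; ring). unfold w.
      rewrite RtoC_minus, RtoC_mult. ring. }
  rewrite Cmod_mult. apply Rmult_le_compat_r; [apply Cmod_ge_0|].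
  eapply Rle_trans; [apply Cmod_triangle|].
  pose proof (Cmod_triangle (- (c * c * RtoC (h * l))) ((1 + c * RtoC h) * rr)) as T1.
  pose proof (Cmod_triangle 1 (c * RtoC h)) as T2. rewrite Cmod_1 in T2.
  rewrite Cmod_opp, !Cmod_mult, !Cmod_R in T1. rewrite Cmod_mult, Cmod_R in T2.
  rewrite Cmod_mult, Cmod_R. rewrite (Rabs_pos_eq (h - l)) by lra.
  rewrite (Rabs_pos_eq (h * l)) in T1 by nra. rewrite (Rabs_pos_eq h) in T2 by lra.
  assert (A1 : (Cmod c * (h - l) <= Cmod c * h ^ 2)%R) by (apply Rmult_le_compat_l; lra).
  assert (A2 : (Cmod c * Cmod c * (h * l) <= Cmod c ^ 2 * h ^ 2)%R).
  { replace (Cmod c ^ 2 * h ^ 2)%R with (Cmod c * Cmod c * (h * h))%R by ring.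
    apply Rmult_le_compat_l; nra. }
  assert (A3 : (Cmod w ^ 2 <= Cmod c ^ 2 * h ^ 2)%R).
  { rewrite <- Rpow_mult_distr. apply pow_incr. split; [apply Cmod_ge_0|exact Hw]. }
  assert (A4 : (Cmod (1 + c * RtoC h) * Cmod rr <= 3 / 2 * (5 * (Cmod c ^ 2 * h ^ 2)))%R).
  { apply Rmult_le_compat; try apply Cmod_ge_0; lra. }
  nra.
Qed.

Lemma rgn_cv (y : C) : ccv (fun n => rgn n y) (rG y).
Proof.
  destruct (rgn_increment y) as [c [N [Hc H]]].
  destruct (product_cv _ c N Hc H) as [l Hl].
  unfold rG. now rewrite (ccv_CLim _ _ Hl).
Qed.

Lemma rG_neq_0 (y : C) : notpole y -> rG y <> 0.
Proof.
  intros Hy. destruct (rgn_increment y) as [c [N [Hc H]]].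
  destruct (product_cv_nonzero _ c N Hc (fun n _ => rgn_neq_0 y n Hy) H) as [l [Hl Hl0]].
  now rewrite (ccv_unique _ _ _ (rgn_cv y) Hl).
Qed.

Lemma rgn_upper (y : C) : exists B, (0 < B)%R /\ forall n, (Cmod (rgn n y) <= B)%R.
Proof. apply (ccv_bounded _ _ (rgn_cv y)). Qed.

Lemma rgn_inv_upper (y : C) : notpole y ->
  exists B, (0 < B)%R /\ forall n, (Cmod (/ rgn n y) <= B)%R.
Proof.
  intros H. apply (ccv_bounded _ (/ rG y)). apply ccv_inv; [apply rgn_cv|now apply rG_neq_0].
Qed.

Lemma Cexp_continuous (u : nat -> C) (l : C) : ccv u l -> ccv (fun n => Cexp (u n)) (Cexp l).
Proof.
  intros H eps He. pose proof (Cmod_ge_0 (Cexp l)) as H0.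
  set (d := Rmin (1 / 2) (eps / (4 * (Cmod (Cexp l) + 1)))%R).
  assert (Hd : (0 < d)%R).
  { apply Rmin_pos; [lra|]. apply Rdiv_lt_0_compat; lra. }
  destruct (H d Hd) as [N HN]. exists N. intros n Hn. specialize (HN n Hn).
  set (w := u n - l) in *.
  pose proof (Rmin_l (1 / 2) (eps / (4 * (Cmod (Cexp l) + 1)))) as D1.
  pose proof (Rmin_r (1 / 2) (eps / (4 * (Cmod (Cexp l) + 1)))) as D2. fold d in D1, D2.
  pose proof (Cexp_second_order w ltac:(lra)) as HR.
  replace (Cexp (u n) - Cexp l) with (Cexp l * ((Cexp w - 1 - w) + w)).
  2:{ replace (u n) with (l + w) by (unfold w; ring). rewrite Cexp_plus. ring. }
  rewrite Cmod_mult. pose proof (Cmod_triangle (Cexp w - 1 - w) w) as T.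
  pose proof (Cmod_ge_0 w) as Hw0.
  assert (T2 : (Cmod (Cexp w - 1 - w + w) <= 7 / 2 * Cmod w)%R) by nra.
  assert (T3 : (Cmod (Cexp l) * Cmod (Cexp w - 1 - w + w) <= (Cmod (Cexp l) + 1) * (7 / 2 * Cmod w))%R).
  { apply Rmult_le_compat; try apply Cmod_ge_0; lra. }
  assert (T4 : (Cmod w < eps / (4 * (Cmod (Cexp l) + 1)))%R) by lra.
  apply (Rmult_lt_compat_l (4 * (Cmod (Cexp l) + 1))) in T4; [|lra].
  replace (4 * (Cmod (Cexp l) + 1) * (eps / (4 * (Cmod (Cexp l) + 1))))%R with eps in T4 by (field; lra).
  nra.
Qed.

Lemma inv_INR_lim : is_lim_seq (fun n => / INR (S n))%R 0%R.
Proof.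
  apply is_lim_seq_ext with (fun n => / (INR n + 1))%R.
  - intros n. now rewrite S_INR.
  - replace (Finite 0) with (Rbar_inv p_infty) by reflexivity.
    apply is_lim_seq_inv; [|discriminate].
    eapply is_lim_seq_plus; [apply is_lim_seq_INR|apply is_lim_seq_const|reflexivity].
Qed.

Lemma Cnatpow_ratio_cv (c : C) : ccv (fun n => Cnatpow (S (S n)) c / Cnatpow (S n) c) 1.
Proof.
  apply ccv_ext with (fun n => Cexp (c * RtoC (lnS (S n) - lnS n))).
  - intros n. unfold Cnatpow, Cdiv. rewrite <- Cexp_opp, <- Cexp_plus. f_equal.
    unfold lnS. rewrite RtoC_minus. ring.
  - rewrite <- Cexp_0. apply Cexp_continuous.
    replace (RtoC 0) with (c * RtoC 0) by ring. apply ccv_scal, ccv_RtoC.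
    apply is_lim_seq_le_le with (fun _ => 0%R) (fun n => / INR (S n))%R.
    + intros n. destruct (lnS_gap n) as [H _]. exact H.
    + apply is_lim_seq_const.
    + apply inv_INR_lim.
Qed.

(** The functional equation of Gamma without division by y, hence valid also at the zeros of [rG].
    At finite level it is exact up to a quotient of powers that tends to 1. *)
Lemma rG_S (y : C) : rG y = y * rG (y + 1).
Proof.
  apply (ccv_unique (fun n => rgn (S n) y)).
  - apply (ccv_subseq (fun n => rgn n y) _ S); [auto|apply rgn_cv].
  - replace (y * rG (y + 1)) with (y * rG (y + 1) / 1) by (field; apply C1_nz).
    eapply ccv_ext; [|apply ccv_div; [apply ccv_scal, rgn_cv|apply (Cnatpow_ratio_cv (y - 1))|apply C1_nz]].
    intros n. cbv beta. unfold rgn. rewrite poch_Sl, fact_simpl, mult_INR, RtoC_mult.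
    replace (y + 1 - 1) with (y - 1 + 1) by ring.
    rewrite (Cnatpow_plus (S n) (y - 1) 1), Cnatpow_1_r by lia.
    field. repeat split; try apply Cnatpow_neq_0; try apply fact_neq_0_C. apply INR_neq_0; lia.
Qed.

Lemma rG_poch (y : C) (k : nat) : rG y = poch y k * rG (y + natC k).
Proof.
  induction k as [|k IH].
  - unfold poch; simpl. replace (y + RtoC 0) with y by ring. ring.
  - rewrite IH, poch_S, (rG_S (y + natC k)), S_INR, RtoC_plus.
    replace (y + (natC k + 1)) with (y + natC k + 1) by ring. ring.
Qed.

Lemma rG_minus (y : C) (k : nat) : rG (y - natC k) = (-1) ^ k * poch (1 - y) k * rG y.
Proof.
  rewrite (rG_poch _ k), poch_minus_k. f_equal. f_equal. ring.
Qed.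

Lemma rG_1 : rG 1 = 1.
Proof.
  apply ccv_CLim. apply ccv_ext with (fun _ => RtoC 1); [|apply ccv_const].
  intros n. unfold rgn. rewrite poch_1_fact. replace (RtoC 1 - 1) with (RtoC 0) by ring.
  rewrite Cnatpow_0_r. field. apply fact_neq_0_C.
Qed.

Lemma CGamma_limit (z : C) : notpole z ->
  ccv (fun N => natC (fact N) * Cnatpow N z / cprod (S N) (fun j => z + natC j)) (/ rG z).
Proof.
  (* The shift avoids N = 0, where [Cnatpow] takes the logarithm of 0. *)
  intros Hz. apply (ccv_shift _ _ 1).
  (* the prefactor is N^z / ((N+1) (N+2)^(z-1)) at N = n+1 *)
  assert (H1 : ccv (fun n => 1 / (Cnatpow (S (S n)) (z - 1) / Cnatpow (S n) (z - 1))
                 / (Cnatpow (S (S (S n))) (z - 1) / Cnatpow (S (S n)) (z - 1))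
                 * (natC (S n) / natC (S (S n)))) (1 / 1 / 1 * 1)).
  { apply ccv_mult.
    - apply ccv_div; [|apply (ccv_subseq (fun n => Cnatpow (S (S n)) (z - 1) / Cnatpow (S n) (z - 1)) _ S (fun n => ltac:(auto)) (Cnatpow_ratio_cv (z - 1)))|apply C1_nz].
      apply ccv_div; [apply ccv_const|apply Cnatpow_ratio_cv|apply C1_nz].
    - apply ccv_ext with (fun n => 1 - RtoC (/ INR (S (S n)))).
      + intros n. rewrite RtoC_inv by (apply not_0_INR; lia).
        rewrite (S_INR (S n)), RtoC_plus. field.
        cbv beta. rewrite <- RtoC_plus, <- S_INR. apply INR_neq_0. lia.
      + apply (eq_ind (1 - RtoC 0) (ccv _)); [|ring]. apply ccv_minus; [apply ccv_const|].
        apply (ccv_subseq (fun n => RtoC (/ INR (S n))) _ S); [auto|]. apply ccv_RtoC, inv_INR_lim. }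
  replace (1 / 1 / 1 * 1) with (RtoC 1) in H1 by (field; apply C1_nz).
  replace (/ rG z) with (1 / rG z) by (field; now apply rG_neq_0).
  eapply ccv_ext; [|apply ccv_div; [exact H1| |now apply rG_neq_0]].
  2:{ apply (ccv_subseq (fun n => rgn n z) _ (fun n => S (S n)) (fun n => Nat.le_trans _ _ _ (Nat.le_succ_diag_r n) (Nat.le_succ_diag_r (S n))) (rgn_cv z)). }
  intros n. cbv beta. rewrite Nat.add_1_r.
  change (cprod (S (S n)) (fun j => z + natC j)) with (poch z (S (S n))).
  unfold rgn. pose proof (poch_neq_0 z (S (S n)) Hz) as HP.
  rewrite (fact_simpl (S n)), mult_INR, RtoC_mult.
  replace (Cnatpow (S n) z) with (Cnatpow (S n) (z - 1) * natC (S n)).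
  2:{ rewrite <- (Cnatpow_1_r (S n)), <- Cnatpow_plus by lia. f_equal. ring. }
  field. repeat split; try apply Cnatpow_neq_0; try apply fact_neq_0_C; try (apply INR_neq_0; lia); exact HP.
Qed.

Lemma CGamma_rG (z : C) : notpole z -> CGamma z = / rG z.
Proof. intros Hz. apply ccv_CLim. now apply CGamma_limit. Qed.

(** * The digamma function *)

(* The term with y + j = 0 contributes / 0 = 0. *)
Definition hsum (y : C) (n : nat) : C := csum n (fun j => / (y + natC j)).
(** Minus the logarithmic derivative of [rgn n], so that the limit is the digamma function. *)
Definition psin (n : nat) (y : C) : C := RtoC (lnS n) - hsum y n.
Definition psi (y : C) : C := CLim (fun n => psin n y).

Lemma Cinv_0 : / (RtoC 0) = 0.
Proof. unfold Cinv, RtoC; simpl. unfold Rdiv. rewrite Ropp_0. f_equal; ring. Qed.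

(** Convergence includes the nonpositive integers, where the singular summand counts as 0. The value
    obtained there is the constant term of the Laurent expansion of digamma, the one that enters the
    residue at a double pole. *)
Lemma psi_cv (y : C) : ccv (fun n => psin n y) (psi y).
Proof.
  enough (H : exists l, ccv (fun n => psin n y) l).
  { destruct H as [l Hl]. unfold psi. now rewrite (ccv_CLim _ _ Hl). }
  set (c := y - 1). pose proof (Cmod_ge_0 c) as Hc.
  destruct (nat_above (2 * Cmod c)) as [N HN].
  apply (series_cv_increments _ (1 + 2 * Cmod c) N). intros n Hn.
  specialize (HN n Hn). destruct (lnS_gap n) as [[Hl0 Hl1] [Hl2 [Hh0 Hh1]]].
  pose proof (INR_S_ge1 n) as HS.
  set (h := (/ INR (S n))%R) in *. set (l := (lnS (S n) - lnS n)%R) in *.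
  replace (/ INR (S n) ^ 2)%R with (h ^ 2)%R by (unfold h; apply pow_inv).
  assert (Hy : y + natC n = natC (S n) + c).
  { unfold c. rewrite S_INR, RtoC_plus. ring. }
  assert (Hlow : (INR (S n) / 2 <= Cmod (y + natC n))%R).
  { rewrite Hy. pose proof (Cmod_triangle_minus (natC (S n)) (- c)) as T.
    rewrite Cmod_R, Cmod_opp, Rabs_pos_eq in T by lra.
    replace (natC (S n) - - c) with (natC (S n) + c) in T by ring.
    rewrite S_INR in *. lra. }
  assert (Hnz : y + natC n <> 0) by (apply Cmod_gt_0; lra).
  replace (psin (S n) y - psin n y) with
    (RtoC (l - h) + RtoC h * c / (y + natC n)).
  2:{ unfold psin, hsum. simpl csum. unfold l. rewrite !RtoC_minus.
      replace c with (y + natC n - natC (S n)) by (rewrite Hy; ring).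
      unfold h. rewrite RtoC_inv by lra. field. split; [exact Hnz|apply INR_neq_0; lia]. }
  eapply Rle_trans; [apply Cmod_triangle|].
  rewrite Cmod_R, Rabs_left1 by lra. rewrite Cmod_div, Cmod_mult, Cmod_R by exact Hnz.
  rewrite (Rabs_pos_eq h) by lra.
  assert (HhS : (h * INR (S n) = 1)%R) by (apply Rinv_l; lra).
  assert (A : (h * Cmod c / Cmod (y + natC n) <= 2 * Cmod c * h ^ 2)%R).
  { apply Rmult_le_reg_r with (Cmod (y + natC n)); [lra|].
    unfold Rdiv. rewrite Rmult_assoc, Rinv_l, Rmult_1_r by lra.
    assert (E : (h * Cmod c = 2 * Cmod c * h ^ 2 * (INR (S n) / 2))%R).
    { transitivity (h * Cmod c * (h * INR (S n)))%R; [rewrite HhS; ring|field]. }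
    rewrite E. apply Rmult_le_compat_l; [nra|exact Hlow]. }
  lra.
Qed.

(** For j >= 2 |z - 1| the constant 1/2 works by the triangle inequality; the finitely many smaller
    j contribute a minimum of positive numbers. *)
Lemma notpole_lower (z : C) : notpole z ->
  exists d, (0 < d <= 1)%R /\ forall j, (d * INR (S j) <= Cmod (z + natC j))%R.
Proof.
  intros Hz. pose proof (Cmod_ge_0 (z - 1)) as Hc.
  destruct (nat_above (2 * Cmod (z - 1))) as [N HN].
  assert (Hfin : exists d, (0 < d <= 1)%R /\
    forall j, (j < N)%nat -> (d * INR (S j) <= Cmod (z + natC j))%R).
  { clear HN. induction N as [|N [d [Hd H]]].
    - exists 1%R. split; [lra|]. intros j Hj; lia.
    - pose proof (INR_S_ge1 N) as HS.
      assert (Hp : (0 < Cmod (z + natC N))%R) by (apply Cmod_gt_0; now apply notpole_neq_0).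
      assert (Hq : (0 < Cmod (z + natC N) / INR (S N))%R) by (apply Rdiv_lt_0_compat; lra).
      exists (Rmin d (Cmod (z + natC N) / INR (S N))). split.
      + split; [apply Rmin_pos; lra|]. eapply Rle_trans; [apply Rmin_l|lra].
      + intros j Hj. pose proof (INR_S_ge1 j) as HSj.
        destruct (Nat.eq_dec j N) as [->|Hne].
        * eapply Rle_trans; [apply Rmult_le_compat_r; [lra|apply Rmin_r]|].
          apply Req_le. field. lra.
        * eapply Rle_trans; [apply Rmult_le_compat_r; [lra|apply Rmin_l]|]. apply H; lia. }
  destruct Hfin as [d [Hd H]]. exists (Rmin d (1 / 2)). split.
  - split; [apply Rmin_pos; lra|]. eapply Rle_trans; [apply Rmin_l|lra].
  - intros j. pose proof (INR_S_ge1 j) as HSj. destruct (le_lt_dec N j) as [Hj|Hj].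
    + eapply Rle_trans; [apply Rmult_le_compat_r; [lra|apply Rmin_r]|].
      specialize (HN j Hj). pose proof (Cmod_triangle_minus (natC (S j)) (- (z - 1))) as T.
      rewrite Cmod_R, Cmod_opp, Rabs_pos_eq in T by lra.
      replace (natC (S j) - - (z - 1)) with (z + natC j) in T
        by (rewrite S_INR, RtoC_plus; ring).
      rewrite S_INR in *. lra.
    + eapply Rle_trans; [apply Rmult_le_compat_r; [lra|apply Rmin_l]|]. now apply H.
Qed.

(** * Complex differentiability of Gamma *)

Lemma is_derive_C_iff (f : C -> C) (z l : C) :
  is_derive f z l <->
  forall eps : R, (0 < eps)%R -> exists d : R, (0 < d)%R /\
    forall h, (Cmod h < d)%R -> (Cmod (f (z + h)%C - f z - h * l) <= eps * Cmod h)%R.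
Proof.
  split.
  - intros [_ H] eps He. specialize (H z (fun P HP => HP) (mkposreal eps He)).
    destruct (locally_le_locally_norm (V := AbsRing_NormedModule C_AbsRing) z _ H) as [d Hd].
    exists d. split; [apply cond_pos|].
    intros h Hh. specialize (Hd (z + h)).
    change (Cmod (z + h - z) < d -> Cmod (f (z + h)%C - f z - (z + h - z) * l) <= eps * Cmod (z + h - z))%R in Hd.
    replace (z + h - z) with h in Hd by ring. auto.
  - intros H. split; [apply is_linear_scal_l|]. intros x Hx.
    apply (is_filter_lim_locally_unique (V := AbsRing_NormedModule C_AbsRing) z x) in Hx.
    subst x. intros eps. destruct (H eps (cond_pos eps)) as [d [Hd0 Hd]].
    apply (locally_norm_le_locally (V := AbsRing_NormedModule C_AbsRing)).
    exists (mkposreal d Hd0). intros y Hy.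
    change C in (type of y). specialize (Hd (y - z) Hy).
    assert (E : (z + (y - z) = y)%C) by ring. rewrite E in Hd. exact Hd.
Qed.

Lemma is_derive_C_unique (f : C -> C) (z l1 l2 : C) :
  is_derive f z l1 -> is_derive f z l2 -> l1 = l2.
Proof.
  rewrite !is_derive_C_iff. intros H1 H2.
  destruct (Req_dec (Cmod (l1 - l2)) 0) as [E|Hne].
  { apply Ceq_minus. now apply Cmod_eq_0. }
  exfalso. pose proof (Cmod_ge_0 (l1 - l2)) as H0.
  destruct (H1 (Cmod (l1 - l2) / 4)%R ltac:(lra)) as [d1 [Hd1 K1]].
  destruct (H2 (Cmod (l1 - l2) / 4)%R ltac:(lra)) as [d2 [Hd2 K2]].
  set (d := (Rmin d1 d2 / 2)%R). assert (Hd : (0 < d)%R).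
  { unfold d. pose proof (Rmin_pos _ _ Hd1 Hd2). lra. }
  assert (Hm : Cmod (RtoC d) = d) by (rewrite Cmod_R, Rabs_pos_eq; lra).
  pose proof (Rmin_l d1 d2). pose proof (Rmin_r d1 d2).
  specialize (K1 (RtoC d)). specialize (K2 (RtoC d)). rewrite Hm in K1, K2.
  specialize (K1 ltac:(unfold d in *; lra)). specialize (K2 ltac:(unfold d in *; lra)).
  pose proof (Cmod_minus_le (f (z + RtoC d) - f z - RtoC d * l2) (f (z + RtoC d) - f z - RtoC d * l1)) as T.
  replace (f (z + RtoC d) - f z - RtoC d * l2 - (f (z + RtoC d) - f z - RtoC d * l1))
    with (RtoC d * (l1 - l2)) in T by ring.
  rewrite Cmod_mult, Hm in T. nra.
Qed.

Lemma cprod_near_1 (n : nat) (a : nat -> C) :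
  (Cmod (cprod n (fun j => 1 + a j)%C - 1) <= exp (rsum n (fun j => Cmod (a j))) - 1)%R.
Proof.
  induction n as [|n IH]; simpl.
  - replace (1 - 1) with (RtoC 0) by ring. rewrite Cmod_0, exp_0. lra.
  - set (P := cprod n (fun j => 1 + a j)) in *. set (s := rsum n (fun j => Cmod (a j))) in *.
    replace (P * (1 + a n) - 1) with ((P - 1) * (1 + a n) + a n) by ring.
    eapply Rle_trans; [apply Cmod_triangle|]. rewrite Cmod_mult, exp_plus.
    pose proof (Cmod_triangle 1 (a n)) as T. rewrite Cmod_1 in T.
    pose proof (exp_ineq1_le (Cmod (a n))) as He. pose proof (Cmod_ge_0 (P - 1)) as H0.
    pose proof (Cmod_ge_0 (a n)) as Ha.
    assert (H1 : (Cmod (P - 1) * Cmod (1 + a n) <= (exp s - 1) * exp (Cmod (a n)))%R).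
    { apply Rmult_le_compat; try apply Cmod_ge_0; lra. }
    lra.
Qed.

(* Gamma_n(z+h) = Gamma_n(z) e^(h psi_n(z)) prod_j e^w_j/(1+w_j) with w_j = h/(z+j): the last
   factors are 1 + O(|h|^2/j^2), uniformly in n. *)
Lemma Gamma_quotient (n : nat) (z h : C) :
  (forall j, z + natC j <> 0) -> (forall j, z + natC j + h <> 0) ->
  / rgn n (z + h) = / rgn n z * Cexp (h * psin n z) *
     cprod n (fun j => Cexp (h / (z + natC j)) / (1 + h / (z + natC j))).
Proof.
  intros H1 H2.
  assert (P1 : forall n, poch z n <> 0) by (intros k; apply cprod_neq_0; auto).
  assert (P2 : forall n, poch (z + h) n <> 0).
  { intros k. apply cprod_neq_0. intros j _.
    replace (z + h + natC j) with (z + natC j + h) by ring. auto. }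
  assert (E : forall n, / poch (z + h) n = / poch z n * Cexp (- (h * hsum z n)) *
    cprod n (fun j => Cexp (h / (z + natC j)) / (1 + h / (z + natC j)))).
  { clear n. intros n. induction n as [|n IH].
    - unfold poch, hsum; simpl. replace (- (h * 0)) with (RtoC 0) by ring. rewrite Cexp_0.
      field.
    - unfold hsum in *. simpl cprod. simpl csum.
      change (cprod n _) with (cprod n (fun j => Cexp (h / (z + natC j)) / (1 + h / (z + natC j)))).
      replace (/ poch (z + h) (S n)) with (/ poch (z + h) n * / (z + natC n + h)).
      2:{ rewrite poch_S. field. repeat split; auto.
          replace (z + h + natC n) with (z + natC n + h) by ring. auto. }
      rewrite IH, poch_S.
      replace (- (h * (csum n (fun j => / (z + natC j)) + / (z + natC n))))
        with (- (h * csum n (fun j => / (z + natC j))) + - (h / (z + natC n)))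
        by (unfold Cdiv; ring).
      rewrite Cexp_plus, (Cexp_opp (h / (z + natC n))).
      assert (Hq : 1 + h / (z + natC n) = (z + natC n + h) / (z + natC n))
        by (field; auto).
      rewrite Hq. field. repeat split; auto. apply Cexp_neq_0. }
  unfold rgn. specialize (E n). specialize (P1 n). specialize (P2 n).
  replace (/ (poch (z + h) n / (natC (fact n) * Cnatpow (S n) (z + h - 1))))
    with (/ poch (z + h) n * (natC (fact n) * Cnatpow (S n) (z + h - 1))).
  2:{ field. repeat split; auto; try apply fact_neq_0_C; apply Cnatpow_neq_0. }
  rewrite E. unfold psin.
  replace (z + h - 1) with ((z - 1) + h) by ring. rewrite Cnatpow_plus.
  replace (h * (RtoC (lnS n) - hsum z n)) with (h * RtoC (lnS n) + - (h * hsum z n)) by ring.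
  rewrite Cexp_plus.
  change (Cexp (h * RtoC (lnS n))) with (Cnatpow (S n) h).
  field. repeat split; auto; try apply fact_neq_0_C; apply Cnatpow_neq_0.
Qed.

(** Limit and derivative are never exchanged: the second-order estimate is proved for the n-th Gauss
    product with constants independent of n, and then passes to the limit. *)
Lemma CGamma_second_order (z : C) : notpole z ->
  exists d K, (0 < d)%R /\ forall h, (Cmod h < d)%R ->
    (Cmod (CGamma (z + h) - CGamma z * Cexp (h * psi z)) <= K * Cmod h ^ 2)%R.
Proof.
  intros Hz. destruct (notpole_lower z Hz) as [d0 [Hd0 Hlow]].
  set (b := fun k => (/ (INR (S k)) ^ 2)%R).
  assert (Hb : forall k, (0 <= b k)%R).
  { intros k. left. apply Rinv_0_lt_compat, pow_lt, lt_0_INR. lia. }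
  set (s := Series b).
  assert (Hs : (1 <= s)%R).
  { pose proof (rsum_le_Series b 1 Hb ex_series_inv_sq) as H. unfold b in H at 1. simpl in H. fold s in H. lra. }
  destruct (rgn_inv_upper z Hz) as [B [HB0 HB]].
  destruct (ccv_bounded _ _ (psi_cv z)) as [P [HP0 HP]].
  (* Each factor in [Gamma_quotient] differs from 1 by at most 10 |w|^2, where |w| <= |h| / (d0
     (j+1)); so q |h|^2 bounds the sum of these deviations. For 2 q |h| < d0 every |w| and also q
     |h|^2 are at most 1/2. *)
  set (q := (10 * s / d0 ^ 2)%R).
  assert (Hd2 : (0 < d0 ^ 2 <= 1)%R) by (split; [apply pow_lt|]; nra).
  assert (Hq : (10 <= q)%R).
  { unfold q. apply Rmult_le_reg_r with (d0 ^ 2)%R; [lra|].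
    unfold Rdiv. rewrite Rmult_assoc, Rinv_l, Rmult_1_r by lra. nra. }
  exists (d0 / (2 * q))%R, (B * exp P * (2 * q))%R.
  assert (Hd : (0 < d0 / (2 * q))%R) by (apply Rdiv_lt_0_compat; lra).
  split; [exact Hd|]. intros h Hh.
  assert (Hhq : (2 * q * Cmod h < d0)%R).
  { apply (Rmult_lt_compat_l (2 * q)) in Hh; [|lra].
    replace (2 * q * (d0 / (2 * q)))%R with d0 in Hh by (field; lra). exact Hh. }
  pose proof (Cmod_ge_0 h) as Hh0.
  assert (Hw : forall j, (Cmod (h / (z + natC j)) <= Cmod h / d0 * / INR (S j))%R).
  { intros j. pose proof (INR_S_ge1 j). specialize (Hlow j).
    assert (0 < Cmod (z + natC j))%R by nra.
    rewrite Cmod_div by (now apply Cmod_gt_0). unfold Rdiv. rewrite Rmult_assoc, <- Rinv_mult.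
    apply Rmult_le_compat_l; [exact Hh0|]. apply Rinv_le_contravar; nra. }
  assert (Hw2 : forall j, (Cmod (h / (z + natC j)) <= 1 / 2)%R).
  { intros j. eapply Rle_trans; [apply Hw|]. pose proof (INR_S_ge1 j).
    assert (/ INR (S j) <= 1)%R by (rewrite <- Rinv_1; apply Rinv_le_contravar; lra).
    assert (0 < / INR (S j))%R by (apply Rinv_0_lt_compat; lra).
    assert (Cmod h / d0 <= 1 / 2)%R.
    { apply Rmult_le_reg_r with d0; [lra|]. unfold Rdiv. rewrite Rmult_assoc, Rinv_l by lra. nra. }
    assert (0 <= Cmod h / d0)%R by (apply Rdiv_le_0_compat; lra). nra. }
  assert (Hnz : forall j, z + natC j <> 0) by (intros j; now apply notpole_neq_0).
  assert (Hnz1 : forall j, 1 + h / (z + natC j) <> 0).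
  { intros j. apply Cmod_gt_0. pose proof (Cmod_triangle_minus 1 (- (h / (z + natC j)))) as T.
    rewrite Cmod_1, Cmod_opp in T. specialize (Hw2 j).
    replace (1 - - (h / (z + natC j))) with (1 + h / (z + natC j)) in T by ring. lra. }
  assert (Hnz2 : forall j, z + natC j + h <> 0).
  { intros j E. apply (Hnz1 j). replace (1 + h / (z + natC j)) with ((z + natC j + h) / (z + natC j)) by (field; auto).
    rewrite E. unfold Cdiv. ring. }
  assert (Hzh : notpole (z + h)).
  { intros m E. apply (Hnz2 m). transitivity (z + h + natC m); [ring|]. rewrite E. ring. }
  assert (Hn : forall n, (Cmod (/ rgn n (z + h) - / rgn n z * Cexp (h * psin n z)) <= B * exp P * (2 * q) * Cmod h ^ 2)%R).
  { intros n. rewrite Gamma_quotient by auto.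
    set (a := fun j => Cexp (h / (z + natC j)) / (1 + h / (z + natC j)) - 1).
    rewrite (cprod_ext n _ (fun j => 1 + a j)) by (intros; unfold a; ring).
    replace (/ rgn n z * Cexp (h * psin n z) * cprod n (fun j => 1 + a j) - / rgn n z * Cexp (h * psin n z))
      with (/ rgn n z * Cexp (h * psin n z) * (cprod n (fun j => 1 + a j) - 1)) by ring.
    rewrite !Cmod_mult.
    assert (X1 : (Cmod (Cexp (h * psin n z)) <= exp P)%R).
    { rewrite Cmod_Cexp. pose proof (re_le_Cmod (h * psin n z)) as T. rewrite Cmod_mult in T.
      pose proof (Rle_abs (Re (h * psin n z))). specialize (HP n).
      assert (Cmod h <= 1)%R by nra. pose proof (Cmod_ge_0 (psin n z)).
      assert (Re (h * psin n z) <= P)%R by nra.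
      destruct (Req_dec (Re (h * psin n z)) P) as [->|Hne]; [lra|]. left. apply exp_increasing. lra. }
    assert (X2 : (Cmod (cprod n (fun j => 1 + a j)%C - 1) <= 2 * (q * Cmod h ^ 2))%R).
    { eapply Rle_trans; [apply cprod_near_1|].
      assert (Hsum : (rsum n (fun j => Cmod (a j)) <= q * Cmod h ^ 2)%R).
      { apply Rle_trans with (rsum n (fun j => 10 * (Cmod h / d0) ^ 2 * b j)%R).
        - apply rsum_le. intros j _. unfold a.
          set (w := h / (z + natC j)).
          replace (Cexp w / (1 + w) - 1) with ((Cexp w - 1 - w) / (1 + w)) by (field; apply Hnz1).
          rewrite Cmod_div by apply Hnz1.
          pose proof (Cexp_second_order w (Hw2 j)) as S2.
          pose proof (Cmod_triangle_minus 1 (- w)) as T. rewrite Cmod_1, Cmod_opp in T.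
          replace (1 - - w) with (1 + w) in T by ring. pose proof (Hw2 j) as W2. fold w in W2.
          apply Rle_trans with (10 * Cmod w ^ 2)%R.
          + apply Rmult_le_reg_r with (Cmod (1 + w)); [lra|].
            unfold Rdiv. rewrite Rmult_assoc, Rinv_l, Rmult_1_r by lra.
            pose proof (pow2_ge_0 (Cmod w)). nra.
          + rewrite Rmult_assoc. apply Rmult_le_compat_l; [lra|]. unfold b. rewrite <- pow_inv, <- Rpow_mult_distr.
            apply pow_incr. split; [apply Cmod_ge_0|apply Hw].
        - rewrite rsum_scal. pose proof (rsum_le_Series b n Hb ex_series_inv_sq) as T. fold s in T.
          replace (q * Cmod h ^ 2)%R with (10 * (Cmod h / d0) ^ 2 * s)%R by (unfold q; field; lra).
          apply Rmult_le_compat_l; [|exact T]. pose proof (pow2_ge_0 (Cmod h / d0)). lra. }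
      assert (Hsmall : (q * Cmod h ^ 2 <= 1 / 2)%R) by nra.
      assert (H0 : (0 <= rsum n (fun j => Cmod (a j)))%R).
      { clear. induction n as [|n IH]; simpl; [lra|]. pose proof (Cmod_ge_0 (a n)). lra. }
      set (x := rsum n (fun j => Cmod (a j))) in *.
      pose proof (exp_minus1_le x ltac:(rewrite Rabs_pos_eq; lra)). nra. }
    apply Rle_trans with (B * exp P * (2 * (q * Cmod h ^ 2)))%R; [|apply Req_le; ring].
    apply Rmult_le_compat; [|apply Cmod_ge_0| |exact X2].
    - apply Rmult_le_pos; apply Cmod_ge_0.
    - apply Rmult_le_compat; try apply Cmod_ge_0; auto. }
  rewrite !CGamma_rG by auto.
  refine (ccv_Cmod_le _ _ _ O (fun n _ => Hn n) _).
  apply ccv_minus.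
  - apply ccv_inv; [apply rgn_cv|now apply rG_neq_0].
  - apply ccv_mult; [apply ccv_inv; [apply rgn_cv|now apply rG_neq_0]|].
    apply Cexp_continuous, ccv_scal, psi_cv.
Qed.

Lemma is_derive_of_second_order (f : C -> C) (z c : C) (d K : R) : (0 < d)%R ->
  (forall h, (Cmod h < d)%R -> (Cmod (f (z + h)%C - f z * Cexp (h * c)) <= K * Cmod h ^ 2)%R) ->
  is_derive f z (f z * c).
Proof.
  intros Hd H. apply is_derive_C_iff. intros eps He.
  pose proof (Cmod_ge_0 c) as Hc. pose proof (Cmod_ge_0 (f z)) as Hf.
  set (K' := (Rabs K + Cmod (f z) * (5 * Cmod c ^ 2) + 1)%R).
  assert (HK' : (1 <= K')%R).
  { unfold K'. pose proof (Rabs_pos K). pose proof (pow2_ge_0 (Cmod c)).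
    assert (0 <= Cmod (f z) * (5 * Cmod c ^ 2))%R by nra. lra. }
  set (d1 := (/ (2 * (Cmod c + 1)))%R).
  assert (Hd1 : (0 < d1)%R) by (apply Rinv_0_lt_compat; lra).
  exists (Rmin (Rmin d d1) (eps / K')). split.
  { repeat apply Rmin_pos; try lra. apply Rdiv_lt_0_compat; lra. }
  intros h Hh. pose proof (Cmod_ge_0 h) as Hh0.
  pose proof (Rmin_l (Rmin d d1) (eps / K')). pose proof (Rmin_r (Rmin d d1) (eps / K')).
  pose proof (Rmin_l d d1). pose proof (Rmin_r d d1).
  specialize (H h ltac:(lra)).
  assert (Hhc : (Cmod (h * c) <= 1 / 2)%R).
  { rewrite Cmod_mult. assert (Cmod h < d1)%R by lra.
    assert (d1 * (2 * (Cmod c + 1)) = 1)%R by (apply Rinv_l; lra). nra. }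
  pose proof (Cexp_second_order (h * c) Hhc) as S2.
  replace (f (z + h) - f z - h * (f z * c)) with
    ((f (z + h) - f z * Cexp (h * c)) + f z * (Cexp (h * c) - 1 - h * c)) by ring.
  eapply Rle_trans; [apply Cmod_triangle|]. rewrite (Cmod_mult (f z)).
  rewrite Cmod_mult in S2.
  assert (T1 : (Cmod (f z) * Cmod (Cexp (h * c) - 1 - h * c) <= Cmod (f z) * (5 * Cmod c ^ 2) * Cmod h ^ 2)%R).
  { eapply Rle_trans; [apply Rmult_le_compat_l; [exact Hf|exact S2]|]. apply Req_le. ring. }
  assert (T2 : (K * Cmod h ^ 2 <= Rabs K * Cmod h ^ 2)%R).
  { apply Rmult_le_compat_r; [apply pow2_ge_0|apply Rle_abs]. }
  assert (T3 : (K' * Cmod h <= eps)%R).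
  { assert (Cmod h <= eps / K')%R by lra. apply (Rmult_le_compat_l K') in H4; [|lra].
    replace (K' * (eps / K'))%R with eps in H4 by (field; lra). exact H4. }
  assert (T4 : (K' * Cmod h ^ 2 <= eps * Cmod h)%R) by nra.
  pose proof (pow2_ge_0 (Cmod h)). unfold K' in T4. lra.
Qed.

Lemma is_derive_CGamma (z : C) : notpole z -> is_derive CGamma z (CGamma z * psi z).
Proof.
  intros Hz. destruct (CGamma_second_order z Hz) as [d [K [Hd H]]].
  now apply is_derive_of_second_order with d K.
Qed.

Lemma CGamma_neq_0 (z : C) : notpole z -> CGamma z <> 0.
Proof.
  intros Hz E. rewrite CGamma_rG in E by exact Hz.
  apply C1_nz. rewrite <- (Cinv_r (rG z)), E by now apply rG_neq_0. ring.
Qed.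

(** [CGamma'] chooses some derivative by [epsilon]; existence and uniqueness of the complex
    derivative identify the choice. *)
Lemma digamma_psi (z : C) : notpole z -> digamma z = psi z.
Proof.
  intros Hz. unfold digamma.
  assert (E : CGamma' z = CGamma z * psi z).
  { apply (is_derive_C_unique CGamma z); [|now apply is_derive_CGamma].
    unfold CGamma'. apply epsilon_spec. exists (CGamma z * psi z). now apply is_derive_CGamma. }
  rewrite E. field. now apply CGamma_neq_0.
Qed.

(** * The reflection formulas *)

(* For x = p + i q: kre - i kim = cos(2xt), sre + i sim = sin(2xt), and J n x below is the
   integral of cos^n t cos(2xt) over [0, pi/2].  Its recursion in n multiplies out to
   sin(pi x) = pi x prod (1 - x^2/j^2). *)
Definition kre (p q t : R) : R :=
  (cos (2 * p * t) * ((exp (2 * q * t) + exp (- (2 * q * t))) / 2))%R.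
Definition kim (p q t : R) : R :=
  (sin (2 * p * t) * ((exp (2 * q * t) - exp (- (2 * q * t))) / 2))%R.
Definition sre (p q t : R) : R :=
  (sin (2 * p * t) * ((exp (2 * q * t) + exp (- (2 * q * t))) / 2))%R.
Definition sim (p q t : R) : R :=
  (cos (2 * p * t) * ((exp (2 * q * t) - exp (- (2 * q * t))) / 2))%R.

Definition Jre (n : nat) (p q : R) : R := RInt (fun t => cos t ^ n * kre p q t)%R 0 (PI / 2).
Definition Jim (n : nat) (p q : R) : R := RInt (fun t => cos t ^ n * kim p q t)%R 0 (PI / 2).

Lemma ex_RInt_derivable (f : R -> R) (a b : R) :
  (forall t, ex_derive f t) -> ex_RInt f a b.
Proof.
  intros H. apply (ex_RInt_continuous (V := R_CompleteNormedModule)).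
  intros t _. apply (ex_derive_continuous (K := R_AbsRing) (V := R_NormedModule)). apply H.
Qed.

Lemma ex_derive_kre n p q t : ex_derive (fun t => cos t ^ n * kre p q t)%R t.
Proof. unfold kre. auto_derive. auto. Qed.
Lemma ex_derive_kim n p q t : ex_derive (fun t => cos t ^ n * kim p q t)%R t.
Proof. unfold kim. auto_derive. auto. Qed.

Lemma is_RInt_Jre n p q : is_RInt (fun t => cos t ^ n * kre p q t)%R 0 (PI / 2) (Jre n p q).
Proof.
  apply (RInt_correct (V := R_CompleteNormedModule)), ex_RInt_derivable. intros; apply ex_derive_kre.
Qed.
Lemma is_RInt_Jim n p q : is_RInt (fun t => cos t ^ n * kim p q t)%R 0 (PI / 2) (Jim n p q).
Proof.
  apply (RInt_correct (V := R_CompleteNormedModule)), ex_RInt_derivable. intros; apply ex_derive_kim.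
Qed.

Lemma is_RInt_lin (f g h : R -> R) (a b lf lg lh x y z : R) :
  is_RInt f a b lf -> is_RInt g a b lg -> is_RInt h a b lh ->
  is_RInt (fun t => x * f t + (y * g t + z * h t))%R a b (x * lf + (y * lg + z * lh))%R.
Proof.
  intros Hf Hg Hh.
  apply (is_RInt_plus (V := R_NormedModule)); [now apply (is_RInt_scal (V := R_NormedModule))|].
  apply (is_RInt_plus (V := R_NormedModule)); now apply (is_RInt_scal (V := R_NormedModule)).
Qed.

Lemma RInt_antiderivative (F f : R -> R) (a b l : R) :
  (forall t, is_derive F t (f t)) -> (forall t, ex_derive f t) -> is_RInt f a b l ->
  l = (F b - F a)%R.
Proof.
  intros HF Hf Hl.
  apply (is_RInt_unique (V := R_CompleteNormedModule)) in Hl. rewrite <- Hl.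
  apply (is_RInt_unique (V := R_CompleteNormedModule)).
  apply (is_RInt_derive (V := R_CompleteNormedModule) F f).
  - intros t _. apply HF.
  - intros t _. apply (ex_derive_continuous (K := R_AbsRing) (V := R_NormedModule)). apply Hf.
Qed.

Lemma cos_PI2_pow (n : nat) : (cos (PI / 2) ^ S n = 0)%R.
Proof. rewrite cos_PI2. simpl. ring. Qed.

(* Integrate the derivative of n cos^(n-1) t sin t cos(2xt) - 2x cos^n t sin(2xt). *)
Lemma Jre_rec n p q :
  (((INR n + 2) ^ 2 - 4 * (p ^ 2 - q ^ 2)) * Jre (S (S n)) p q - 8 * p * q * Jim (S (S n)) p q
   = (INR n + 2) * (INR n + 1) * Jre n p q)%R.
Proof.
  pose proof (is_RInt_lin _ _ _ 0 (PI / 2) _ _ _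
    ((INR n + 2) ^ 2 - 4 * (p ^ 2 - q ^ 2))%R (- (8 * p * q))%R (- ((INR n + 2) * (INR n + 1)))%R
    (is_RInt_Jre (S (S n)) p q) (is_RInt_Jim (S (S n)) p q) (is_RInt_Jre n p q)) as H.
  apply (RInt_antiderivative (fun t => (INR n + 2) * cos t ^ (S n) * sin t * kre p q t
     - 2 * cos t ^ S (S n) * (p * sre p q t - q * sim p q t))%R) in H.
  - rewrite !cos_PI2_pow in H. rewrite sin_0 in H.
    unfold sre, sim in H. rewrite !Rmult_0_r, sin_0, Ropp_0, exp_0 in H.
    ring_simplify in H. ring_simplify. lra.
  - intros t. unfold kre, kim, sre, sim. auto_derive; [auto|].
    replace (match n with O => 1 | S _ => INR n + 1 end)%R with (INR n + 1)%R by (destruct n; simpl; ring).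
    change (pred (S n)) with n. change (pred (S (S n))) with (S n).
    pose proof (sin2_cos2 t) as E. unfold Rsqr in E.
    set (A := exp (2 * q * t)). set (B := exp (- (2 * q * t))).
    set (Sn := sin (2 * p * t)). set (Cn := cos (2 * p * t)).
    set (s := sin t) in *. set (c := cos t) in *.
    simpl pow. set (P := (c ^ n)%R).
    ring_simplify. replace (s ^ 2)%R with (1 - c ^ 2)%R by (simpl; lra). field.
  - intros t. unfold kre, kim. auto_derive. auto.
Qed.

Lemma Jim_rec n p q :
  (((INR n + 2) ^ 2 - 4 * (p ^ 2 - q ^ 2)) * Jim (S (S n)) p q + 8 * p * q * Jre (S (S n)) p q
   = (INR n + 2) * (INR n + 1) * Jim n p q)%R.
Proof.
  pose proof (is_RInt_lin _ _ _ 0 (PI / 2) _ _ _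
    ((INR n + 2) ^ 2 - 4 * (p ^ 2 - q ^ 2))%R (8 * p * q)%R (- ((INR n + 2) * (INR n + 1)))%R
    (is_RInt_Jim (S (S n)) p q) (is_RInt_Jre (S (S n)) p q) (is_RInt_Jim n p q)) as H.
  apply (RInt_antiderivative (fun t => (INR n + 2) * cos t ^ (S n) * sin t * kim p q t
     + 2 * cos t ^ S (S n) * (p * sim p q t + q * sre p q t))%R) in H.
  - rewrite !cos_PI2_pow in H. rewrite sin_0 in H.
    unfold sre, sim in H. rewrite !Rmult_0_r, sin_0, Ropp_0, exp_0 in H.
    ring_simplify in H. ring_simplify. lra.
  - intros t. unfold kre, kim, sre, sim. auto_derive; [auto|].
    replace (match n with O => 1 | S _ => INR n + 1 end)%R with (INR n + 1)%R by (destruct n; simpl; ring).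
    change (pred (S n)) with n. change (pred (S (S n))) with (S n).
    pose proof (sin2_cos2 t) as E. unfold Rsqr in E.
    set (A := exp (2 * q * t)). set (B := exp (- (2 * q * t))).
    set (Sn := sin (2 * p * t)). set (Cn := cos (2 * p * t)).
    set (s := sin t) in *. set (c := cos t) in *.
    simpl pow. set (P := (c ^ n)%R).
    ring_simplify. replace (s ^ 2)%R with (1 - c ^ 2)%R by (simpl; lra). field.
  - intros t. unfold kre, kim. auto_derive. auto.
Qed.

Definition J (n : nat) (x : C) : C := (Jre n (fst x) (snd x), (- Jim n (fst x) (snd x))%R).

Lemma J_rec n (x : C) :
  ((natC n + 2) ^ 2 - 4 * x ^ 2) * J (S (S n)) x = (natC n + 2) * (natC n + 1) * J n x.
Proof.
  destruct x as [p q]. pose proof (Jre_rec n p q) as H1. pose proof (Jim_rec n p q) as H2.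
  unfold J. cbn [fst snd].
  apply injective_projections; simpl; simpl in H1, H2; lra.
Qed.

Definition wallis (n : nat) : R := Jre n 0 0.

Lemma is_RInt_wallis n : is_RInt (fun t => cos t ^ n)%R 0 (PI / 2) (wallis n).
Proof.
  apply (is_RInt_ext (fun t => cos t ^ n * kre 0 0 t)%R); [|apply is_RInt_Jre].
  intros t _. unfold kre. rewrite !Rmult_0_r, !Rmult_0_l, cos_0, Ropp_0, exp_0. simpl. field.
Qed.

Lemma wallis_rec n : ((INR n + 2) * wallis (S (S n)) = (INR n + 1) * wallis n)%R.
Proof.
  pose proof (Jre_rec n 0 0) as H. fold (wallis n) (wallis (S (S n))) in H.
  pose proof (pos_INR n). apply Rmult_eq_reg_l with (INR n + 2)%R; lra.
Qed.

Lemma wallis_0 : wallis 0 = (PI / 2)%R.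
Proof.
  pose proof (is_RInt_wallis 0) as H.
  apply (RInt_antiderivative (fun t => t)) in H; [lra| |]; intros t; simpl; auto_derive; auto.
Qed.

Lemma wallis_pos m : (0 < wallis (2 * m))%R.
Proof.
  induction m as [|m IH].
  - rewrite Nat.mul_0_r, wallis_0. pose proof PI_RGT_0. lra.
  - replace (2 * S m)%nat with (S (S (2 * m))) by lia.
    pose proof (wallis_rec (2 * m)) as H. pose proof (pos_INR (2 * m)). nra.
Qed.

(** The elementary integral of cos(2xt), left without division so that x = 0 is included. *)
Lemma J_0_sin (x : C) : 2 * x * J 0 x = Csin (RtoC PI * x).
Proof.
  destruct x as [p q].
  pose proof (is_RInt_lin _ _ _ 0 (PI / 2) _ _ _ (2 * p)%R (2 * q)%R 0%R
    (is_RInt_Jre 0 p q) (is_RInt_Jim 0 p q) (is_RInt_Jim 0 p q)) as H1.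
  apply (RInt_antiderivative (sre p q)) in H1.
  2:{ intros t. unfold sre, kre, kim. auto_derive; [auto|]. field. }
  2:{ intros t. unfold kre, kim. auto_derive. auto. }
  pose proof (is_RInt_lin _ _ _ 0 (PI / 2) _ _ _ (2 * q)%R (- (2 * p))%R 0%R
    (is_RInt_Jre 0 p q) (is_RInt_Jim 0 p q) (is_RInt_Jim 0 p q)) as H2.
  apply (RInt_antiderivative (sim p q)) in H2.
  2:{ intros t. unfold sim, kre, kim. auto_derive; [auto|]. field. }
  2:{ intros t. unfold kre, kim. auto_derive. auto. }
  unfold sre, sim in H1, H2. rewrite !Rmult_0_r, sin_0, Ropp_0, exp_0 in H1.
  rewrite !Rmult_0_r, cos_0, Ropp_0, exp_0 in H2.
  unfold J. cbn [fst snd].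
  transitivity ((2 * p * Jre 0 p q + 2 * q * Jim 0 p q)%R, (2 * q * Jre 0 p q - 2 * p * Jim 0 p q)%R).
  { apply injective_projections; simpl; ring. }
  replace (2 * p * Jre 0 p q + 2 * q * Jim 0 p q)%R with
    (sin (2 * p * (PI / 2)) * ((exp (2 * q * (PI / 2)) + exp (- (2 * q * (PI / 2)))) / 2))%R by lra.
  replace (2 * q * Jre 0 p q - 2 * p * Jim 0 p q)%R with
    (cos (2 * p * (PI / 2)) * ((exp (2 * q * (PI / 2)) - exp (- (2 * q * (PI / 2)))) / 2))%R by lra.
  replace (2 * p * (PI / 2))%R with (PI * p)%R by field.
  replace (2 * q * (PI / 2))%R with (PI * q)%R by field.
  unfold Csin.
  replace (Ci * (RtoC PI * (p, q))) with ((- (PI * q))%R, (PI * p)%R)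
    by (apply injective_projections; simpl; ring).
  replace (- ((- (PI * q))%R, (PI * p)%R)) with ((PI * q)%R, (- (PI * p))%R)
    by (apply injective_projections; simpl; ring).
  unfold Cexp, Re, Im. cbn [fst snd]. rewrite cos_neg, sin_neg.
  apply injective_projections; simpl; field.
Qed.

Lemma exp_minus1_abs (v : R) : (Rabs (exp v - 1) <= Rabs v * exp (Rabs v))%R.
Proof.
  pose proof (exp_ineq1_le v) as H1. pose proof (exp_ineq1_le (- v)) as H2. pose proof (exp_pos v) as Hp.
  rewrite exp_Ropp in H2.
  assert (H3 : ((1 - v) * exp v <= 1)%R).
  { apply (Rmult_le_compat_r (exp v)) in H2; [|lra]. rewrite Rinv_l in H2 by lra. lra. }
  destruct (Rle_lt_dec 0 v) as [Hv|Hv].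
  - rewrite (Rabs_pos_eq v) by exact Hv. rewrite Rabs_pos_eq; lra.
  - rewrite (Rabs_left v) by exact Hv.
    assert (1 <= exp (- v))%R by (pose proof (exp_ineq1_le (- v)); lra).
    assert (exp v < 1)%R by (rewrite <- exp_0; now apply exp_increasing).
    rewrite Rabs_left by lra. nra.
Qed.

Lemma exp_second_le (v : R) : (0 <= exp v - 1 - v <= v ^ 2 * exp (Rabs v))%R.
Proof.
  pose proof (exp_ineq1_le v) as H1. pose proof (exp_ineq1_le (- v)) as H2. pose proof (exp_pos v) as Hp.
  rewrite exp_Ropp in H2.
  assert (H3 : ((1 - v) * exp v <= 1)%R).
  { apply (Rmult_le_compat_r (exp v)) in H2; [|lra]. rewrite Rinv_l in H2 by lra. lra. }
  split; [lra|]. apply Rle_trans with (v * (exp v - 1))%R; [lra|].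
  eapply Rle_trans; [apply Rle_abs|]. rewrite Rabs_mult.
  replace (v ^ 2)%R with (Rabs v * Rabs v)%R by (rewrite <- Rabs_mult, Rabs_pos_eq; nra).
  rewrite Rmult_assoc. apply Rmult_le_compat_l; [apply Rabs_pos|apply exp_minus1_abs].
Qed.

Lemma PI2_lt_2 : (PI / 2 <= 2)%R.
Proof. pose proof PI_4. lra. Qed.

(** The function cos(2xt) - 1 is O(t^2) uniformly on the interval, with a constant that depends on x
    alone. The exponent 4 |q| bounds |2qt| because pi/2 <= 2. *)
Lemma kernel_bounds (p q t : R) : (0 <= t <= PI / 2)%R ->
  let K := ((4 * p ^ 2 + 4 * q ^ 2) * exp (4 * Rabs q))%R in
  (Rabs (kre p q t - 1) <= K * t ^ 2 /\ Rabs (kim p q t) <= K * t ^ 2)%R.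
Proof.
  intros Ht K. unfold kre, kim. pose proof PI2_lt_2.
  set (u := (2 * p * t)%R). set (v := (2 * q * t)%R).
  assert (Hv : (Rabs v <= 4 * Rabs q)%R).
  { unfold v. rewrite !Rabs_mult, (Rabs_pos_eq t), (Rabs_pos_eq 2) by lra.
    pose proof (Rabs_pos q). nra. }
  set (X := exp (4 * Rabs q)) in *.
  assert (HX : (exp (Rabs v) <= X)%R) by now apply exp_le_mono.
  assert (HX1 : (1 <= X)%R).
  { unfold X. pose proof (exp_ineq1_le (4 * Rabs q)). pose proof (Rabs_pos q). lra. }
  pose proof (exp_second_le v) as [E1 E2]. pose proof (exp_second_le (- v)) as [E3 E4].
  rewrite Rabs_Ropp in E4.
  pose proof (cos_minus1_le u) as [C1 C2].
  pose proof (pow2_ge_0 u) as U0. pose proof (pow2_ge_0 v) as V0.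
  assert (V1 : (v ^ 2 * exp (Rabs v) <= v ^ 2 * X)%R) by (apply Rmult_le_compat_l; lra).
  replace ((- v) ^ 2)%R with (v ^ 2)%R in E4 by ring.
  assert (Eu : (u ^ 2 = 4 * p ^ 2 * t ^ 2)%R) by (unfold u; ring).
  assert (Ev : (v ^ 2 = 4 * q ^ 2 * t ^ 2)%R) by (unfold v; ring).
  set (ch := ((exp v + exp (- v)) / 2)%R). set (sh := ((exp v - exp (- v)) / 2)%R).
  assert (Hch : (1 <= ch <= X)%R).
  { unfold ch. split; [lra|].
    assert (exp v <= X)%R by (apply Rle_trans with (2 := HX); apply exp_le_mono, Rle_abs).
    assert (exp (- v) <= X)%R by (apply Rle_trans with (2 := HX); apply exp_le_mono; rewrite <- Rabs_Ropp; apply Rle_abs).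
    lra. }
  assert (Hch1 : (ch - 1 <= v ^ 2 * X)%R) by (unfold ch; lra).
  split.
  - replace (cos u * ch - 1)%R with (- (1 - cos u) * ch + (ch - 1))%R by ring.
    eapply Rle_trans; [apply Rabs_triang|]. rewrite Rabs_mult, Rabs_Ropp, !Rabs_pos_eq by lra.
    assert ((1 - cos u) * ch <= u ^ 2 / 2 * X)%R by (apply Rmult_le_compat; lra).
    unfold K. pose proof (pow2_ge_0 p). pose proof (pow2_ge_0 t).
    assert (0 <= p ^ 2 * t ^ 2 * X)%R by (apply Rmult_le_pos; nra).
    rewrite Eu, Ev in *. nra.
  - rewrite Rabs_mult. pose proof (sin_abs_le u) as S1.
    assert (Hsh : (Rabs sh <= Rabs v * X)%R).
    { unfold sh. pose proof (exp_minus1_abs v) as A1. pose proof (exp_minus1_abs (- v)) as A2.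
      rewrite Rabs_Ropp in A2. pose proof (Rabs_pos v).
      replace ((exp v - exp (- v)) / 2)%R with ((exp v - 1) / 2 + - ((exp (- v) - 1) / 2))%R by field.
      eapply Rle_trans; [apply Rabs_triang|]. rewrite Rabs_Ropp. unfold Rdiv. rewrite !Rabs_mult.
      rewrite (Rabs_pos_eq (/ 2)) by lra.
      assert (Rabs v * exp (Rabs v) <= Rabs v * X)%R by (apply Rmult_le_compat_l; lra). lra. }
    apply Rle_trans with (Rabs u * (Rabs v * X))%R.
    { apply Rmult_le_compat; try apply Rabs_pos; auto. }
    assert (Huv : (Rabs u * Rabs v <= u ^ 2 + v ^ 2)%R).
    { pose proof (pow2_ge_0 (Rabs u - Rabs v)).
      rewrite <- (pow2_abs u), <- (pow2_abs v). pose proof (Rabs_pos u). pose proof (Rabs_pos v). nra. }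
    rewrite <- Rmult_assoc. unfold K.
    replace ((4 * p ^ 2 + 4 * q ^ 2) * X * t ^ 2)%R with ((u ^ 2 + v ^ 2) * X)%R by (rewrite Eu, Ev; ring).
    apply Rmult_le_compat_r; lra.
Qed.

(** Since t^2 <= 4, one has sin t >= t - t^3/6 >= t/3. This trades t^2 for sin^2 t = 1 - cos^2 t,
    whose integral against cos^n t is exactly [wallis n - wallis (S (S n))]. *)
Lemma t_le_3sin (t : R) : (0 <= t <= PI / 2)%R -> (t ^ 2 <= 9 * sin t ^ 2)%R.
Proof.
  intros Ht. pose proof PI2_lt_2. pose proof PI_RGT_0.
  destruct (pre_sin_bound t 0 ltac:(lra) ltac:(lra)) as [Hl _].
  unfold sin_approx, sin_term in Hl; simpl in Hl.
  assert (Hl' : (t - t ^ 3 / 6 <= sin t)%R) by lra.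
  assert (t ^ 3 <= 4 * t)%R by (simpl; nra).
  assert (t <= 3 * sin t)%R by lra. nra.
Qed.

Lemma J_bound n p q :
  let K := ((4 * p ^ 2 + 4 * q ^ 2) * exp (4 * Rabs q))%R in
  (Rabs (Jre n p q - wallis n) <= 9 * K * (wallis n - wallis (S (S n))) /\
   Rabs (Jim n p q) <= 9 * K * (wallis n - wallis (S (S n))))%R.
Proof.
  intros K.
  assert (HK : (0 <= K)%R).
  { unfold K. pose proof (exp_pos (4 * Rabs q)). pose proof (pow2_ge_0 p). pose proof (pow2_ge_0 q).
    apply Rmult_le_pos; lra. }
  assert (Hg : is_RInt (fun t => 9 * K * (cos t ^ n * sin t ^ 2))%R 0 (PI / 2)
                 (9 * K * (wallis n - wallis (S (S n))))%R).
  { eapply is_RInt_ext; [|apply (is_RInt_scal (V := R_NormedModule)),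
      (is_RInt_minus (V := R_NormedModule)); [apply is_RInt_wallis|apply (is_RInt_wallis (S (S n)))]].
    intros t _. pose proof (sin2_cos2 t) as E. unfold Rsqr in E.
    change (9 * K * (cos t ^ n - cos t ^ S (S n)) = 9 * K * (cos t ^ n * sin t ^ 2))%R.
    replace (sin t ^ 2)%R with (1 - cos t * cos t)%R by (simpl; lra). simpl. ring. }
  pose proof PI_RGT_0.
  assert (Hpt : forall t g, (0 <= t <= PI / 2)%R -> (Rabs g <= K * t ^ 2)%R ->
    (Rabs (cos t ^ n * g) <= 9 * K * (cos t ^ n * sin t ^ 2))%R).
  { intros t g Ht Hgt.
    assert (0 <= cos t)%R by (apply cos_ge_0; lra).
    assert (0 <= cos t ^ n)%R by (now apply pow_le).
    rewrite Rabs_mult, (Rabs_pos_eq (cos t ^ n)) by auto.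
    replace (9 * K * (cos t ^ n * sin t ^ 2))%R with (cos t ^ n * (K * (9 * sin t ^ 2)))%R by ring.
    apply Rmult_le_compat_l; [auto|]. eapply Rle_trans; [exact Hgt|].
    apply Rmult_le_compat_l; [exact HK|now apply t_le_3sin]. }
  split.
  - apply (norm_RInt_le (V := R_NormedModule) (fun t => cos t ^ n * (kre p q t - 1))%R
      (fun t => 9 * K * (cos t ^ n * sin t ^ 2))%R 0 (PI / 2)); [lra| | |exact Hg].
    + intros t Ht. apply Hpt; [exact Ht|now apply kernel_bounds].
    + eapply is_RInt_ext; [|apply (is_RInt_minus (V := R_NormedModule)); [apply is_RInt_Jre|apply is_RInt_wallis]].
      intros t _. change (cos t ^ n * kre p q t - cos t ^ n = cos t ^ n * (kre p q t - 1))%R. ring.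
  - apply (norm_RInt_le (V := R_NormedModule) (fun t => cos t ^ n * kim p q t)%R
      (fun t => 9 * K * (cos t ^ n * sin t ^ 2))%R 0 (PI / 2)); [lra| |apply is_RInt_Jim|exact Hg].
    intros t Ht. apply Hpt; [exact Ht|now apply kernel_bounds].
Qed.

(** The weight cos^(2m) t concentrates at t = 0, where the kernel cos(2xt) equals 1. The rate comes
    from [wallis_rec]: w_n - w_(n+2) = w_n / (n+2). *)
Lemma J_ratio_cv (x : C) : ccv (fun m => J (2 * m) x / RtoC (wallis (2 * m))) 1.
Proof.
  destruct x as [p q]. set (K := ((4 * p ^ 2 + 4 * q ^ 2) * exp (4 * Rabs q))%R).
  assert (HK : (0 <= K)%R).
  { unfold K. pose proof (exp_pos (4 * Rabs q)). pose proof (pow2_ge_0 p). pose proof (pow2_ge_0 q).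
    apply Rmult_le_pos; lra. }
  apply (ccv_squeeze _ _ (fun m => 18 * K * / INR (S m))%R O).
  - intros m _. destruct (J_bound (2 * m) p q) as [H1 H2]. fold K in H1, H2.
    pose proof (wallis_pos m) as Hw. pose proof (wallis_rec (2 * m)) as Hr.
    set (w := wallis (2 * m)) in *.
    assert (Hw0 : RtoC w <> 0) by (intros E; apply RtoC_inj in E; lra).
    replace (J (2 * m) (p, q) / RtoC w - 1) with ((J (2 * m) (p, q) - RtoC w) / RtoC w) by (field; auto).
    rewrite Cmod_div, Cmod_R, (Rabs_pos_eq w) by (auto; lra).
    apply Rmult_le_reg_r with w; [lra|]. unfold Rdiv at 1. rewrite Rmult_assoc, Rinv_l, Rmult_1_r by lra.
    unfold J. cbn [fst snd].
    replace ((Jre (2 * m) p q, (- Jim (2 * m) p q)%R) - RtoC w) with ((Jre (2 * m) p q - w)%R, (- Jim (2 * m) p q)%R)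
      by (apply injective_projections; simpl; ring).
    eapply Rle_trans; [apply Cmod_le_abs|]. rewrite Rabs_Ropp.
    assert (Hd : ((INR (2 * m) + 2) * (w - wallis (S (S (2 * m)))) = w)%R) by lra.
    assert (Hi : (INR (2 * m) + 2 = 2 * INR (S m))%R) by (rewrite S_INR, mult_INR; simpl; ring).
    rewrite Hi in Hd. pose proof (INR_S_ge1 m).
    assert (Hdw : (w - wallis (S (S (2 * m))) = w / 2 * / INR (S m))%R).
    { rewrite <- Hd at 2. field. lra. }
    rewrite Hdw in H1, H2.
    assert (0 < / INR (S m))%R by (apply Rinv_0_lt_compat; lra).
    assert (0 <= K * w * / INR (S m))%R by (apply Rmult_le_pos; nra). lra.
  - replace (Finite 0) with (Rbar_mult (18 * K)%R 0%R) by (simpl; f_equal; ring).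
    apply (is_lim_seq_scal_l (fun m => / INR (S m))%R (18 * K)%R 0%R inv_INR_lim).
Qed.

(** Euler's product for the sine in finite form, with the error kept as a quotient of integrals. The
    recursions of [J] and [wallis] supply one factor per step; no division by j^2 - x^2 occurs, so
    integers x are allowed. *)
Lemma sine_product (x : C) (m : nat) :
  poch x (S m) * poch (1 - x) m * (J (2 * m) x / RtoC (wallis (2 * m)))
  = x * (J 0 x / RtoC (wallis 0)) * natC (fact m) ^ 2.
Proof.
  induction m as [|m IH].
  - unfold poch; simpl. ring.
  - rewrite (poch_S x (S m)), (poch_S (1 - x) m).
    replace (2 * S m)%nat with (S (S (2 * m))) by lia.
    pose proof (J_rec (2 * m) x) as HJ. pose proof (wallis_rec (2 * m)) as Hw.
    pose proof (wallis_pos m) as W0. pose proof (wallis_pos (S m)) as W1.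
    replace (2 * S m)%nat with (S (S (2 * m))) in W1 by lia.
    set (w0 := wallis (2 * m)) in *. set (w1 := wallis (S (S (2 * m)))) in *.
    set (j0 := J (2 * m) x) in *. set (j1 := J (S (S (2 * m))) x) in *.
    assert (Hm : natC (2 * m) = 2 * natC m).
    { rewrite mult_INR, RtoC_mult. reflexivity. }
    rewrite Hm in HJ.
    assert (HwC : (2 * natC m + 2) * RtoC w1 = (2 * natC m + 1) * RtoC w0).
    { rewrite <- Hm, <- !RtoC_plus, <- !RtoC_mult. f_equal. exact Hw. }
    assert (N0 : RtoC w0 <> 0) by (intros E; apply RtoC_inj in E; lra).
    assert (N1 : RtoC w1 <> 0) by (intros E; apply RtoC_inj in E; lra).
    rewrite fact_simpl, mult_INR, RtoC_mult.
    rewrite !S_INR, !RtoC_plus in *.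
    set (n := natC m) in *.
    assert (E : ((n + 1) ^ 2 - x ^ 2) * (j1 / RtoC w1) = (n + 1) ^ 2 * (j0 / RtoC w0)).
    { apply (f_equal (fun z => z / (4 * RtoC w1))) in HJ.
      replace (((n + 1) ^ 2 - x ^ 2) * (j1 / RtoC w1)) with
        (((2 * n + 2) ^ 2 - 4 * x ^ 2) * j1 / (4 * RtoC w1)) by (field; auto).
      rewrite HJ. replace ((2 * n + 2) * (2 * n + 1) * j0 / (4 * RtoC w1))
        with ((2 * n + 2) * ((2 * n + 1) * RtoC w0) * j0 / (4 * RtoC w1 * RtoC w0)) by (field; auto).
      rewrite <- HwC. field. auto. }
    transitivity (poch x (S m) * poch (1 - x) m * (((n + 1) ^ 2 - x ^ 2) * (j1 / RtoC w1))); [ring|].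
    rewrite E.
    transitivity ((n + 1) ^ 2 * (poch x (S m) * poch (1 - x) m * (j0 / RtoC w0))); [ring|].
    rewrite IH. ring.
Qed.

Lemma PI_neq_0_C : RtoC PI <> 0.
Proof. intros E. apply RtoC_inj in E. pose proof PI_RGT_0. lra. Qed.

(** In the limit the Pochhammer symbols of [sine_product] become the reciprocals of Gamma(x) and
    Gamma(1-x) and the quotient of integrals becomes 1. As an identity between entire functions it
    holds for every x. *)
Lemma rG_reflection (x : C) : rG x * rG (1 - x) = Csin (RtoC PI * x) / RtoC PI.
Proof.
  rewrite <- J_0_sin.
  apply (ccv_unique (fun m => rgn (S m) x * rgn m (1 - x) * (J (2 * m) x / RtoC (wallis (2 * m))))).
  - replace (rG x * rG (1 - x)) with (rG x * rG (1 - x) * 1) by ring.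
    apply ccv_mult; [|apply J_ratio_cv]. apply ccv_mult; [|apply rgn_cv].
    apply (ccv_subseq (fun n => rgn n x) _ S); [auto|apply rgn_cv].
  - replace (2 * x * J 0 x / RtoC PI) with (x * (J 0 x / RtoC (wallis 0)) / 1).
    2:{ rewrite wallis_0, RtoC_div by lra. field. apply PI_neq_0_C. }
    eapply ccv_ext; [|apply ccv_div; [apply ccv_const|apply (Cnatpow_ratio_cv (x - 1))|apply C1_nz]].
    intros m. cbv beta. pose proof (sine_product x m) as H.
    unfold rgn. replace (1 - x - 1) with (- (x - 1) - 1) by ring.
    rewrite (Cnatpow_minus (S m) (- (x - 1)) 1), Cnatpow_opp, Cnatpow_1_r by lia.
    rewrite (fact_simpl m), mult_INR, RtoC_mult.
    pose proof (fact_neq_0_C m) as Hf. assert (Hn : natC (S m) <> 0) by (apply INR_neq_0; lia).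
    set (A := Cnatpow (S m) (x - 1)). set (B := Cnatpow (S (S m)) (x - 1)).
    assert (HA : A <> 0) by apply Cnatpow_neq_0. assert (HB : B <> 0) by apply Cnatpow_neq_0.
    set (F := natC (fact m)) in *.
    transitivity (poch x (S m) * poch (1 - x) m * (J (2 * m) x / RtoC (wallis (2 * m))) * A / (F ^ 2 * B)).
    + rewrite H. field. repeat split; auto.
      intros E. apply RtoC_inj in E. rewrite wallis_0 in E. pose proof PI_RGT_0. lra.
    + field. repeat split; auto.
      intros E. apply RtoC_inj in E. pose proof (wallis_pos m). lra.
Qed.

Lemma Csin_neq_0 (x : C) : nonint x -> Csin (RtoC PI * x) <> 0.
Proof.
  intros Hx E. pose proof (rG_reflection x) as H. rewrite E in H.
  assert (H1 : notpole x) by now apply nonint_notpole.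
  assert (H2 : notpole (1 - x)).
  { intros m Em. apply (Hx (1 + Z.of_nat m)%Z).
    replace x with (1 - (1 - x)) by ring. rewrite Em, plus_IZR, <- INR_IZR_INZ, RtoC_plus. ring. }
  apply (Cmult_neq_0 _ _ (rG_neq_0 _ H1) (rG_neq_0 _ H2)). rewrite H. unfold Cdiv. ring.
Qed.

Lemma is_derive_Cexp_scal (c z : C) : is_derive (fun w => Cexp (c * w)) z (Cexp (c * z) * c).
Proof.
  apply (is_derive_of_second_order (fun w => Cexp (c * w)) z c 1 0); [lra|].
  intros h _. replace (c * (z + h)) with (c * z + h * c) by ring. rewrite Cexp_plus.
  replace (Cexp (c * z) * Cexp (h * c) - Cexp (c * z) * Cexp (h * c)) with (RtoC 0) by ring.
  rewrite Cmod_0. lra.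
Qed.

(** The product rule is formulated for a ring regarded as a module over itself, while derivatives on
    C are elaborated with [C_NormedModule]; the two conditions coincide. *)
Lemma is_derive_C_AbsRing (f : C -> C) (z l : C) :
  is_derive f z l <-> is_derive (V := AbsRing_NormedModule C_AbsRing) f z l.
Proof.
  split; intros [_ H]; (split; [apply is_linear_scal_l|exact H]).
Qed.

Lemma is_derive_C_mult (f g : C -> C) (z df dg : C) :
  is_derive f z df -> is_derive g z dg ->
  is_derive (fun w => f w * g w) z (df * g z + f z * dg).
Proof.
  rewrite !is_derive_C_AbsRing. intros Hf Hg.
  apply (is_derive_mult (K := C_AbsRing) f g z df dg Hf Hg). apply Cmult_comm.
Qed.

Lemma is_derive_Csin_PI (z : C) :
  is_derive (fun w => Csin (RtoC PI * w)) z (RtoC PI * Ccos (RtoC PI * z)).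
Proof.
  pose proof (is_derive_Cexp_scal (Ci * RtoC PI) z) as H1.
  pose proof (is_derive_Cexp_scal (- (Ci * RtoC PI)) z) as H2.
  pose proof (is_derive_minus (V := C_NormedModule) _ _ _ _ _ H1 H2) as H3.
  pose proof (is_derive_C_mult _ _ _ _ _ H3 (is_derive_const (V := C_NormedModule) (/ (2 * Ci)) z)) as H4.
  assert (Hi : Ci <> 0) by apply Ci_nz.
  eapply is_derive_ext in H4.
  - replace (RtoC PI * Ccos (RtoC PI * z)) with
      ((Cexp (Ci * RtoC PI * z) * (Ci * RtoC PI) - Cexp (- (Ci * RtoC PI) * z) * - (Ci * RtoC PI)) * / (2 * Ci)
       + (Cexp (Ci * RtoC PI * z) - Cexp (- (Ci * RtoC PI) * z)) * 0); [exact H4|].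
    unfold Ccos. replace (Ci * (RtoC PI * z)) with (Ci * RtoC PI * z) by ring.
    replace (- (Ci * RtoC PI * z)) with (- (Ci * RtoC PI) * z) by ring. field. auto.
  - intros t. cbv beta. unfold Csin.
    replace (Ci * (RtoC PI * t)) with (Ci * RtoC PI * t) by ring.
    replace (- (Ci * RtoC PI * t)) with (- (Ci * RtoC PI) * t) by ring. reflexivity.
Qed.

Lemma nonint_1_minus (x : C) : nonint x -> nonint (1 - x).
Proof.
  intros Hx m E. apply (Hx (1 - m)%Z).
  replace x with (1 - (1 - x)) by ring. rewrite E, minus_IZR, RtoC_minus. ring.
Qed.

(** Logarithmic differentiation of Gamma(w) Gamma(1-w) sin(pi w), which is constantly pi: both the
    product rule and constancy give its derivative at x. *)
Lemma psi_reflection (x : C) : nonint x ->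
  psi (1 - x) - psi x = RtoC PI * Ccot (RtoC PI * x).
Proof.
  intros Hx. pose proof (nonint_notpole _ Hx) as H1. pose proof (nonint_notpole _ (nonint_1_minus _ Hx)) as H2.
  pose proof (is_derive_CGamma x H1) as D1. pose proof (is_derive_CGamma (1 - x) H2) as D2.
  assert (D2' : is_derive (fun w => CGamma (1 - w)) x (- (CGamma (1 - x) * psi (1 - x)))).
  { apply is_derive_C_iff. intros eps He. destruct (proj1 (is_derive_C_iff _ _ _) D2 eps He) as [d [Hd K]].
    exists d. split; [exact Hd|]. intros h Hh. specialize (K (- h)). rewrite Cmod_opp in K.
    specialize (K Hh). cbv beta. replace (1 - (x + h)) with (1 - x + - h) by ring.
    replace (CGamma (1 - x + - h) - CGamma (1 - x) - h * - (CGamma (1 - x) * psi (1 - x)))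
      with (CGamma (1 - x + - h) - CGamma (1 - x) - - h * (CGamma (1 - x) * psi (1 - x))) by ring.
    exact K. }
  pose proof (is_derive_C_mult _ _ _ _ _ (is_derive_C_mult _ _ _ _ _ D1 D2') (is_derive_Csin_PI x)) as D.
  assert (Hconst : forall w, notpole w -> notpole (1 - w) ->
     CGamma w * CGamma (1 - w) * Csin (RtoC PI * w) = RtoC PI).
  { intros w W1 W2. rewrite !CGamma_rG by auto.
    replace (Csin (RtoC PI * w)) with (rG w * rG (1 - w) * RtoC PI).
    - field. split; now apply rG_neq_0.
    - rewrite rG_reflection. field. apply PI_neq_0_C. }
  (* Constancy is known only off the poles of the two Gamma factors; [notpole_lower] supplies a disc
     around x that avoids them. *)
  assert (D0 : is_derive (fun w => CGamma w * CGamma (1 - w) * Csin (RtoC PI * w)) x (RtoC 0)).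
  { apply is_derive_C_iff. intros eps He.
    destruct (notpole_lower x H1) as [d1 [Hd1 L1]]. destruct (notpole_lower (1 - x) H2) as [d2 [Hd2 L2]].
    exists (Rmin d1 d2). split; [apply Rmin_pos; lra|]. intros h Hh.
    pose proof (Rmin_l d1 d2). pose proof (Rmin_r d1 d2). cbv beta.
    assert (W : forall y d g, (0 < d <= 1)%R -> (Cmod g < d)%R ->
      (forall j, (d * INR (S j) <= Cmod (y + natC j))%R) -> notpole (y + g)).
    { intros y d g Hd Hg L m E. specialize (L m). pose proof (INR_S_ge1 m).
      replace (y + natC m) with (- g) in L; [rewrite Cmod_opp in L; nra|].
      transitivity (y + g + natC m - g); [rewrite E; ring|ring]. }
    rewrite !Hconst; auto.
    - replace (RtoC PI - RtoC PI - h * 0) with (RtoC 0) by ring. rewrite Cmod_0.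
      apply Rmult_le_pos; [lra|apply Cmod_ge_0].
    - apply (W x d1); auto. lra.
    - replace (1 - (x + h)) with (1 - x + - h) by ring. apply (W (1 - x) d2); auto. rewrite Cmod_opp. lra. }
  pose proof (is_derive_C_unique _ _ _ _ D D0) as E. cbv beta in E.
  pose proof (CGamma_neq_0 x H1) as G1. pose proof (CGamma_neq_0 (1 - x) H2) as G2.
  pose proof (Csin_neq_0 x Hx) as S0. unfold Ccot.
  set (g1 := CGamma x) in *. set (g2 := CGamma (1 - x)) in *.
  set (sn := Csin (RtoC PI * x)) in *. set (cs := Ccos (RtoC PI * x)) in *.
  assert (E2 : (psi (1 - x) - psi x) * sn = RtoC PI * cs).
  { apply Ceq_minus.
    transitivity (- (0 / (g1 * g2))); [|unfold Cdiv; ring]. rewrite <- E. field. auto. }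
  transitivity ((psi (1 - x) - psi x) * sn / sn); [field; exact S0|].
  rewrite E2. unfold Cdiv. ring.
Qed.

(** * Residues of a rational function *)

(* Products of [pun] omit their vanishing factors. *)
Definition pun (y : C) : C := if Ceq_dec y 0 then 1 else y.

Lemma pun_neq_0 (y : C) : pun y <> 0.
Proof. unfold pun. destruct (Ceq_dec y 0); [apply C1_nz|auto]. Qed.

Lemma pun_id (y : C) : y <> 0 -> pun y = y.
Proof. intros H. unfold pun. destruct (Ceq_dec y 0); [contradiction|auto]. Qed.

Lemma pun_0 : pun 0 = 1.
Proof. unfold pun. destruct (Ceq_dec 0 0); [auto|congruence]. Qed.

Lemma vsum_cons (x : C) (l : list C) : vsum (x :: l) = x + vsum l.
Proof. reflexivity. Qed.
Lemma vsum_app (l m : list C) : vsum (l ++ m) = vsum l + vsum m.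
Proof. induction l as [|x l IH]; simpl; [ring|]. rewrite IH. ring. Qed.

Lemma vprod_neq_0 {A : Type} (f : A -> C) (l : list A) :
  (forall x, In x l -> f x <> 0) -> vprod (map f l) <> 0.
Proof.
  induction l as [|x l IH]; intros H; simpl; [apply C1_nz|].
  apply Cmult_neq_0; [apply H; now left|apply IH; intros; apply H; now right].
Qed.

(* A denominator is a list of roots, the boolean telling whether the root is double. *)
Definition den_factor (r : C) (p : C * bool) : C :=
  pun (r - fst p) * (if snd p then pun (r - fst p) else 1).
Definition punctured_value (ns : list C) (ps : list (C * bool)) (r : C) : C :=
  vprod (map (fun n => r - n) ns) / vprod (map (den_factor r) ps).
Definition log_deriv (ns : list C) (ps : list (C * bool)) (r : C) : C :=
  vsum (map (fun n => / (r - n)) ns)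
  - vsum (map (fun p => (if snd p : bool then 2 else 1) / (r - fst p)) ps).
(* At a double root the residue is the derivative of the punctured value; the terms of
   [log_deriv] belonging to the root itself vanish because / 0 = 0. *)
Definition residue (ns : list C) (ps : list (C * bool)) (p : C * bool) : C :=
  punctured_value ns ps (fst p) * (if snd p then log_deriv ns ps (fst p) else 1).
Definition residues (ns : list C) (ps : list (C * bool)) : C :=
  vsum (map (residue ns ps) ps).
Definition size (ps : list (C * bool)) : nat :=
  fold_right (fun p s => ((if snd p : bool then 2 else 1) + s)%nat) O ps.
(** The effect of cancelling one factor t - p: a double root becomes simple and a simple root
    disappears. *)
Definition lower (p : C * bool) : list (C * bool) :=
  if snd p then [(fst p, false)] else [].

Lemma den_neq_0 (r : C) (ps : list (C * bool)) : vprod (map (den_factor r) ps) <> 0.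
Proof.
  apply vprod_neq_0. intros [x m] _. unfold den_factor; simpl.
  apply Cmult_neq_0; [apply pun_neq_0|]. destruct m; [apply pun_neq_0|apply C1_nz].
Qed.

Lemma vsum_map_lin {A : Type} (f g h : A -> C) (c : C) (l : list A) :
  (forall x, In x l -> f x = g x + c * h x) ->
  vsum (map f l) = vsum (map g l) + c * vsum (map h l).
Proof.
  induction l as [|x l IH]; intros H; simpl; [ring|].
  rewrite IH, (H x) by (try (now left); intros; apply H; now right). ring.
Qed.

(* Partial fractions: t - n = (t - p) + (p - n). *)
Lemma residues_numerator (n : C) (ns : list C) (p : C * bool) (ps : list (C * bool)) :
  NoDup (map fst (p :: ps)) ->
  (forall q, In q (p :: ps) -> snd q = true -> n <> fst q) ->
  residues (n :: ns) (p :: ps)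
  = residues ns (lower p ++ ps) + (fst p - n) * residues ns (p :: ps).
Proof.
  intros Hnd Hn. inversion Hnd as [|a l Hp Hps E]; subst.
  assert (Hterm : forall q, In q ps ->
    residue (n :: ns) (p :: ps) q
    = residue ns (lower p ++ ps) q + (fst p - n) * residue ns (p :: ps) q).
  { intros q Hq. assert (Hpq : fst q - fst p <> 0).
    { intros E. apply Hp. apply Ceq_minus in E. rewrite <- E. now apply in_map. }
    (* At a double root that is also a zero of the numerator, the product is 0 and / 0 = 0 removes
       the compensating term of [log_deriv], so [residue] would not be the derivative. This is why
       such coincidences are excluded. *)
    pose proof (Hn q (or_intror Hq)) as Hnq.
    unfold residue, punctured_value, log_deriv.
    rewrite !map_app. destruct p as [p mp], q as [q mq]. unfold lower.
    cbn [fst snd] in *.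
    pose proof (den_neq_0 q ps) as HD.
    set (D := vprod (map (den_factor q) ps)) in *.
    destruct mp, mq; simpl; fold D; unfold den_factor; cbn [fst snd];
      rewrite (pun_id _ Hpq);
      try (assert (q - n <> 0) by (intros E; apply (Hnq eq_refl); symmetry; now apply Ceq_minus));
      field; auto. }
  unfold residues at 1 3. rewrite !(map_cons _ p ps), !vsum_cons.
  rewrite (vsum_map_lin _ _ _ _ ps Hterm).
  enough (E : residue (n :: ns) (p :: ps) p
     = vsum (map (residue ns (lower p ++ ps)) (lower p)) + (fst p - n) * residue ns (p :: ps) p).
  { rewrite E. unfold residues. rewrite map_app, vsum_app. ring. }
  pose proof (Hn p (or_introl eq_refl)) as Hnp.
  destruct p as [p mp]. unfold lower. cbn [fst snd] in *.
  pose proof (den_neq_0 p ps) as HD.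
  unfold residue, punctured_value, log_deriv. cbn [fst snd].
  set (D := vprod (map (den_factor p) ps)) in *.
  assert (Z : p - p = 0) by ring.
  destruct mp; simpl; fold D; unfold den_factor; cbn [fst snd]; rewrite Z, pun_0;
    unfold Cdiv; rewrite ?Cinv_0.
  - assert (p - n <> 0) by (intros E; apply (Hnp eq_refl); symmetry; now apply Ceq_minus).
    field; auto.
  - field; auto.
Qed.

(* Partial fractions: p - q = (t - q) - (t - p). *)
Lemma residues_base (p q : C * bool) (l : list (C * bool)) :
  NoDup (map fst (p :: q :: l)) ->
  (fst p - fst q) * residues [] (p :: q :: l)
  = residues [] (p :: lower q ++ l) - residues [] (lower p ++ q :: l).
Proof.
  intros Hnd. inversion Hnd as [|a l' Hp Hnd' E]; subst.
  inversion Hnd' as [|a l' Hq Hl E]; subst.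
  assert (Hpq : fst p - fst q <> 0).
  { intros E. apply Hp. apply Ceq_minus in E. rewrite E. now left. }
  assert (Hqp : fst q - fst p <> 0).
  { intros E. apply Hpq. replace (fst p - fst q) with (- (fst q - fst p)) by ring. rewrite E. ring. }
  assert (Hterm : forall r, In r l ->
    residue [] (p :: lower q ++ l) r
    = residue [] (lower p ++ q :: l) r + (fst p - fst q) * residue [] (p :: q :: l) r).
  { intros r Hr.
    assert (Hrp : fst r - fst p <> 0).
    { intros E. apply Hp. apply Ceq_minus in E. rewrite <- E. right. now apply in_map. }
    assert (Hrq : fst r - fst q <> 0).
    { intros E. apply Hq. apply Ceq_minus in E. rewrite <- E. now apply in_map. }
    unfold residue, punctured_value, log_deriv.
    rewrite !map_cons, !map_app, !map_cons. destruct p as [p mp], q as [q mq], r as [r mr]. unfold lower.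
    cbn [fst snd] in *. pose proof (den_neq_0 r l) as HD.
    set (D := vprod (map (den_factor r) l)) in *.
    destruct mp, mq, mr; simpl; fold D; unfold den_factor; cbn [fst snd];
      rewrite (pun_id _ Hrp), (pun_id _ Hrq); field; auto. }
  pose proof (vsum_map_lin _ _ _ _ l Hterm) as HL.
  unfold residues. rewrite !map_cons, !map_app, !map_cons, !vsum_cons, !vsum_app, !vsum_cons, HL.
  enough (E : (fst p - fst q) * (residue [] (p :: q :: l) p + residue [] (p :: q :: l) q)
    = residue [] (p :: lower q ++ l) p + vsum (map (residue [] (p :: lower q ++ l)) (lower q))
      - (vsum (map (residue [] (lower p ++ q :: l)) (lower p)) + residue [] (lower p ++ q :: l) q)).
  { transitivity ((fst p - fst q) * (residue [] (p :: q :: l) p + residue [] (p :: q :: l) q)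
      + (fst p - fst q) * vsum (map (residue [] (p :: q :: l)) l)); [ring|]. rewrite E. ring. }
  destruct p as [p mp], q as [q mq]. unfold lower. cbn [fst snd] in *.
  pose proof (den_neq_0 p l) as HDp. pose proof (den_neq_0 q l) as HDq.
  unfold residue, punctured_value, log_deriv. cbn [fst snd].
  set (Dp := vprod (map (den_factor p) l)) in *. set (Dq := vprod (map (den_factor q) l)) in *.
  assert (Zp : p - p = 0) by ring. assert (Zq : q - q = 0) by ring.
  destruct mp, mq; simpl; fold Dp Dq; unfold den_factor; cbn [fst snd];
    rewrite ?Zp, ?Zq, ?pun_0, ?(pun_id _ Hpq), ?(pun_id _ Hqp);
    unfold Cdiv; rewrite ?Cinv_0; field; auto.
Qed.

(** Induction on the total number of linear factors. The first partial-fraction identity removes a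
    zero of the numerator without reducing the degree deficit; for an empty numerator the second
    removes roots until one double root, of residue 0, or two simple roots remain. *)
Lemma residue_theorem (ns : list C) (ps : list (C * bool)) :
  NoDup (map fst ps) ->
  (forall n q, In n ns -> In q ps -> snd q = true -> n <> fst q) ->
  (length ns + 2 <= size ps)%nat ->
  residues ns ps = 0.
Proof.
  remember (length ns + size ps)%nat as N eqn:HN.
  revert ns ps HN. induction N as [N IH] using lt_wf_ind. intros ns ps HN Hnd Hns Hsz.
  assert (Hlow : forall p, size (lower p) = ((if snd p : bool then 2 else 1) - 1)%nat)
    by (intros [p []]; reflexivity).
  assert (Hsapp : forall l m, size (l ++ m) = (size l + size m)%nat).
  { induction l as [|x l IHl]; intros m; simpl; [auto|]. rewrite IHl. lia. }
  assert (Hndlow : forall p l, NoDup (map fst (p :: l)) -> NoDup (map fst (lower p ++ l))).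
  { intros [p []] l H; [exact H|]. inversion H; auto. }
  destruct ns as [|n ns].
  - destruct ps as [|p [|q l]]; [simpl in Hsz; lia| |].
    + destruct p as [p []]; simpl in Hsz; [|lia].
      unfold residues, residue, punctured_value, log_deriv. simpl.
      replace (p - p) with (RtoC 0) by ring. unfold Cdiv at 2. rewrite Cinv_0. ring.
    + assert (Hpq : fst p - fst q <> 0).
      { inversion Hnd as [|a l' Hp _ E]; subst. intros E. apply Hp. apply Ceq_minus in E. rewrite E. now left. }
      pose proof (residues_base p q l Hnd) as E.
      assert (Hnd1 : NoDup (map fst (p :: lower q ++ l))).
      { destruct q as [q []]; [exact Hnd|]. cbn [lower snd app].
        inversion Hnd as [|a l' Hp Hnd' E1]; subst. inversion Hnd'; subst.
        constructor; [|auto]. intros Hin. apply Hp. now right. }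
      pose proof (Hndlow p (q :: l) Hnd) as Hnd2.
      assert (Hz : residues [] (p :: lower q ++ l) - residues [] (lower p ++ q :: l) = 0).
      (* With three roots or more, counted with multiplicity, both shorter lists still have at least
         two. With exactly two, both are simple and each shorter list has a single simple root of
         residue 1, so the difference vanishes. *)
      { destruct (le_lt_dec 3 (size (p :: q :: l))) as [H3|H3].
        - rewrite (IH (0 + size (p :: lower q ++ l))%nat), (IH (0 + size (lower p ++ q :: l))%nat); try ring; auto;
            try (intros ? ? []); pose proof (Hsapp (lower p) (q :: l)) as S1;
            pose proof (Hsapp (lower q) l) as S2; pose proof (Hlow p) as L1; pose proof (Hlow q) as L2;
            simpl in *; destruct (snd p), (snd q); simpl in *; lia.
        - destruct p as [p []], q as [q []], l as [|[l []] l2]; simpl in H3; try lia.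
          unfold residues, residue, punctured_value, den_factor; simpl.
          replace (p - p) with (RtoC 0) by ring. replace (q - q) with (RtoC 0) by ring.
          rewrite pun_0. field. }
      rewrite Hz in E.
      rewrite <- (Cmult_1_l (residues [] (p :: q :: l))), <- (Cinv_l _ Hpq), <- Cmult_assoc, E. ring.
  - destruct ps as [|p ps]; [simpl in Hsz; lia|].
    rewrite residues_numerator; [|exact Hnd|intros q Hq; apply Hns; [now left|exact Hq]].
    rewrite (IH (length ns + size (lower p ++ ps))%nat), (IH (length ns + size (p :: ps))%nat); try ring; auto.
    all: pose proof (Hsapp (lower p) ps) as S1; pose proof (Hlow p) as L1;
      try (simpl in *; destruct (snd p); simpl in *; lia).
    + intros m q Hm Hq. apply Hns; [now right|exact Hq].
    + intros m q Hm Hq Hs. apply in_app_or in Hq. destruct Hq as [Hq|Hq].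
      * destruct p as [p []]; simpl in Hq; [|destruct Hq].
        destruct Hq as [<-|[]]. discriminate Hs.
      * apply Hns; auto; now right.
Qed.

(** * Truncated Gamma quotients *)

(** y and k are separate arguments because the singular case is y = 0, where the factor j = k is
    dropped; genericity leaves only y = 0 and y not an integer. *)
Definition ppoch (y : C) (k M : nat) : C :=
  cprod M (fun j => pun (y - natC k + natC j)).
Definition prgn (M : nat) (y : C) (k : nat) : C :=
  ppoch y k M / (natC (fact M) * Cnatpow (S M) (y - natC k - 1)).
(** (-1)^k k! is the derivative of 1/Gamma at -k, the inverse of the residue of Gamma there. *)
Definition prG (y : C) (k : nat) : C :=
  if Ceq_dec y 0 then (-1) ^ k * natC (fact k) else rG (y - natC k).

(* The truncated Phi at its pole v0 + k, v0 in V, without the vanishing factors.  The poles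
   -u0 - k, u0 in U, are those of t -> Phi(-t), which exchanges U with V and W with X. *)
Definition term (M : nat) (U V W X : list C) (v0 : C) (k : nat) : C :=
  vprod (map (fun w => rgn M (w + v0 + natC k)) W)
  * vprod (map (fun x => rgn M (x - v0 - natC k)) X)
  / (vprod (map (fun u => rgn M (u + v0 + natC k)) U)
     * vprod (map (fun v => prgn M (v - v0) k) V)).
Definition term_lim (U V W X : list C) (v0 : C) (k : nat) : C :=
  vprod (map (fun w => rG (w + v0 + natC k)) W)
  * vprod (map (fun x => rG (x - v0 - natC k)) X)
  / (vprod (map (fun u => rG (u + v0 + natC k)) U)
     * vprod (map (fun v => prG (v - v0) k) V)).

Lemma nonint_plus_Z (y : C) (m : Z) : nonint y -> nonint (y + RtoC (IZR m)).
Proof.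
  intros H n E. apply (H (n - m)%Z). rewrite minus_IZR, RtoC_minus, <- E. ring.
Qed.

Lemma nonint_minus_nat (y : C) (k : nat) : nonint y -> nonint (y - natC k).
Proof.
  intros H. replace (y - natC k) with (y + RtoC (IZR (- Z.of_nat k))).
  - now apply nonint_plus_Z.
  - rewrite opp_IZR, <- INR_IZR_INZ, RtoC_opp. reflexivity.
Qed.

Lemma nonint_plus_nat (y : C) (k : nat) : nonint y -> nonint (y + natC k).
Proof. rewrite INR_IZR_INZ. apply nonint_plus_Z. Qed.

Lemma nonint_neq_0 (y : C) : nonint y -> y <> 0.
Proof. intros H. apply (H 0%Z). Qed.

Lemma nonint_opp (y : C) : nonint y -> nonint (- y).
Proof.
  intros H m E. apply (H (- m)%Z). rewrite opp_IZR, RtoC_opp, <- E. ring.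
Qed.

Lemma ppoch_nonint (y : C) (k M : nat) : nonint y -> ppoch y k M = poch (y - natC k) M.
Proof.
  intros H. apply cprod_ext. intros j _. apply pun_id, nonint_neq_0, nonint_plus_nat.
  now apply nonint_minus_nat.
Qed.

Lemma fact_C_S (n : nat) : natC (fact (S n)) = natC (S n) * natC (fact n).
Proof. rewrite fact_simpl, mult_INR, RtoC_mult. reflexivity. Qed.

(** The condition k < M places the vanishing factor inside the product; below it stand -k, ..., -1
    and above it 1, ..., M-1-k. *)
Lemma ppoch_0 (k M : nat) : (k < M)%nat ->
  ppoch 0 k M = (-1) ^ k * natC (fact k) * natC (fact (M - 1 - k)).
Proof.
  intros H. unfold ppoch. replace M with (k + (1 + (M - 1 - k)))%nat at 1 by lia.
  rewrite !cprod_add, <- Cmult_assoc.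
  assert (E1 : cprod k (fun j => pun (0 - natC k + natC j)) = (-1) ^ k * natC (fact k)).
  { rewrite <- poch_1_fact. replace (poch 1 k) with (poch (1 - 0) k) by (f_equal; ring). rewrite <- poch_minus_k.
    apply cprod_ext. intros j Hj. apply pun_id.
    replace (0 - natC k + natC j) with (- (natC k - natC j)) by ring.
    rewrite <- RtoC_minus, <- minus_INR, <- RtoC_opp by lia. intros E. apply RtoC_inj in E.
    assert (0 < INR (k - j))%R by (apply lt_0_INR; lia). lra. }
  rewrite E1, <- Cmult_assoc. f_equal. f_equal. simpl. rewrite Nat.add_0_r.
  replace (0 - natC k + natC k) with (RtoC 0) by ring. rewrite pun_0, !Cmult_1_l.
  rewrite <- poch_1_fact. apply cprod_ext. intros j _.
  rewrite Nat.add_succ_r, S_INR, plus_INR, !RtoC_plus.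
  replace (0 - natC k + (natC k + natC j + 1)) with (1 + natC j) by ring.
  apply pun_id. rewrite <- RtoC_plus. intros E. apply RtoC_inj in E. pose proof (pos_INR j). lra.
Qed.

(** A product of k + 1 factors (M-i)/(M+1), i <= k, each tending to 1. It shows that the
    normalisation of [prgn] fits the singular case as well. *)
Lemma falling_ratio_cv (k : nat) :
  ccv (fun M => natC (fact M) / (natC (fact (M - 1 - k)) * natC (S M) ^ (S k))) 1.
Proof.
  assert (Hlin : forall c : C, ccv (fun M => 1 - c * RtoC (/ INR (S M))) 1).
  { intros c. apply (eq_ind (1 - c * 0) (ccv _)); [|ring].
    apply ccv_minus; [apply ccv_const|]. apply ccv_scal, ccv_RtoC, inv_INR_lim. }
  induction k as [|k IH].
  - apply ccv_ext_loc with (2 := Hlin 1) (N := 1%nat). intros M HM.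
    destruct M as [|M]; [lia|]. replace (S M - 1 - 0)%nat with M by lia.
    rewrite fact_C_S, Cpow_1_r, RtoC_inv by (apply not_0_INR; lia).
    rewrite (S_INR (S M)), RtoC_plus. field. split; [|apply fact_neq_0_C].
    cbv beta. rewrite <- RtoC_plus, <- S_INR. apply INR_neq_0. lia.
  - apply (eq_ind (1 * 1) (ccv _)); [|ring].
    apply ccv_ext_loc with (2 := ccv_mult _ _ _ _ IH (Hlin (natC (S (S k))))) (N := S (S k)).
    intros M HM. replace (M - 1 - k)%nat with (S (M - 1 - S k)) by lia.
    rewrite fact_C_S, (Cpow_S (natC (S M)) (S k)), RtoC_inv by (apply not_0_INR; lia).
    assert (E : natC (S (M - 1 - S k)) = natC (S M) - natC (S (S k))).
    { rewrite <- RtoC_minus, <- minus_INR by lia. do 2 f_equal. lia. }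
    assert (N1 : natC (S (M - 1 - S k)) <> 0) by (apply INR_neq_0; lia).
    assert (N2 : natC (S M) <> 0) by (apply INR_neq_0; lia).
    rewrite E in *. field. repeat split; auto; try apply fact_neq_0_C. now apply (Cpow_nz _ (S k)).
Qed.

Lemma Cnatpow_INR (N k : nat) : (0 < N)%nat -> Cnatpow N (natC k) = natC N ^ k.
Proof.
  intros H. induction k as [|k IH]; [apply Cnatpow_0_r|].
  rewrite S_INR, RtoC_plus, Cnatpow_plus, IH, Cnatpow_1_r, Cpow_S by exact H. ring.
Qed.

Lemma prgn_cv (y : C) (k : nat) : y = 0 \/ nonint y -> ccv (fun M => prgn M y k) (prG y k).
Proof.
  intros [->|Hy]; unfold prG.
  - destruct (Ceq_dec 0 0) as [_|H]; [|congruence].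
    pose proof (ccv_inv _ _ (falling_ratio_cv k) C1_nz) as H.
    apply (ccv_scal ((-1) ^ k * natC (fact k))) in H.
    replace ((-1) ^ k * natC (fact k) * / 1) with ((-1) ^ k * natC (fact k)) in H by field.
    apply ccv_ext_loc with (2 := H) (N := S k). intros M HM.
    unfold prgn. rewrite ppoch_0 by lia.
    replace (0 - natC k - 1) with (- natC (S k)) by (rewrite S_INR, RtoC_plus; ring).
    rewrite Cnatpow_opp, Cnatpow_INR by lia.
    field. repeat split; try apply fact_neq_0_C. apply Cpow_nz, INR_neq_0. lia.
  - destruct (Ceq_dec y 0) as [E|_]; [now apply nonint_neq_0 in Hy|].
    apply ccv_ext with (fun M => rgn M (y - natC k)); [|apply rgn_cv].
    intros M. unfold prgn. now rewrite ppoch_nonint.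
Qed.

Lemma prG_neq_0 (y : C) (k : nat) : y = 0 \/ nonint y -> prG y k <> 0.
Proof.
  intros H. unfold prG. destruct (Ceq_dec y 0) as [E|E].
  - apply Cmult_neq_0; [|apply fact_neq_0_C]. apply Cpow_nz. intros E1. apply RtoC_inj in E1. lra.
  - destruct H as [H|H]; [contradiction|]. apply rG_neq_0, nonint_notpole. now apply nonint_minus_nat.
Qed.

Lemma vprod_cv {A : Type} (f : nat -> A -> C) (g : A -> C) (l : list A) :
  (forall x, In x l -> ccv (fun M => f M x) (g x)) ->
  ccv (fun M => vprod (map (f M) l)) (vprod (map g l)).
Proof.
  induction l as [|x l IH]; intros H; simpl; [apply ccv_const|].
  apply ccv_mult; [apply H; now left|apply IH; intros; apply H; now right].
Qed.

Lemma vsum_cv {A : Type} (f : nat -> A -> C) (g : A -> C) (l : list A) :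
  (forall x, In x l -> ccv (fun M => f M x) (g x)) ->
  ccv (fun M => vsum (map (f M) l)) (vsum (map g l)).
Proof.
  induction l as [|x l IH]; intros H; simpl; [apply ccv_const|].
  apply ccv_plus; [apply H; now left|apply IH; intros; apply H; now right].
Qed.

Lemma term_cv (U V W X : list C) (v0 : C) (k : nat) :
  (forall u, In u U -> notpole (u + v0)) ->
  (forall v, In v V -> v - v0 = 0 \/ nonint (v - v0)) ->
  ccv (fun M => term M U V W X v0 k) (term_lim U V W X v0 k).
Proof.
  intros HU HV. apply ccv_div; [apply ccv_mult|apply ccv_mult|apply Cmult_neq_0].
  - apply (vprod_cv (fun M w => rgn M (w + v0 + natC k))). intros; apply rgn_cv.
  - apply (vprod_cv (fun M w => rgn M (w - v0 - natC k))). intros; apply rgn_cv.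
  - apply (vprod_cv (fun M w => rgn M (w + v0 + natC k))). intros; apply rgn_cv.
  - apply (vprod_cv (fun M w => prgn M (w - v0) k)). intros; apply prgn_cv; auto.
  - apply vprod_neq_0. intros u Hu. apply rG_neq_0, notpole_plus. auto.
  - apply vprod_neq_0. intros u Hu. apply prG_neq_0. auto.
Qed.

(** * Bounds for the truncated terms, uniform in M and k *)

Definition lf (n : nat) : R := ln (INR (fact n)).

Lemma exp_lf (n : nat) : exp (lf n) = INR (fact n).
Proof. apply exp_ln, lt_0_INR, lt_O_fact. Qed.

Lemma Cmod_fact (n : nat) : Cmod (natC (fact n)) = exp (lf n).
Proof. rewrite Cmod_R, Rabs_pos_eq, exp_lf; [easy|apply pos_INR]. Qed.

(* rgn M (y + k) and rgn M (y - k) have the orders of magnitude exp (eU (Re y) M k) and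
   exp (eV (Re y) M k). *)
Definition eU (r : R) (M k : nat) : R :=
  (lf (M + k) - lf k - lf M + (r - 1) * (lnS (M + k) - lnS k) - (r + INR k - 1) * lnS M)%R.
Definition eV (r : R) (M k : nat) : R :=
  (lf k - r * lnS k + lf (M - k) + (r - 1) * lnS (M - k) - lf M - (r - INR k - 1) * lnS M)%R.

Lemma Re_plus (x y : C) : Re (x + y) = (Re x + Re y)%R.
Proof. reflexivity. Qed.
Lemma Re_RtoC (x : R) : Re (RtoC x) = x.
Proof. reflexivity. Qed.

Lemma Cmod_normalisation (n : nat) (y : C) :
  Cmod (natC (fact n) * Cnatpow (S n) (y - 1)) = exp (lf n + (Re y - 1) * lnS n).
Proof.
  rewrite Cmod_mult, Cmod_fact, Cmod_Cnatpow, <- exp_plus, Re_minus, Re_RtoC. reflexivity.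
Qed.

Lemma normalisation_neq_0 (n : nat) (y : C) : natC (fact n) * Cnatpow (S n) y <> 0.
Proof. apply Cmult_neq_0; [apply fact_neq_0_C|apply Cnatpow_neq_0]. Qed.

(** Writing (y+k)_M = (y)_(M+k) / (y)_k reduces uniformity in the two indices to the boundedness of
    the single sequence [rgn n y] and of its inverse. *)
Lemma Cmod_rgn_plus (y : C) (M k : nat) : notpole y ->
  Cmod (rgn M (y + natC k)) = (Cmod (rgn (M + k) y) * Cmod (/ rgn k y) * exp (eU (Re y) M k))%R.
Proof.
  intros Hy. pose proof (rgn_neq_0 y k Hy) as H0.
  assert (E : rgn M (y + natC k) = rgn (M + k) y * / rgn k y *
    ((natC (fact (M + k)) * Cnatpow (S (M + k)) (y - 1)) /
     ((natC (fact k) * Cnatpow (S k) (y - 1)) *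
      (natC (fact M) * Cnatpow (S M) (y + natC k - 1))))).
  { unfold rgn at 1.
    assert (P : poch (y + natC k) M = poch y (M + k) / poch y k).
    { rewrite Nat.add_comm, poch_add. field. now apply poch_neq_0. }
    rewrite P, (poch_rgn y (M + k)), (poch_rgn y k).
    field. repeat split; try apply Cnatpow_neq_0; try apply fact_neq_0_C; exact H0. }
  rewrite E, Cmod_mult, Cmod_mult, Cmod_div, (Cmod_mult (natC (fact k) * _)), !Cmod_normalisation.
  2:{ apply Cmult_neq_0; apply normalisation_neq_0. }
  f_equal. unfold Rdiv. rewrite <- exp_plus, <- exp_Ropp, <- exp_plus. f_equal.
  rewrite Re_plus, Re_RtoC. unfold eU. ring.
Qed.

Lemma Cmod_rgn_minus (y : C) (M k : nat) : (k <= M)%nat ->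
  Cmod (rgn M (y - natC k)) = (Cmod (rgn k (1 - y)) * Cmod (rgn (M - k) y) * exp (eV (Re y) M k))%R.
Proof.
  intros Hk.
  assert (E : rgn M (y - natC k) = (-1) ^ k * (rgn k (1 - y) * rgn (M - k) y *
    ((natC (fact k) * Cnatpow (S k) (1 - y - 1)) * (natC (fact (M - k)) * Cnatpow (S (M - k)) (y - 1)) /
      (natC (fact M) * Cnatpow (S M) (y - natC k - 1))))).
  { unfold rgn at 1. rewrite poch_minus by exact Hk. rewrite (poch_rgn (1 - y) k), (poch_rgn y (M - k)).
    field. repeat split; try apply Cnatpow_neq_0; apply fact_neq_0_C. }
  rewrite E, Cmod_mult, Cmod_pow.
  replace (Cmod (-1)) with 1%R by (rewrite Cmod_R, Rabs_left; lra).
  rewrite pow1, Rmult_1_l, Cmod_mult, Cmod_mult, Cmod_div, (Cmod_mult (natC (fact k) * _)), !Cmod_normalisation.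
  2:{ apply normalisation_neq_0. }
  f_equal. unfold Rdiv. rewrite <- exp_plus, <- exp_Ropp, <- exp_plus. f_equal.
  rewrite !Re_minus, !Re_RtoC. unfold eV. ring.
Qed.

Lemma rgn_plus_upper (y : C) : notpole y -> exists B, (0 < B)%R /\ forall M k,
  (Cmod (rgn M (y + natC k)) <= B * exp (eU (Re y) M k))%R.
Proof.
  intros Hy. destruct (rgn_upper y) as [B1 [H1 K1]]. destruct (rgn_inv_upper y Hy) as [B2 [H2 K2]].
  exists (B1 * B2)%R. split; [nra|]. intros M k. rewrite Cmod_rgn_plus by exact Hy.
  apply Rmult_le_compat_r; [left; apply exp_pos|].
  apply Rmult_le_compat; auto; apply Cmod_ge_0.
Qed.

Lemma rgn_plus_inv_upper (y : C) : notpole y -> exists B, (0 < B)%R /\ forall M k,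
  (Cmod (/ rgn M (y + natC k)) <= B * exp (- eU (Re y) M k))%R.
Proof.
  intros Hy. destruct (rgn_upper y) as [B1 [H1 K1]]. destruct (rgn_inv_upper y Hy) as [B2 [H2 K2]].
  exists (B1 * B2)%R. split; [nra|]. intros M k.
  rewrite Cmod_inv by (apply rgn_neq_0, notpole_plus, Hy). rewrite Cmod_rgn_plus by exact Hy.
  rewrite !Rinv_mult, exp_Ropp. apply Rmult_le_compat_r; [left; apply Rinv_0_lt_compat, exp_pos|].
  rewrite <- !Cmod_inv by (try apply Cinv_neq_0; try apply rgn_neq_0; auto).
  rewrite Rmult_comm. specialize (K1 k). specialize (K2 (M + k)%nat).
  rewrite Cmod_inv by (now apply rgn_neq_0).
  rewrite Rinv_inv, Cmod_inv by (now apply rgn_neq_0).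
  rewrite Cmod_inv in K2 by (now apply rgn_neq_0).
  apply Rmult_le_compat; auto; [apply Cmod_ge_0|].
  left. apply Rinv_0_lt_compat. apply Cmod_gt_0. now apply rgn_neq_0.
Qed.

Lemma rgn_minus_upper (y : C) : exists B, (0 < B)%R /\ forall M k, (k <= M)%nat ->
  (Cmod (rgn M (y - natC k)) <= B * exp (eV (Re y) M k))%R.
Proof.
  destruct (rgn_upper y) as [B1 [H1 K1]]. destruct (rgn_upper (1 - y)) as [B2 [H2 K2]].
  exists (B2 * B1)%R. split; [nra|]. intros M k Hk. rewrite Cmod_rgn_minus by exact Hk.
  apply Rmult_le_compat_r; [left; apply exp_pos|].
  apply Rmult_le_compat; auto; apply Cmod_ge_0.
Qed.

Lemma lf_S (n : nat) : lf (S n) = (lnS n + lf n)%R.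
Proof.
  unfold lf, lnS. rewrite fact_simpl, mult_INR, ln_mult; auto; apply lt_0_INR; [lia|apply lt_O_fact].
Qed.

Lemma prgn_inv_upper (y : C) : y = 0 \/ nonint y -> exists B, (0 < B)%R /\ forall M k, (k < M)%nat ->
  (Cmod (/ prgn M y k) <= B * exp (- eV (Re y) M k))%R.
Proof.
  intros [->|Hy].
  - exists 1%R. split; [lra|]. intros M k Hk. unfold prgn. rewrite ppoch_0 by exact Hk.
    replace (0 - natC k - 1) with ((- natC k) - 1) by ring.
    assert (H1 : (-1) ^ k <> 0) by (apply Cpow_nz; intros E1; apply RtoC_inj in E1; lra).
    pose proof (fact_neq_0_C k) as H2. pose proof (fact_neq_0_C (M - 1 - k)) as H3.
    pose proof (normalisation_neq_0 M (- natC k - 1)) as H4.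
    assert (E : (-1) ^ k * natC (fact k) * natC (fact (M - 1 - k)) /
      (natC (fact M) * Cnatpow (S M) (- natC k - 1)) <> 0).
    { unfold Cdiv. repeat apply Cmult_neq_0; auto.
      intros E. apply C1_nz. rewrite <- (Cinv_r _ H4), E. ring. }
    rewrite Cmod_inv, Cmod_div, !(Cmod_mult _ (natC (fact (M - 1 - k)))), Cmod_normalisation, Cmod_mult, Cmod_pow, !Cmod_fact by auto.
    replace (Cmod (-1)) with 1%R by (rewrite Cmod_R, Rabs_left; lra).
    rewrite pow1, !Rmult_1_l. unfold Rdiv. rewrite Rinv_mult, Rinv_inv, Rinv_mult, <- !exp_Ropp, <- !exp_plus.

    apply exp_le_mono. replace (Re (- natC k)) with (- INR k)%R by reflexivity.
    unfold eV. change (Re (RtoC 0)) with 0%R.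
    (* Dropping the zero factor leaves (M-1-k)! where [eV] has (M-k)! / (M-k+1); the latter is the
       smaller one, which suffices for an upper bound of the inverse. *)
    replace (M - k)%nat with (S (M - 1 - k)) by lia. rewrite lf_S.
    pose proof (lnS_le (M - 1 - k) (S (M - 1 - k)) ltac:(lia)). lra.
  - destruct (rgn_inv_upper y (nonint_notpole _ Hy)) as [B1 [H1 K1]].
    assert (H1y : notpole (1 - y)).
    { apply nonint_notpole. replace (1 - y) with (- y + natC 1) by (simpl; ring).
      apply nonint_plus_nat, nonint_opp, Hy. }
    destruct (rgn_inv_upper (1 - y) H1y) as [B2 [H2 K2]].
    exists (B2 * B1)%R. split; [nra|]. intros M k Hk.
    replace (prgn M y k) with (rgn M (y - natC k)) by (unfold prgn; now rewrite ppoch_nonint).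
    assert (Hyk : notpole (y - natC k)) by (now apply nonint_notpole, nonint_minus_nat).
    rewrite Cmod_inv by (now apply rgn_neq_0). rewrite Cmod_rgn_minus by lia.
    rewrite !Rinv_mult, exp_Ropp. apply Rmult_le_compat_r; [left; apply Rinv_0_lt_compat, exp_pos|].
    specialize (K1 (M - k)%nat). specialize (K2 k).
    rewrite Cmod_inv in K1, K2 by (apply rgn_neq_0; auto using nonint_notpole).
    apply Rmult_le_compat; auto; left; apply Rinv_0_lt_compat, Cmod_gt_0, rgn_neq_0; auto using nonint_notpole.
Qed.

(** Exponents affine in Re x add up over a list to one depending only on its length and its sum, the
    two data that the balance conditions control. *)
Lemma vprod_upper (f : C -> nat -> nat -> C) (a b : nat -> nat -> R) (l : list C) :
  (forall x, In x l -> exists B, (0 < B)%R /\ forall M k, (k < M)%nat ->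
     (Cmod (f x M k) <= B * exp (a M k + Re x * b M k))%R) ->
  exists B, (0 < B)%R /\ forall M k, (k < M)%nat ->
     (Cmod (vprod (map (fun x => f x M k) l)) <= B * exp (INR (length l) * a M k + Re (vsum l) * b M k))%R.
Proof.
  induction l as [|x l IH]; intros H.
  - exists 1%R. split; [lra|]. intros M k _. simpl. rewrite Cmod_1, !Rmult_0_l, Rplus_0_r, exp_0. lra.
  - destruct (H x (or_introl eq_refl)) as [B1 [P1 K1]].
    destruct IH as [B2 [P2 K2]]; [intros; apply H; now right|].
    exists (B1 * B2)%R. split; [nra|]. intros M k Hk.
    rewrite map_cons. simpl vprod. change (fold_right Cmult 1 ?l) with (vprod l).
    rewrite Cmod_mult, vsum_cons, Re_plus. simpl length. rewrite S_INR.
    replace ((INR (length l) + 1) * a M k + (Re x + Re (vsum l)) * b M k)%R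
      with ((a M k + Re x * b M k) + (INR (length l) * a M k + Re (vsum l) * b M k))%R by ring.
    rewrite exp_plus.
    replace (B1 * B2 * (exp (a M k + Re x * b M k) * exp (INR (length l) * a M k + Re (vsum l) * b M k)))%R
      with ((B1 * exp (a M k + Re x * b M k)) * (B2 * exp (INR (length l) * a M k + Re (vsum l) * b M k)))%R by ring.
    apply Rmult_le_compat; try apply Cmod_ge_0; auto.
Qed.

Lemma vprod_inv {A : Type} (f : A -> C) (l : list A) :
  (forall x, In x l -> f x <> 0) -> / vprod (map f l) = vprod (map (fun x => / f x) l).
Proof.
  induction l as [|x l IH]; intros H; simpl; [field|].
  rewrite <- IH by (intros; apply H; now right).
  assert (H2 : vprod (map f l) <> 0) by (apply vprod_neq_0; intros; apply H; now right).
  change (fold_right Cmult 1 (map f l)) with (vprod (map f l)).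
  field. split; auto. apply H. now left.
Qed.

(** Log-convexity of the factorial at M-k, M, M+k. Its m-fold multiple has a favourable sign in
    [term_upper] because m is a natural number. *)
Lemma fact_log_convex (M k : nat) : (k <= M)%nat -> (2 * lf M <= lf (M + k) + lf (M - k))%R.
Proof.
  induction k as [|k IH]; intros H.
  - rewrite Nat.add_0_r, Nat.sub_0_r. lra.
  - specialize (IH ltac:(lia)). rewrite Nat.add_succ_r, lf_S.
    replace (M - k)%nat with (S (M - S k)) in IH by lia. rewrite lf_S in IH.
    pose proof (lnS_le (M - S k) (M + k) ltac:(lia)). lra.
Qed.

Lemma lnS_double (M k : nat) : (k <= M)%nat -> (0 <= lnS (M + k) - lnS M <= 1)%R.
Proof.
  intros H. pose proof (lnS_le M (M + k) ltac:(lia)). split; [lra|].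
  assert (H1 : (lnS (M + k) <= ln (2 * INR (S M)))%R).
  { apply ln_le; [apply lt_0_INR; lia|].
    replace 2%R with (INR 2) by reflexivity. rewrite <- mult_INR. apply le_INR. lia. }
  rewrite ln_mult in H1 by (try lra; apply lt_0_INR; lia). fold (lnS M) in H1.
  pose proof (ln_le_minus1 2 ltac:(lra)). lra.
Qed.

(** The exponents of the four products combine to four summands: -m times the log-convexity defect,
    which is at most 0; cP (ln(M+k+1) - ln(M+1)), bounded because k < M; cN (ln(M+1) - ln(M-k+1)),
    which is unbounded for k near M and is left to the regulator through A0 >= |cN|; and (-1-s)
    ln(k+1), the summable decay. *)
Lemma term_upper (U V W X : list C) (v0 : C) (m : nat) (s : R) :
  length U = (length W + m)%nat -> length V = (length X + m)%nat ->
  Re (vsum U + vsum V - vsum W - vsum X) = (INR m - 1 - s)%R ->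
  (forall u, In u U -> notpole (u + v0)) ->
  (forall w, In w W -> notpole (w + v0)) ->
  (forall v, In v V -> v - v0 = 0 \/ nonint (v - v0)) ->
  exists (A0 : nat) (B : R), (0 < B)%R /\ forall M k, (k < M)%nat ->
    (Cmod (term M U V W X v0 k)
     <= B * exp ((-1 - s) * lnS k + INR A0 * (lnS M - lnS (M - k))))%R.
Proof.
  intros HlU HlV Hsum HU HW HV. set (r := Re v0).
  set (bU := fun M k : nat => (lnS (M + k) - lnS k - lnS M)%R).
  set (bV := fun M k : nat => (- lnS k + lnS (M - k) - lnS M)%R).
  destruct (vprod_upper (fun w M k => rgn M (w + v0 + natC k)) (eU r) bU W) as [B1 [P1 K1]].
  { intros w Hw. destruct (rgn_plus_upper (w + v0) (HW w Hw)) as [B [P K]].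
    exists B. split; [exact P|]. intros M k _. eapply Rle_trans; [apply K|].
    right. do 2 f_equal. rewrite Re_plus. unfold eU, bU, r. ring. }
  destruct (vprod_upper (fun x M k => rgn M (x - v0 - natC k)) (eV (- r)) bV X) as [B2 [P2 K2]].
  { intros x Hx. destruct (rgn_minus_upper (x - v0)) as [B [P K]].
    exists B. split; [exact P|]. intros M k Hk. eapply Rle_trans; [apply K; lia|].
    right. do 2 f_equal. rewrite Re_minus. unfold eV, bV, r. ring. }
  destruct (vprod_upper (fun u M k => / rgn M (u + v0 + natC k)) (fun M k => - eU r M k)%R
    (fun M k => - bU M k)%R U) as [B3 [P3 K3]].
  { intros u Hu. destruct (rgn_plus_inv_upper (u + v0) (HU u Hu)) as [B [P K]].
    exists B. split; [exact P|]. intros M k _. eapply Rle_trans; [apply K|].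
    right. do 2 f_equal. rewrite Re_plus. unfold eU, bU, r. ring. }
  destruct (vprod_upper (fun v M k => / prgn M (v - v0) k) (fun M k => - eV (- r) M k)%R
    (fun M k => - bV M k)%R V) as [B4 [P4 K4]].
  { intros v Hv. destruct (prgn_inv_upper (v - v0) (HV v Hv)) as [B [P K]].
    exists B. split; [exact P|]. intros M k Hk. eapply Rle_trans; [apply K; exact Hk|].
    right. do 2 f_equal. rewrite Re_minus. unfold eV, bV, r. ring. }
  set (cP := (- INR m * (r - 1) + Re (vsum W) - Re (vsum U))%R).
  set (cN := (- INR m * (r + 1) - Re (vsum X) + Re (vsum V))%R).
  destruct (nat_above (Rabs cN)) as [A0 HA0]. specialize (HA0 A0 (le_n _)).
  exists A0, (B1 * B2 * (B3 * B4) * exp (Rabs cP))%R. split.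
  { pose proof (exp_pos (Rabs cP)). repeat apply Rmult_lt_0_compat; auto. }
  intros M k Hk. unfold term, Cdiv.
  assert (Hnz : forall v, In v V -> prgn M (v - v0) k <> 0).
  { intros v Hv. unfold prgn, Cdiv. apply Cmult_neq_0.
    - apply cprod_neq_0. intros; apply pun_neq_0.
    - intros E. apply C1_nz. rewrite <- (Cinv_r _ (normalisation_neq_0 M (v - v0 - natC k - 1))), E. ring. }
  assert (HnzU : forall u, In u U -> rgn M (u + v0 + natC k) <> 0).
  { intros u Hu. apply rgn_neq_0, notpole_plus. auto. }
  assert (Einv : / (vprod (map (fun u => rgn M (u + v0 + natC k)) U) * vprod (map (fun v => prgn M (v - v0) k) V))
    = vprod (map (fun u => / rgn M (u + v0 + natC k)) U) * vprod (map (fun v => / prgn M (v - v0) k) V)).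
  { rewrite <- (vprod_inv (fun u => rgn M (u + v0 + natC k))) by auto.
    rewrite <- (vprod_inv (fun v => prgn M (v - v0) k)) by auto.
    field. split; apply vprod_neq_0; auto. }
  rewrite Einv, !Cmod_mult.
  specialize (K1 M k Hk). specialize (K2 M k Hk). specialize (K3 M k Hk). specialize (K4 M k Hk).
  eapply Rle_trans.
  { apply Rmult_le_compat; [apply Rmult_le_pos; apply Cmod_ge_0|apply Rmult_le_pos; apply Cmod_ge_0| |].
    - apply Rmult_le_compat; [apply Cmod_ge_0|apply Cmod_ge_0|exact K1|exact K2].
    - apply Rmult_le_compat; [apply Cmod_ge_0|apply Cmod_ge_0|exact K3|exact K4]. }
  match goal with |- (_ * exp ?e1 * (_ * exp ?e2) * (_ * exp ?e3 * (_ * exp ?e4)) <= _)%R =>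
    replace (B1 * exp e1 * (B2 * exp e2) * (B3 * exp e3 * (B4 * exp e4)))%R
      with (B1 * B2 * (B3 * B4) * exp (e1 + e2 + (e3 + e4)))%R by (rewrite !exp_plus; ring) end.
  rewrite (Rmult_assoc _ (exp (Rabs cP))), <- exp_plus. apply Rmult_le_compat_l.
  { left. repeat apply Rmult_lt_0_compat; auto. }
  apply exp_le_mono.
  rewrite HlU, HlV, !plus_INR. rewrite !Re_minus, Re_plus in Hsum.
  pose proof (fact_log_convex M k ltac:(lia)) as HLf. pose proof (lnS_double M k ltac:(lia)) as HP.
  pose proof (lnS_le (M - k) M ltac:(lia)) as HN. pose proof (pos_INR m) as Hm.
  assert (Hs : s = (INR m - 1 - (Re (vsum U) + Re (vsum V) - Re (vsum W) - Re (vsum X)))%R) by lra.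
  subst s.
  match goal with |- (?l <= _)%R => replace l with
    (- INR m * (lf (M + k) + lf (M - k) - 2 * lf M) + cP * (lnS (M + k) - lnS M) + cN * (lnS M - lnS (M - k))
     + (Re (vsum U) + Re (vsum V) - Re (vsum W) - Re (vsum X) - INR m) * lnS k)%R
     by (unfold cP, cN, eU, eV, bU, bV; ring) end.
  assert (T1 : (cP * (lnS (M + k) - lnS M) <= Rabs cP)%R).
  { eapply Rle_trans; [apply Rle_abs|]. rewrite Rabs_mult, (Rabs_pos_eq (lnS (M + k) - lnS M)) by lra.
    pose proof (Rabs_pos cP). nra. }
  assert (T2 : (cN * (lnS M - lnS (M - k)) <= INR A0 * (lnS M - lnS (M - k)))%R).
  { apply Rmult_le_compat_r; [lra|]. eapply Rle_trans; [apply Rle_abs|exact HA0]. }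
  assert (T3 : (0 <= INR m * (lf (M + k) + lf (M - k) - 2 * lf M))%R) by (apply Rmult_le_pos; lra).
  lra.
Qed.

(** * Logarithmic growth at the double poles *)

Lemma hsum_log (y : C) : exists B, (0 < B)%R /\ forall n, (Cmod (hsum y n - RtoC (lnS n)) <= B)%R.
Proof.
  destruct (ccv_bounded _ _ (psi_cv y)) as [B [H K]]. exists B. split; [exact H|].
  intros n. rewrite Cmod_minus_sym. apply K.
Qed.

Lemma hsum_add (y : C) (m n : nat) : hsum y (m + n) = hsum y m + hsum (y + natC m) n.
Proof.
  unfold hsum. rewrite csum_add. f_equal. apply csum_ext. intros k _. f_equal.
  rewrite plus_INR, RtoC_plus. ring.
Qed.

Lemma Cinv_opp (y : C) : / (- y) = - / y.
Proof.
  destruct (Ceq_dec y 0) as [->|H]; [|field; auto].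
  replace (- (0)) with (RtoC 0) by ring. rewrite Cinv_0. ring.
Qed.

(** The additive counterpart of [poch_minus]. Summands with a zero denominator match too, since
    [Cinv_opp] holds at 0. *)
Lemma hsum_minus (y : C) (k M : nat) : (k <= M)%nat ->
  hsum (y - natC k) M = - hsum (1 - y) k + hsum y (M - k).
Proof.
  intros H. replace M with (k + (M - k))%nat at 1 by lia. rewrite hsum_add.
  replace (y - natC k + natC k) with y by ring. f_equal.
  unfold hsum. rewrite <- (csum_rev k (fun j => / (1 - y + natC j))).
  replace (- csum k (fun j => / (1 - y + natC (k - 1 - j))))
    with (-1 * csum k (fun j => / (1 - y + natC (k - 1 - j)))) by ring.
  rewrite <- csum_scal. apply csum_ext. intros j Hj.
  rewrite !minus_INR, !RtoC_minus by lia. simpl (INR 1).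
  replace (1 - y + (natC k - 1 - natC j)) with (- (y - natC k + natC j)) by ring.
  rewrite Cinv_opp. ring.
Qed.

Lemma hsum_plus_upper (y : C) : exists B, (0 < B)%R /\ forall M k, (k < M)%nat ->
  (Cmod (hsum (y + natC k) M - RtoC (lnS M)) <= B + lnS k)%R.
Proof.
  destruct (hsum_log y) as [B [HB K]]. exists (2 * B + 1)%R. split; [lra|]. intros M k Hk.
  assert (E : hsum (y + natC k) M - RtoC (lnS M)
     = (hsum y (M + k) - RtoC (lnS (M + k))) + ((- (hsum y k - RtoC (lnS k)))
        + (RtoC (lnS (M + k) - lnS M) + - RtoC (lnS k)))).
  { rewrite RtoC_minus, Nat.add_comm, hsum_add. ring. }
  rewrite E. eapply Rle_trans; [apply Cmod_triangle|].
  pose proof (Cmod_triangle (- (hsum y k - RtoC (lnS k))) (RtoC (lnS (M + k) - lnS M) + - RtoC (lnS k))).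
  pose proof (Cmod_triangle (RtoC (lnS (M + k) - lnS M)) (- RtoC (lnS k))) as T.
  rewrite !Cmod_opp, !Cmod_R in *. pose proof (lnS_double M k ltac:(lia)). pose proof (lnS_ge0 k).
  rewrite !Rabs_pos_eq in T by lra. pose proof (K (M + k)%nat). pose proof (K k). lra.
Qed.

Lemma hsum_minus_upper (y : C) : exists B, (0 < B)%R /\ forall M k, (k < M)%nat ->
  (Cmod (hsum (y - natC k) M - RtoC (lnS M)) <= B + lnS k + (lnS M - lnS (M - k)))%R.
Proof.
  destruct (hsum_log y) as [B1 [HB1 K1]]. destruct (hsum_log (1 - y)) as [B2 [HB2 K2]].
  exists (B1 + B2)%R. split; [lra|]. intros M k Hk. rewrite hsum_minus by lia.
  assert (E : - hsum (1 - y) k + hsum y (M - k) - RtoC (lnS M)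
     = (hsum y (M - k) - RtoC (lnS (M - k))) + ((- (hsum (1 - y) k - RtoC (lnS k)))
        + (- RtoC (lnS M - lnS (M - k)) + - RtoC (lnS k)))).
  { rewrite RtoC_minus. ring. }
  rewrite E. eapply Rle_trans; [apply Cmod_triangle|].
  pose proof (Cmod_triangle (- (hsum (1 - y) k - RtoC (lnS k))) (- RtoC (lnS M - lnS (M - k)) + - RtoC (lnS k))).
  pose proof (Cmod_triangle (- RtoC (lnS M - lnS (M - k))) (- RtoC (lnS k))) as T.
  rewrite !Cmod_opp, !Cmod_R in *. pose proof (lnS_le (M - k) M ltac:(lia)). pose proof (lnS_ge0 k).
  rewrite !Rabs_pos_eq in T by lra. pose proof (K1 (M - k)%nat). pose proof (K2 k). lra.
Qed.

Lemma vsum_hsum_upper (f : C -> nat -> nat -> C) (l : list C) :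
  (forall x, In x l -> exists B, (0 < B)%R /\ forall M k, (k < M)%nat ->
     (Cmod (f x M k - RtoC (lnS M)) <= B + lnS k + (lnS M - lnS (M - k)))%R) ->
  exists B, (0 < B)%R /\ forall M k, (k < M)%nat ->
     (Cmod (vsum (map (fun x => f x M k) l) - RtoC (INR (length l) * lnS M))
       <= B * (1 + lnS k + (lnS M - lnS (M - k))))%R.
Proof.
  induction l as [|x l IH]; intros H.
  - exists 1%R. split; [lra|]. intros M k Hk. simpl. rewrite Rmult_0_l.
    replace (0 - 0) with (RtoC 0) by ring. rewrite Cmod_0.
    pose proof (lnS_le (M - k) M ltac:(lia)). pose proof (lnS_ge0 k). lra.
  - destruct (H x (or_introl eq_refl)) as [B1 [P1 K1]].
    destruct IH as [B2 [P2 K2]]; [intros; apply H; now right|].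
    exists (B1 + 1 + B2)%R. split; [lra|]. intros M k Hk.
    rewrite map_cons, vsum_cons. simpl length. rewrite S_INR.
    replace (f x M k + vsum (map (fun x => f x M k) l) - RtoC ((INR (length l) + 1) * lnS M))
      with ((f x M k - RtoC (lnS M)) + (vsum (map (fun x => f x M k) l) - RtoC (INR (length l) * lnS M)))
      by (rewrite Rmult_plus_distr_r, RtoC_plus, Rmult_1_l; ring).
    eapply Rle_trans; [apply Cmod_triangle|].
    specialize (K1 M k Hk). specialize (K2 M k Hk).
    pose proof (lnS_le (M - k) M ltac:(lia)). pose proof (lnS_ge0 k). nra.
Qed.

(** * The truncated residue identity *)

Definition grid (g : C -> nat -> C) (M : nat) (l : list C) : list C :=
  flat_map (fun y => map (g y) (seq 0 M)) l.

Lemma vprod_cons (x : C) (l : list C) : vprod (x :: l) = x * vprod l.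
Proof. reflexivity. Qed.
Lemma vprod_app (l m : list C) : vprod (l ++ m) = vprod l * vprod m.
Proof. induction l as [|x l IH]; simpl; [ring|]. rewrite IH. ring. Qed.

Lemma vprod_seq (f : nat -> C) (M : nat) : vprod (map f (seq 0 M)) = cprod M f.
Proof.
  induction M as [|M IH]; [reflexivity|].
  rewrite seq_S, map_app, vprod_app, IH. simpl. ring.
Qed.

Lemma vsum_seq (f : nat -> C) (M : nat) : vsum (map f (seq 0 M)) = csum M f.
Proof.
  induction M as [|M IH]; [reflexivity|].
  rewrite seq_S, map_app, vsum_app, IH. simpl. ring.
Qed.

Lemma vprod_grid (f : C -> C) (g : C -> nat -> C) (M : nat) (l : list C) :
  vprod (map f (grid g M l)) = vprod (map (fun y => cprod M (fun j => f (g y j))) l).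
Proof.
  induction l as [|y l IH]; [reflexivity|]. unfold grid in *. simpl flat_map.
  rewrite map_app, vprod_app, IH, map_map, vprod_seq. reflexivity.
Qed.

Lemma vsum_grid (f : C -> C) (g : C -> nat -> C) (M : nat) (l : list C) :
  vsum (map f (grid g M l)) = vsum (map (fun y => csum M (fun j => f (g y j))) l).
Proof.
  induction l as [|y l IH]; [reflexivity|]. unfold grid in *. simpl flat_map.
  rewrite map_app, vsum_app, IH, map_map, vsum_seq. reflexivity.
Qed.

Lemma length_grid (g : C -> nat -> C) (M : nat) (l : list C) :
  length (grid g M l) = (length l * M)%nat.
Proof.
  induction l as [|y l IH]; [reflexivity|]. unfold grid in *. simpl.
  rewrite length_app, length_map, length_seq, IH. reflexivity.
Qed.

Lemma in_grid (g : C -> nat -> C) (M : nat) (l : list C) (r : C) :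
  In r (grid g M l) <-> exists y j, In y l /\ (j < M)%nat /\ r = g y j.
Proof.
  unfold grid. rewrite in_flat_map. split.
  - intros [y [Hy H]]. apply in_map_iff in H. destruct H as [j [E Hj]]. apply in_seq in Hj.
    exists y, j. repeat split; auto. lia.
  - intros [y [j [Hy [Hj E]]]]. exists y. split; [exact Hy|]. apply in_map_iff. exists j.
    split; [auto|]. apply in_seq. lia.
Qed.

Lemma vprod_mult {A : Type} (f g : A -> C) (l : list A) :
  vprod (map (fun x => f x * g x) l) = vprod (map f l) * vprod (map g l).
Proof. induction l as [|x l IH]; [simpl; ring|]. simpl map. rewrite !vprod_cons, IH. ring. Qed.

Lemma vprod_const {A : Type} (c : C) (l : list A) : vprod (map (fun _ => c) l) = c ^ (length l).
Proof. induction l as [|x l IH]; [reflexivity|]. simpl map. rewrite vprod_cons, IH. simpl length. now rewrite Cpow_S. Qed.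

Lemma vprod_ext {A : Type} (f g : A -> C) (l : list A) :
  (forall x, In x l -> f x = g x) -> vprod (map f l) = vprod (map g l).
Proof. intros H. f_equal. now apply map_ext_in. Qed.

Lemma vsum_ext {A : Type} (f g : A -> C) (l : list A) :
  (forall x, In x l -> f x = g x) -> vsum (map f l) = vsum (map g l).
Proof. intros H. f_equal. now apply map_ext_in. Qed.

Lemma vprod_indicator (c : C) (y : C) (l : list C) :
  NoDup l -> In y l -> vprod (map (fun x => if Ceq_dec x y then c else 1) l) = c.
Proof.
  intros Hnd. induction Hnd as [|x l Hx Hnd IH]; intros Hin; [destruct Hin|].
  simpl map. rewrite vprod_cons. destruct (Ceq_dec x y) as [->|Hne].
  - rewrite (vprod_ext _ (fun _ => RtoC 1)).
    + rewrite vprod_const, Cpow_1_l. ring.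
    + intros z Hz. destruct (Ceq_dec z y) as [->|]; [contradiction|reflexivity].
  - destruct Hin as [E|Hin]; [contradiction|]. rewrite IH by exact Hin. ring.
Qed.

Lemma cprod_opp (M : nat) (f : nat -> C) : cprod M (fun j => - f j) = (-1) ^ M * cprod M f.
Proof. induction M as [|M IH]; simpl; [ring|]. rewrite IH. ring. Qed.

(* Zeros and poles of the regulator, in the scale t / (M + 1). *)
Definition nhat (A : nat) : list C := repeat (RtoC 1) A ++ repeat (RtoC (-1)) A.
Definition xhat (A : nat) : list C := map (fun l => Ci * natC (S l)) (seq 0 (2 * A + 2)).
Definition regulator (A : nat) (t : C) : C :=
  vprod (map (fun n => t - n) (nhat A)) / vprod (map (fun x => t - x) (xhat A)).

Lemma vprod_scale (t c : C) (l : list C) : c <> 0 ->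
  vprod (map (fun n => t - n) (map (fun n => n * c) l)) = c ^ (length l) * vprod (map (fun n => t / c - n) l).
Proof.
  intros Hc. rewrite map_map, <- vprod_const, <- vprod_mult. apply vprod_ext.
  intros x _. field. exact Hc.
Qed.

Lemma length_nhat A : length (nhat A) = (2 * A)%nat.
Proof. unfold nhat. rewrite length_app, !repeat_length. lia. Qed.
Lemma length_xhat A : length (xhat A) = (2 * A + 2)%nat.
Proof. unfold xhat. now rewrite length_map, length_seq. Qed.

Definition Traw (M : nat) (U V W X : list C) (v0 : C) (k : nat) : C :=
  vprod (map (fun w => poch (w + v0 + natC k) M) W)
  * vprod (map (fun x => poch (x - v0 - natC k) M) X)
  / (vprod (map (fun u => poch (u + v0 + natC k) M) U)
     * vprod (map (fun v => ppoch (v - v0) k M) V)).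

(** The ratio between [term] and [Traw]. It depends neither on the pole nor on the family, so a
    single relation between residues can be rescaled as a whole. *)
Definition scaling (M m : nat) (U V W X : list C) : C :=
  natC (fact M) ^ m * natC (fact M) ^ m
  * Cnatpow (S M) (vsum U + vsum V - vsum W - vsum X - 2 * natC m).

Lemma vprod_normalise (f : C -> C) (M : nat) (c : C) (l : list C) :
  vprod (map (fun y => f y / (natC (fact M) * Cnatpow (S M) (y + c))) l)
  = vprod (map f l) / (natC (fact M) ^ length l * Cnatpow (S M) (vsum l + natC (length l) * c)).
Proof.
  induction l as [|y l IH].
  - simpl. replace (0 + 0 * c) with (RtoC 0) by ring. rewrite Cnatpow_0_r. field.
  - simpl map. rewrite !vprod_cons, IH, vsum_cons. simpl length. rewrite Cpow_S, S_INR, RtoC_plus.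
    replace (y + vsum l + (natC (length l) + 1) * c) with
      ((y + c) + (vsum l + natC (length l) * c)) by ring.
    rewrite (Cnatpow_plus _ (y + c)).
    field. repeat split; try apply Cnatpow_neq_0; try apply fact_neq_0_C; apply Cpow_nz, fact_neq_0_C.
Qed.

(** In the exponent of M + 1 the pole enters through m c + m d, where c + d = -2; the equal excesses
    of the two length conditions thus make v0 + k disappear. *)
Lemma term_Traw (M m : nat) (U V W X : list C) (v0 : C) (k : nat) :
  length U = (length W + m)%nat -> length V = (length X + m)%nat ->
  (forall u, In u U -> notpole (u + v0)) ->
  term M U V W X v0 k = scaling M m U V W X * Traw M U V W X v0 k.
Proof.
  intros HU HV HUp. unfold term, Traw, rgn, prgn.
  set (c := v0 + natC k - 1). set (d := - v0 - natC k - 1).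
  rewrite (vprod_ext (fun w => poch (w + v0 + natC k) M / _)
     (fun w => poch (w + v0 + natC k) M / (natC (fact M) * Cnatpow (S M) (w + c))) W)
    by (intros; do 3 f_equal; unfold c; ring).
  rewrite (vprod_ext (fun x => poch (x - v0 - natC k) M / _)
     (fun x => poch (x - v0 - natC k) M / (natC (fact M) * Cnatpow (S M) (x + d))) X)
    by (intros; do 3 f_equal; unfold d; ring).
  rewrite (vprod_ext (fun u => poch (u + v0 + natC k) M / _)
     (fun w => poch (w + v0 + natC k) M / (natC (fact M) * Cnatpow (S M) (w + c))) U)
    by (intros; do 3 f_equal; unfold c; ring).
  rewrite (vprod_ext (fun v => ppoch (v - v0) k M / _)
     (fun v => ppoch (v - v0) k M / (natC (fact M) * Cnatpow (S M) (v + d))) V)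
    by (intros; do 3 f_equal; unfold d; ring).
  rewrite !vprod_normalise, HU, HV, !plus_INR, !RtoC_plus, !Cpow_add_r.
  unfold scaling.
  assert (E : Cnatpow (S M) (vsum U + vsum V - vsum W - vsum X - 2 * natC m)
    = Cnatpow (S M) (vsum U + (natC (length W) + natC m) * c)
      * Cnatpow (S M) (vsum V + (natC (length X) + natC m) * d)
      / (Cnatpow (S M) (vsum W + natC (length W) * c) * Cnatpow (S M) (vsum X + natC (length X) * d))).
  { unfold Cdiv. rewrite <- !Cnatpow_plus, <- Cnatpow_opp, <- Cnatpow_plus. f_equal. unfold c, d. ring. }
  rewrite E.
  assert (N1 : vprod (map (fun u => poch (u + v0 + natC k) M) U) <> 0).
  { apply vprod_neq_0. intros u Hu. apply poch_neq_0, notpole_plus. auto. }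
  assert (N2 : vprod (map (fun v => ppoch (v - v0) k M) V) <> 0).
  { apply vprod_neq_0. intros v _. apply cprod_neq_0. intros; apply pun_neq_0. }
  field. repeat split; try apply Cnatpow_neq_0; try (apply Cpow_nz, fact_neq_0_C); auto.
Qed.

(* Logarithmic derivative of the truncated Phi at the double pole k, without the polar part. *)
Definition Lam (M : nat) (U V W X : list C) (k : nat) : C :=
  vsum (map (fun w => hsum (w + natC k) M) W)
  - vsum (map (fun x => hsum (x - natC k) M) X)
  - vsum (map (fun u => hsum (u + natC k) M) U)
  + vsum (map (fun v => hsum (v - natC k) M) V).

Definition reg_log (A M : nat) (t : C) : C :=
  vsum (map (fun n => / (t - n * natC (S M))) (nhat A))
  - vsum (map (fun x => / (t - x * natC (S M))) (xhat A)).

Definition zeros (M A : nat) (W X : list C) : list C :=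
  grid (fun w j => - w - natC j) M W ++ grid (fun x j => x + natC j) M X
  ++ map (fun n => n * natC (S M)) (nhat A).
(** V' stands for V without its two zeros, which account for the double roots 0, ..., M-1 in
    [poles]. *)
Definition simple_poles (M A : nat) (U V' : list C) : list C :=
  grid (fun u j => - u - natC j) M U ++ grid (fun v j => v + natC j) M V'
  ++ map (fun x => x * natC (S M)) (xhat A).
Definition poles (M A : nat) (U V' : list C) : list (C * bool) :=
  map (fun r => (r, false)) (simple_poles M A U V')
  ++ map (fun j => (natC j, true)) (seq 0 M).

Definition den_at (M A : nat) (U V' : list C) (r : C) : C :=
  vprod (map (fun u => cprod M (fun j => pun (r - (- u - natC j)))) U)
  * vprod (map (fun v => cprod M (fun j => pun (r - (v + natC j)))) V')
  * vprod (map (fun x => pun (r - x * natC (S M))) (xhat A))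
  * (cprod M (fun j => pun (r - natC j)) * cprod M (fun j => pun (r - natC j))).
Definition num_at (M A : nat) (W X : list C) (r : C) : C :=
  vprod (map (fun w => cprod M (fun j => r - (- w - natC j))) W)
  * vprod (map (fun x => cprod M (fun j => r - (x + natC j))) X)
  * vprod (map (fun n => r - n * natC (S M)) (nhat A)).

Lemma punctured_value_at M A U V' W X r :
  punctured_value (zeros M A W X) (poles M A U V') r = num_at M A W X r / den_at M A U V' r.
Proof.
  unfold punctured_value. f_equal.
  - unfold zeros. rewrite !map_app, !vprod_app, !vprod_grid, map_map. unfold num_at. ring.
  - f_equal. unfold poles, simple_poles. rewrite map_app, vprod_app, !map_map.
    unfold den_factor; cbn [fst snd].
    rewrite (vprod_ext (fun x => pun (r - x) * 1) (fun x => pun (r - x))) by (intros; ring).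
    rewrite !map_app, !vprod_app, !vprod_grid, map_map, vprod_seq, cprod_mult.
    unfold den_at. ring.
Qed.

Lemma residues_split M A U V' W X :
  residues (zeros M A W X) (poles M A U V') =
  vsum (map (fun u => csum M (fun k => punctured_value (zeros M A W X) (poles M A U V') (- u - natC k))) U)
  + vsum (map (fun v => csum M (fun k => punctured_value (zeros M A W X) (poles M A U V') (v + natC k))) V')
  + vsum (map (fun x => punctured_value (zeros M A W X) (poles M A U V') (x * natC (S M))) (xhat A))
  + csum M (fun k => punctured_value (zeros M A W X) (poles M A U V') (natC k)
              * log_deriv (zeros M A W X) (poles M A U V') (natC k)).
Proof.
  unfold residues. unfold poles at 2. unfold simple_poles.
  set (ns := zeros M A W X). set (ps := poles M A U V').
  rewrite map_app, vsum_app, !map_map. unfold residue. cbn [fst snd].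
  rewrite (vsum_ext (fun x => punctured_value ns ps x * 1) (punctured_value ns ps)) by (intros; ring).
  rewrite !map_app, !vsum_app, !vsum_grid, map_map, vsum_seq. ring.
Qed.

(** The truncated Gamma(x-t) and Gamma(v-t) contain factors x - t + j, the rational function has t -
    r: this is the total sign change. The two zeros of V contribute a square. *)
Definition sgn (M : nat) (X V' : list C) : C := ((-1) ^ M) ^ length X * ((-1) ^ M) ^ length V'.

Lemma m1_pow_sq (n : nat) : (-1) ^ n * (-1) ^ n = 1.
Proof. rewrite <- Cpow_mult_l. replace (-1 * -1) with (RtoC 1) by ring. apply Cpow_1_l. Qed.

Lemma m1_pow_neq_0 (n : nat) : (-1) ^ n <> 0.
Proof. apply Cpow_nz. intros E. apply RtoC_inj in E. lra. Qed.

Lemma sgn_sq M X V' : sgn M X V' * sgn M X V' = 1.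
Proof.
  unfold sgn. rewrite <- !Cpow_mult_r, <- Cpow_add_r. apply m1_pow_sq.
Qed.

Lemma cprod_indicator (c : C) (k M : nat) :
  cprod M (fun j => if Nat.eqb j k then c else 1) = if Nat.ltb k M then c else 1.
Proof.
  induction M as [|M IH]; [reflexivity|]. simpl cprod. rewrite IH.
  destruct (Nat.eqb_spec M k), (Nat.ltb_spec k M), (Nat.ltb_spec k (S M)); try lia; ring.
Qed.

(** For y = 0 the factor j = k is 1 on both sides and does not change sign, whence the additional
    -1. It reappears as the minus sign of the V' family in [finite_identity]. *)
Lemma cprod_pun_flip (y : C) (k M : nat) : (k < M)%nat -> y = 0 \/ nonint y ->
  cprod M (fun j => pun (natC k - y - natC j))
  = (if Ceq_dec y 0 then RtoC (-1) else RtoC 1) * ((-1) ^ M * ppoch y k M).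
Proof.
  intros Hk Hy. unfold ppoch. rewrite <- cprod_opp.
  destruct (Ceq_dec y 0) as [->|Hne].
  - replace (RtoC (-1)) with (if Nat.ltb k M then RtoC (-1) else RtoC 1)
      by (apply Nat.ltb_lt in Hk; now rewrite Hk).
    rewrite <- cprod_indicator, <- cprod_mult. apply cprod_ext. intros j _.
    destruct (Nat.eqb_spec j k) as [->|Hjk].
    + replace (natC k - 0 - natC k) with (RtoC 0) by ring.
      replace (0 - natC k + natC k) with (RtoC 0) by ring. rewrite pun_0. ring.
    + assert (Hn : natC k - natC j <> 0).
      { intros E. apply (proj2 (Ceq_minus _ _)) in E. apply RtoC_inj, INR_eq in E. congruence. }
      rewrite !pun_id.
      * ring.
      * intros E. apply Hn. transitivity (- (0 - natC k + natC j)); [ring|]. rewrite E. ring.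
      * intros E. apply Hn. rewrite <- E. ring.
  - destruct Hy as [Hy|Hy]; [contradiction|]. rewrite Cmult_1_l. apply cprod_ext. intros j _.
    assert (Hn : y - natC k + natC j <> 0).
    { apply nonint_neq_0, nonint_plus_nat, nonint_minus_nat, Hy. }
    rewrite !pun_id; [ring|exact Hn|].
    intros E. apply Hn. transitivity (- (natC k - y - natC j)); [ring|]. rewrite E. ring.
Qed.

(** The regulator has two more poles than zeros, so passing to the scale t / (M+1) leaves the factor
    (M+1)^(-2). *)
Lemma regulator_scaled (M A : nat) (r : C) :
  (forall x, In x (xhat A) -> r - x * natC (S M) <> 0) ->
  vprod (map (fun n => r - n * natC (S M)) (nhat A))
  / vprod (map (fun x => pun (r - x * natC (S M))) (xhat A))
  = regulator A (r / natC (S M)) / natC (S M) ^ 2.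
Proof.
  intros H. set (c := natC (S M)) in *. assert (Hc : c <> 0) by (apply INR_neq_0; lia).
  rewrite (vprod_ext (fun x => pun (r - x * c)) (fun x => r - x * c)) by (intros; apply pun_id; auto).
  rewrite <- (map_map (fun n => n * c) (fun n => r - n)), <- (map_map (fun n => n * c) (fun n => r - n)).
  rewrite !vprod_scale, length_nhat, length_xhat, Cpow_add_r by exact Hc.
  unfold regulator. field. repeat split; try (apply Cpow_nz; exact Hc); [|exact Hc].
  apply vprod_neq_0. intros x Hx E. apply (H x Hx).
  transitivity (c * (r / c - x)); [field; exact Hc|]. rewrite E. ring.
Qed.

Lemma num_at_V (M A : nat) (W X : list C) (v0 : C) (k : nat) :
  num_at M A W X (v0 + natC k) =
  vprod (map (fun w => poch (w + v0 + natC k) M) W)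
  * (((-1) ^ M) ^ length X * vprod (map (fun x => poch (x - v0 - natC k) M) X))
  * vprod (map (fun n => v0 + natC k - n * natC (S M)) (nhat A)).
Proof.
  unfold num_at. f_equal. f_equal.
  - apply vprod_ext. intros w _. apply cprod_ext. intros j _. ring.
  - rewrite <- vprod_const, <- vprod_mult. apply vprod_ext. intros x _.
    unfold poch. rewrite <- cprod_opp. apply cprod_ext. intros j _. ring.
Qed.

Lemma den_at_V (M A : nat) (U V' : list C) (v0 : C) (k : nat) : (k < M)%nat ->
  (forall u, In u U -> notpole (u + v0)) ->
  (forall v, In v (RtoC 0 :: V') -> v - v0 = 0 \/ nonint (v - v0)) ->
  den_at M A U V' (v0 + natC k) =
  vprod (map (fun u => poch (u + v0 + natC k) M) U)
  * (vprod (map (fun v => if Ceq_dec v v0 then RtoC (-1) else RtoC 1) V')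
     * ((-1) ^ M) ^ length V' * vprod (map (fun v => ppoch (v - v0) k M) V'))
  * vprod (map (fun x => pun (v0 + natC k - x * natC (S M))) (xhat A))
  * (ppoch (0 - v0) k M * ppoch (0 - v0) k M).
Proof.
  intros Hk HU HV. unfold den_at. f_equal; [f_equal; f_equal|].
  - apply vprod_ext. intros u Hu. apply cprod_ext. intros j _.
    replace (v0 + natC k - (- u - natC j)) with (u + v0 + natC k + natC j) by ring.
    apply pun_id, notpole_neq_0, notpole_plus. auto.
  - rewrite <- vprod_const, <- !vprod_mult. apply vprod_ext. intros v Hv.
    rewrite (cprod_ext M _ (fun j => pun (natC k - (v - v0) - natC j))) by (intros; f_equal; ring).
    rewrite cprod_pun_flip by (auto; apply HV; now right).
    destruct (Ceq_dec v v0) as [E|E], (Ceq_dec (v - v0) 0) as [E'|E']; try ring.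
    + exfalso. apply E'. subst. ring.
    + exfalso. apply E. now apply Ceq_minus.
  - rewrite (cprod_ext M _ (fun j => pun (natC k - (0 - v0) - natC j))) by (intros; f_equal; ring).
    rewrite cprod_pun_flip by (auto; apply HV; now left).
    pose proof (m1_pow_sq M) as HS. set (e := (-1) ^ M) in *.
    transitivity ((e * e) * (ppoch (0 - v0) k M * ppoch (0 - v0) k M)).
    + destruct (Ceq_dec (0 - v0) 0); ring.
    + rewrite HS. ring.
Qed.

(** The sign of [cprod_pun_flip] occurs once for v0 in V' and twice, hence not at all, at the double
    poles v0 = 0. *)
Lemma punctured_value_V (M A : nat) (U V' W X : list C) (v0 : C) (k : nat) : (k < M)%nat ->
  (forall u, In u U -> notpole (u + v0)) ->
  (forall v, In v (RtoC 0 :: V') -> v - v0 = 0 \/ nonint (v - v0)) ->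
  (forall x, In x (xhat A) -> v0 + natC k - x * natC (S M) <> 0) ->
  punctured_value (zeros M A W X) (poles M A U V') (v0 + natC k) =
  / vprod (map (fun v => if Ceq_dec v v0 then RtoC (-1) else RtoC 1) V') * sgn M X V'
  * Traw M U (RtoC 0 :: RtoC 0 :: V') W X v0 k
  * (regulator A ((v0 + natC k) / natC (S M)) / natC (S M) ^ 2).
Proof.
  intros Hk HU HV Hx. rewrite punctured_value_at, num_at_V, den_at_V by auto.
  rewrite <- regulator_scaled by exact Hx. unfold Traw, sgn.
  rewrite !map_cons, !vprod_cons.
  assert (N1 : vprod (map (fun v => if Ceq_dec v v0 then RtoC (-1) else RtoC 1) V') <> 0).
  { apply vprod_neq_0. intros v _. destruct (Ceq_dec v v0); intros E; apply RtoC_inj in E; lra. }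
  assert (N2 : vprod (map (fun v => ppoch (v - v0) k M) V') <> 0).
  { apply vprod_neq_0. intros v _. apply cprod_neq_0. intros; apply pun_neq_0. }
  assert (N3 : vprod (map (fun x => pun (v0 + natC k - x * natC (S M))) (xhat A)) <> 0).
  { apply vprod_neq_0. intros; apply pun_neq_0. }
  assert (N4 : ppoch (0 - v0) k M <> 0) by (apply cprod_neq_0; intros; apply pun_neq_0).
  assert (N5 : vprod (map (fun u => poch (u + v0 + natC k) M) U) <> 0).
  { apply vprod_neq_0. intros u Hu. apply poch_neq_0, notpole_plus. auto. }
  assert (N6 : ((-1) ^ M) ^ length V' <> 0) by (apply Cpow_nz, m1_pow_neq_0).
  assert (S2 : ((-1) ^ M) ^ length V' = / ((-1) ^ M) ^ length V').
  { assert (H : ((-1) ^ M) ^ length V' * ((-1) ^ M) ^ length V' = 1)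
      by (rewrite <- !Cpow_mult_r; apply m1_pow_sq).
    rewrite <- (Cmult_1_r (((-1) ^ M) ^ length V')) at 1. rewrite <- (Cinv_r _ N6), Cmult_assoc, H. ring. }
  rewrite S2 at 2. field. repeat split; auto.
Qed.

Lemma punctured_value_U (M A : nat) (U V' W X : list C) (u0 : C) (k : nat) :
  (forall v, In v (RtoC 0 :: V') -> notpole (v + u0)) ->
  (forall x, In x (xhat A) -> - u0 - natC k - x * natC (S M) <> 0) ->
  punctured_value (zeros M A W X) (poles M A U V') (- u0 - natC k) =
  sgn M X V' * Traw M (RtoC 0 :: RtoC 0 :: V') U X W u0 k
  * (regulator A ((- u0 - natC k) / natC (S M)) / natC (S M) ^ 2).
Proof.
  intros HV Hx. rewrite punctured_value_at.
  assert (EN : num_at M A W X (- u0 - natC k) =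
    vprod (map (fun w => poch (w - u0 - natC k) M) W)
    * (((-1) ^ M) ^ length X * vprod (map (fun x => poch (x + u0 + natC k) M) X))
    * vprod (map (fun n => - u0 - natC k - n * natC (S M)) (nhat A))).
  { unfold num_at. f_equal. f_equal.
    - apply vprod_ext. intros w _. apply cprod_ext. intros j _. ring.
    - rewrite <- vprod_const, <- vprod_mult. apply vprod_ext. intros x _.
      unfold poch. rewrite <- cprod_opp. apply cprod_ext. intros j _. ring. }
  assert (ED : den_at M A U V' (- u0 - natC k) =
    vprod (map (fun u => ppoch (u - u0) k M) U)
    * (((-1) ^ M) ^ length V' * vprod (map (fun v => poch (v + u0 + natC k) M) V'))
    * vprod (map (fun x => pun (- u0 - natC k - x * natC (S M))) (xhat A))
    * (poch (0 + u0 + natC k) M * poch (0 + u0 + natC k) M)).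
  { assert (HC : forall v, In v (RtoC 0 :: V') ->
      cprod M (fun j => pun (- u0 - natC k - (v + natC j))) = (-1) ^ M * poch (v + u0 + natC k) M).
    { intros v Hv. unfold poch. rewrite <- cprod_opp. apply cprod_ext. intros j _.
      pose proof (notpole_neq_0 _ j (notpole_plus _ k (HV v Hv))) as Hn.
      rewrite pun_id; [ring|]. intros E. apply Hn.
      transitivity (- (- u0 - natC k - (v + natC j))); [ring|]. rewrite E. ring. }
    unfold den_at. f_equal; [f_equal; f_equal|].
    - apply vprod_ext. intros u _. apply cprod_ext. intros j _. f_equal. ring.
    - rewrite <- vprod_const, <- vprod_mult. apply vprod_ext. intros v Hv. apply HC. now right.
    - rewrite (cprod_ext M _ (fun j => pun (- u0 - natC k - (0 + natC j)))) by (intros; f_equal; ring).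
      rewrite (HC 0) by now left. pose proof (m1_pow_sq M) as HS. set (e := (-1) ^ M) in *.
      transitivity ((e * e) * (poch (0 + u0 + natC k) M * poch (0 + u0 + natC k) M)); [ring|].
      rewrite HS. ring. }
  rewrite EN, ED, <- regulator_scaled by exact Hx. unfold Traw, sgn.
  rewrite !map_cons, !vprod_cons.
  assert (N2 : vprod (map (fun v => ppoch (v - u0) k M) U) <> 0).
  { apply vprod_neq_0. intros v _. apply cprod_neq_0. intros; apply pun_neq_0. }
  assert (N3 : vprod (map (fun x => pun (- u0 - natC k - x * natC (S M))) (xhat A)) <> 0).
  { apply vprod_neq_0. intros; apply pun_neq_0. }
  assert (N5 : vprod (map (fun u => poch (u + u0 + natC k) M) V') <> 0).
  { apply vprod_neq_0. intros u Hu. apply poch_neq_0, notpole_plus, HV. now right. }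
  assert (N4 : poch (0 + u0 + natC k) M <> 0) by (apply poch_neq_0, notpole_plus, HV; now left).
  assert (N6 : ((-1) ^ M) ^ length V' <> 0) by (apply Cpow_nz, m1_pow_neq_0).
  assert (S2 : ((-1) ^ M) ^ length V' = / ((-1) ^ M) ^ length V').
  { assert (H : ((-1) ^ M) ^ length V' * ((-1) ^ M) ^ length V' = 1)
      by (rewrite <- !Cpow_mult_r; apply m1_pow_sq).
    rewrite <- (Cmult_1_r (((-1) ^ M) ^ length V')) at 1. rewrite <- (Cinv_r _ N6), Cmult_assoc, H. ring. }
  rewrite S2 at 2. field. repeat split; auto.
Qed.

Lemma vsum_scal {A : Type} (c : C) (f : A -> C) (l : list A) :
  vsum (map (fun x => c * f x) l) = c * vsum (map f l).
Proof. induction l as [|x l IH]; [simpl; ring|]. simpl map. rewrite !vsum_cons, IH. ring. Qed.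

Lemma csum_opp (n : nat) (f : nat -> C) : csum n (fun k => - f k) = - csum n f.
Proof. induction n as [|n IH]; simpl; [ring|rewrite IH; ring]. Qed.

(** The polar part of the double root itself is the summand 2 / (k - k), which counts as 0; the
    other double roots give the two terms of [Lam] for the zeros of V. *)
Lemma log_deriv_at (M A : nat) (U V' W X : list C) (k : nat) : (k <= M)%nat ->
  log_deriv (zeros M A W X) (poles M A U V') (natC k)
  = Lam M U (RtoC 0 :: RtoC 0 :: V') W X k + reg_log A M (natC k).
Proof.
  intros Hk. unfold log_deriv, zeros, poles, simple_poles.
  rewrite !map_app, !vsum_app, !map_map. cbn [fst snd].
  rewrite !vsum_grid, vsum_seq.
  unfold Lam, reg_log. rewrite !map_cons, !vsum_cons.
  assert (neg : forall y, csum M (fun j => / (natC k - (y + natC j))) = - hsum (y - natC k) M).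
  { intros y. unfold hsum. rewrite <- csum_opp. apply csum_ext. intros j _. rewrite <- Cinv_opp. f_equal. ring. }
  assert (EW : vsum (map (fun y => csum M (fun j => / (natC k - (- y - natC j)))) W)
     = vsum (map (fun w => hsum (w + natC k) M) W)).
  { apply vsum_ext. intros w _. apply csum_ext. intros j _. f_equal. ring. }
  assert (EX : vsum (map (fun y => csum M (fun j => / (natC k - (y + natC j)))) X)
     = - vsum (map (fun x => hsum (x - natC k) M) X)).
  { replace (- vsum (map (fun x => hsum (x - natC k) M) X))
      with (-1 * vsum (map (fun x => hsum (x - natC k) M) X)) by ring.
    rewrite <- vsum_scal. apply vsum_ext. intros x _. rewrite neg. ring. }
  assert (EU : vsum (map (fun y => csum M (fun j => 1 / (natC k - (- y - natC j)))) U)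
     = vsum (map (fun w => hsum (w + natC k) M) U)).
  { apply vsum_ext. intros w _. apply csum_ext. intros j _. unfold Cdiv. rewrite Cmult_1_l. f_equal. ring. }
  assert (EV : vsum (map (fun y => csum M (fun j => 1 / (natC k - (y + natC j)))) V')
     = - vsum (map (fun x => hsum (x - natC k) M) V')).
  { replace (- vsum (map (fun x => hsum (x - natC k) M) V'))
      with (-1 * vsum (map (fun x => hsum (x - natC k) M) V')) by ring.
    rewrite <- vsum_scal. apply vsum_ext. intros x _.
    transitivity (- hsum (x - natC k) M); [|ring]. rewrite <- neg.
    apply csum_ext. intros j _. unfold Cdiv. ring. }
  assert (E0 : csum M (fun j => 2 / (natC k - natC j)) = -2 * hsum (0 - natC k) M).
  { transitivity (2 * csum M (fun j => / (natC k - (0 + natC j)))); [|rewrite neg; ring].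
    rewrite <- csum_scal. apply csum_ext. intros j _. unfold Cdiv. do 2 f_equal. ring. }
  rewrite EW, EX, EU, EV, E0.
  rewrite (vsum_ext (fun x => 1 / (natC k - x * natC (S M))) (fun x => / (natC k - x * natC (S M))))
    by (intros; unfold Cdiv; ring).
  ring.
Qed.

Definition generic (l : list C) : Prop :=
  NoDup l /\ forall x y, In x l -> In y l -> x <> y -> nonint (x - y).

Lemma NoDup_grid (g : C -> nat -> C) (M : nat) (l : list C) :
  NoDup l ->
  (forall y y' j j', In y l -> In y' l -> g y j = g y' j' -> y = y' /\ j = j') ->
  NoDup (grid g M l).
Proof.
  intros Hnd. induction Hnd as [|y l Hy Hnd IH]; intros H; [constructor|].
  unfold grid in *. simpl. apply NoDup_app.
  -
    assert (Hs : NoDup (seq 0 M)) by apply seq_NoDup. revert Hs. generalize (seq 0 M).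
    intros s Hs. induction Hs as [|j s Hj Hs IHs]; simpl; constructor; auto.
    intros Hin. apply in_map_iff in Hin. destruct Hin as [j' [E Hj']].
    destruct (H y y j' j) as [_ E']; [now left|now left|exact E|]. subst. contradiction.
  - apply IH. intros y1 y2 j1 j2 H1 H2. apply H; now right.
  - intros r Hr Hr'. apply in_map_iff in Hr. destruct Hr as [j [E Hj]].
    apply in_flat_map in Hr'. destruct Hr' as [y' [Hy' Hr']]. apply in_map_iff in Hr'.
    destruct Hr' as [j' [E' Hj']].
    destruct (H y y' j j') as [E1 _]; [now left|now right|congruence|]. subst. contradiction.
Qed.

Lemma generic_inj (l : list C) (y y' : C) (j j' : nat) : generic l -> In y l -> In y' l ->
  y + natC j = y' + natC j' -> y = y' /\ j = j'.
Proof.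
  intros [_ H] Hy Hy' E. destruct (Ceq_dec y y') as [->|Hne].
  - split; [auto|]. apply INR_eq, RtoC_inj.
    transitivity (y' + natC j - y'); [ring|]. rewrite E. ring.
  - exfalso. apply (H y y' Hy Hy' Hne (Z.of_nat j' - Z.of_nat j)%Z).
    rewrite minus_IZR, RtoC_minus, <- !INR_IZR_INZ.
    transitivity (y + natC j - natC j - y'); [ring|]. rewrite E. ring.
Qed.

Lemma in_xhat (A : nat) (x : C) : In x (xhat A) -> exists l, x = Ci * natC (S l).
Proof.
  intros H. apply in_map_iff in H. destruct H as [l [E _]]. now exists l.
Qed.

(** The poles of the scaled regulator are l (M+1) i with l >= 1, above every pole of the truncated
    quotient once M is large. *)
Lemma off_imaginary (r : C) (M A : nat) (x : C) :
  (Rabs (Im r) < INR (S M))%R -> In x (xhat A) -> r - x * natC (S M) <> 0.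
Proof.
  intros Hr Hx E. apply in_xhat in Hx. destruct Hx as [l ->].
  apply (f_equal Im) in E.
  replace (Im (r - Ci * natC (S l) * natC (S M))) with (Im r - INR (S l) * INR (S M))%R in E.
  2:{ destruct r as [p q]. unfold Im, RtoC, Ci, Cminus, Cplus, Copp, Cmult. cbn [fst snd]. ring. }
  change (Im (RtoC 0)) with 0%R in E.
  pose proof (INR_S_ge1 l). pose proof (INR_S_ge1 M). pose proof (Rle_abs (Im r)). nra.
Qed.

Section Poles.
Variables (M A : nat) (U V' W X : list C).
Hypothesis (HU : generic U) (HV : generic (RtoC 0 :: V')).
Hypothesis (HUV : forall u v, In u U -> In v (RtoC 0 :: V') -> notpole (u + v)).
Hypothesis (Hbig : forall y, In y (U ++ V') -> (Cmod y < INR (S M))%R).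

Lemma Im_big (y : C) (c : R) : In y (U ++ V') -> (Rabs (Im (y + RtoC c)) < INR (S M))%R.
Proof.
  intros Hy. replace (Im (y + RtoC c)) with (Im y).
  - eapply Rle_lt_trans; [apply im_le_Cmod|auto].
  - unfold Im, RtoC, Cplus. cbn [snd]. ring.
Qed.

Lemma in_xhat_scaled (r : C) : In r (map (fun x => x * natC (S M)) (xhat A)) ->
  exists x, In x (xhat A) /\ r = x * natC (S M).
Proof. intros H. apply in_map_iff in H. destruct H as [x [E Hx]]. eauto. Qed.

Lemma NoDup_poles : NoDup (map fst (poles M A U V')).
Proof.
  unfold poles. rewrite map_app, !map_map. cbn [fst]. rewrite map_id. unfold simple_poles.
  destruct (HV) as [HVnd HVn]. inversion HVnd as [|? ? H0V HV'nd]; subst.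
  assert (HV' : generic V').
  { split; [exact HV'nd|]. intros x y Hx Hy. apply HVn; now right. }
  assert (Hu : forall u j r, In u U -> r = - u - natC j ->
    (forall v i, In v (RtoC 0 :: V') -> r <> v + natC i) /\ (Rabs (Im r) < INR (S M))%R).
  { intros u j r Hu ->. split.
    - intros v i Hv E. apply (HUV u v Hu Hv (j + i)%nat). rewrite plus_INR, RtoC_plus.
      transitivity (- natC j - (- u - natC j) + v); [ring|]. rewrite E. ring.
    - replace (- u - natC j) with (- (u + natC j)) by ring.
      change (Im (- (u + natC j))) with (- Im (u + natC j))%R. rewrite Rabs_Ropp.
      apply Im_big. apply in_or_app. now left. }
  assert (Hx : forall r, (Rabs (Im r) < INR (S M))%R -> ~ In r (map (fun x => x * natC (S M)) (xhat A))).
  { intros r Hr Hin. apply in_xhat_scaled in Hin. destruct Hin as [x [Hx ->]].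
    apply (off_imaginary _ M A x Hr Hx). ring. }
  assert (Hcx : NoDup (map (fun x => x * natC (S M)) (xhat A))).
  { unfold xhat. rewrite map_map. apply FinFun.Injective_map_NoDup; [|apply seq_NoDup].
    intros i j E. apply (f_equal Im) in E.
    replace (Im (Ci * natC (S i) * natC (S M))) with (INR (S i) * INR (S M))%R in E
      by (unfold Im, RtoC, Ci, Cmult; cbn [fst snd]; ring).
    replace (Im (Ci * natC (S j) * natC (S M))) with (INR (S j) * INR (S M))%R in E
      by (unfold Im, RtoC, Ci, Cmult; cbn [fst snd]; ring).
    pose proof (INR_S_ge1 M). apply Rmult_eq_reg_r in E; [|lra]. apply INR_eq in E. congruence. }
  assert (Hnat : NoDup (map (fun j => natC j) (seq 0 M))).
  { apply FinFun.Injective_map_NoDup; [|apply seq_NoDup]. intros i j E. now apply RtoC_inj, INR_eq in E. }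
  repeat apply NoDup_app; auto.
  - apply NoDup_grid; [apply HU|]. intros y y' j j' Hy Hy' E.
    apply (generic_inj U); auto. transitivity (- (- y - natC j)); [ring|]. rewrite E. ring.
  - apply NoDup_grid; [exact HV'nd|]. intros y y' j j' Hy Hy' E. now apply (generic_inj V').
  - intros r Hr. apply in_grid in Hr. destruct Hr as [v [j [Hv [Hj ->]]]]. apply Hx.
    apply Im_big. apply in_or_app. now right.
  - intros r Hr Hin. apply in_grid in Hr. destruct Hr as [u [j [Hu' [Hj E]]]].
    destruct (Hu u j r Hu' E) as [K1 K2]. apply in_app_or in Hin. destruct Hin as [Hin|Hin].
    + apply in_grid in Hin. destruct Hin as [v [i [Hv [_ E']]]]. apply (K1 v i); [now right|exact E'].
    + now apply Hx in Hin.
  - intros r Hr Hin. apply in_map_iff in Hin. destruct Hin as [i [E _]].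
    apply in_app_or in Hr. destruct Hr as [Hr|Hr]; [|apply in_app_or in Hr; destruct Hr as [Hr|Hr]].
    + apply in_grid in Hr. destruct Hr as [u [j [Hu' [Hj E']]]].
      destruct (Hu u j r Hu' E') as [K1 _]. apply (K1 0 i); [now left|]. rewrite <- E. ring.
    + apply in_grid in Hr. destruct Hr as [v [j [Hv [Hj E']]]].
      destruct (generic_inj _ v 0 j i HV) as [E1 _]; [now right|now left| |].
      * rewrite <- E', <- E. ring.
      * subst v. contradiction.
    + subst r. revert Hr. apply Hx. change (Im (natC i)) with 0%R. rewrite Rabs_R0.
      pose proof (INR_S_ge1 M). lra.
Qed.

Lemma size_poles : size (poles M A U V') = (length U * M + length V' * M + (2 * A + 2) + 2 * M)%nat.
Proof.
  assert (Hs : forall l m, size (l ++ m) = (size l + size m)%nat).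
  { induction l as [|x l IHl]; intros m; simpl; [auto|]. rewrite IHl. lia. }
  unfold poles. rewrite Hs.
  assert (H1 : forall l, size (map (fun r : C => (r, false)) l) = length l).
  { induction l as [|x l IHl]; simpl; auto. }
  assert (H2 : forall l, size (map (fun j : nat => (natC j, true)) l) = (2 * length l)%nat).
  { induction l as [|x l IHl]; simpl in *; lia. }
  rewrite H1, H2, length_seq. unfold simple_poles.
  rewrite !length_app, !length_grid, length_map, length_xhat. lia.
Qed.

Variable (m : nat).
Hypothesis (HlU : length U = (length W + m)%nat) (HlV : (2 + length V' = length X + m)%nat).
Hypothesis (HW : forall w, In w W -> notpole w) (HX : forall x, In x X -> nonint x).

Lemma residues_vanish : residues (zeros M A W X) (poles M A U V') = 0.
Proof.
  apply residue_theorem.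
  - exact NoDup_poles.
  - intros n q Hn Hq Hs E. unfold poles in Hq. apply in_app_or in Hq. destruct Hq as [Hq|Hq];
      apply in_map_iff in Hq; destruct Hq as [k [Ek Hk]]; subst q; simpl in Hs; [discriminate|].
    cbn [fst] in E. apply in_seq in Hk. unfold zeros in Hn.
    apply in_app_or in Hn. destruct Hn as [Hn|Hn]; [|apply in_app_or in Hn; destruct Hn as [Hn|Hn]].
    + apply in_grid in Hn. destruct Hn as [w [j [Hw [Hj E']]]]. apply (HW w Hw (j + k)%nat).
      rewrite plus_INR, RtoC_plus, <- E, E'. ring.
    + apply in_grid in Hn. destruct Hn as [x [j [Hx [Hj E']]]]. apply (HX x Hx (Z.of_nat k - Z.of_nat j)%Z).
      rewrite minus_IZR, RtoC_minus, <- !INR_IZR_INZ, <- E, E'. ring.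
    + apply in_map_iff in Hn. destruct Hn as [c [E' Hc]]. unfold nhat in Hc.
      assert (Hk' : (INR k < INR (S M))%R) by (apply lt_INR; lia). pose proof (pos_INR k).
      pose proof (INR_S_ge1 M).
      apply in_app_or in Hc. destruct Hc as [Hc|Hc]; apply repeat_spec in Hc; subst c;
        rewrite <- E', <- RtoC_mult in E; apply RtoC_inj in E; lra.
  (* The degree deficit is 2 m M + 2: m M from U and W, m M from V and X, and 2 from the
     regulator. *)
  - rewrite size_poles. unfold zeros. rewrite !length_app, !length_grid, length_map, length_nhat. nia.
Qed.

Definition extra_residues : C :=
  scaling M m U (RtoC 0 :: RtoC 0 :: V') W X * sgn M X V' * natC (S M) ^ 2
  * vsum (map (fun x => punctured_value (zeros M A W X) (poles M A U V') (x * natC (S M))) (xhat A)).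

Lemma scaling_swap (V : list C) : scaling M m V U X W = scaling M m U V W X.
Proof. unfold scaling. f_equal. f_equal. ring. Qed.

(** The vanishing sum of residues, multiplied by [scaling], by [sgn], whose square is 1, and by
    (M+1)^2, which undoes [regulator_scaled]. After this each residue is a convergent [term] times a
    value of the regulator. *)
Lemma finite_identity :
  csum M (fun k => term M U (RtoC 0 :: RtoC 0 :: V') W X 0 k * regulator A (natC k / natC (S M))
            * (Lam M U (RtoC 0 :: RtoC 0 :: V') W X k + reg_log A M (natC k)))
  + vsum (map (fun u => csum M (fun k => term M (RtoC 0 :: RtoC 0 :: V') U X W u k
              * regulator A ((- u - natC k) / natC (S M)))) U)
  - vsum (map (fun v => csum M (fun k => term M U (RtoC 0 :: RtoC 0 :: V') W X v k
              * regulator A ((v + natC k) / natC (S M)))) V')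
  + extra_residues = 0.
Proof.
  pose proof residues_vanish as H. rewrite residues_split in H.
  set (V := RtoC 0 :: RtoC 0 :: V') in *.
  assert (Hc : natC (S M) <> 0) by (apply INR_neq_0; lia).
  destruct (HV) as [HVnd HVn]. inversion HVnd as [|? ? H0V HV'nd]; subst.
  assert (HVV : length V = (length X + m)%nat) by exact HlV.
  assert (HVin : forall v0 v, In v0 (RtoC 0 :: V') -> In v V -> v - v0 = 0 \/ nonint (v - v0)).
  { intros v0 v H0 Hv. destruct (Ceq_dec v v0) as [->|Hne]; [left; ring|].
    right. apply HVn; auto. destruct Hv as [Hv|Hv]; [now left|exact Hv]. }
  assert (Hsg := sgn_sq M X V'). set (s := sgn M X V') in *.
  set (K := scaling M m U V W X).
  assert (EU : K * s * natC (S M) ^ 2 *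
     vsum (map (fun u => csum M (fun k => punctured_value (zeros M A W X) (poles M A U V') (- u - natC k))) U)
    = vsum (map (fun u => csum M (fun k => term M V U X W u k
              * regulator A ((- u - natC k) / natC (S M)))) U)).
  { rewrite <- vsum_scal. apply vsum_ext. intros u Hu. rewrite <- csum_scal. apply csum_ext. intros k Hk.
    rewrite punctured_value_U.
    - fold V s. rewrite (term_Traw M m) by
        (auto; intros v [<-|Hv]; rewrite Cplus_comm; apply HUV; auto; now left).
      rewrite scaling_swap. fold K.
      transitivity ((s * s) * (K * Traw M V U X W u k * regulator A ((- u - natC k) / natC (S M))));
        [field; exact Hc|rewrite Hsg; ring].
    - intros v Hv. rewrite Cplus_comm. now apply HUV.
    - intros x Hx. apply off_imaginary with A; [|exact Hx].
      replace (- u - natC k) with (- (u + natC k)) by ring.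
      change (Im (- (u + natC k))) with (- Im (u + natC k))%R. rewrite Rabs_Ropp.
      apply Im_big. apply in_or_app. now left. }
  assert (EV : K * s * natC (S M) ^ 2 *
     vsum (map (fun v => csum M (fun k => punctured_value (zeros M A W X) (poles M A U V') (v + natC k))) V')
    = - vsum (map (fun v => csum M (fun k => term M U V W X v k
              * regulator A ((v + natC k) / natC (S M)))) V')).
  { rewrite <- vsum_scal.
    match goal with |- _ = - ?a => replace (- a) with (-1 * a) by ring end.
    rewrite <- vsum_scal. apply vsum_ext. intros v0 Hv0. rewrite <- !csum_scal. apply csum_ext. intros k Hk.
    rewrite punctured_value_V; auto.
    - fold V s. rewrite vprod_indicator by auto. rewrite (term_Traw M m) by (auto; intros; apply HUV; auto; now right).
      fold K.
      transitivity (- (s * s) * (K * Traw M U V W X v0 k * regulator A ((v0 + natC k) / natC (S M))));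
        [field; exact Hc|rewrite Hsg; ring].
    - intros u Hu. apply HUV; auto. now right.
    - intros v Hv. apply HVin; [now right|]. now right.
    - intros x Hx. apply off_imaginary with A; [|exact Hx]. apply Im_big. apply in_or_app. now right. }
  assert (E0 : K * s * natC (S M) ^ 2 *
     csum M (fun k => punctured_value (zeros M A W X) (poles M A U V') (natC k)
              * log_deriv (zeros M A W X) (poles M A U V') (natC k))
    = csum M (fun k => term M U V W X 0 k * regulator A (natC k / natC (S M))
            * (Lam M U V W X k + reg_log A M (natC k)))).
  { rewrite <- csum_scal. apply csum_ext. intros k Hk. rewrite log_deriv_at by lia. fold V.
    pose proof (punctured_value_V M A U V' W X 0 k Hk) as E. rewrite !Cplus_0_l in E.
    rewrite E; clear E.
    - fold V s. rewrite (vprod_ext _ (fun _ => RtoC 1)).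
      + rewrite vprod_const, Cpow_1_l. rewrite (term_Traw M m) by (auto; intros; apply HUV; auto; now left).
        fold K. transitivity ((s * s) * (K * Traw M U V W X 0 k * regulator A (natC k / natC (S M)))
          * (Lam M U V W X k + reg_log A M (natC k)));
        [field; exact Hc|rewrite Hsg; ring].
      + intros v Hv. destruct (Ceq_dec v 0) as [->|]; [contradiction|reflexivity].
    - intros u Hu. apply HUV; auto. now left.
    - intros v Hv. apply HVin; [now left|]. now right.
    - intros x Hx. apply off_imaginary with A; [|exact Hx]. change (Im (natC k)) with 0%R.
      rewrite Rabs_R0. pose proof (INR_S_ge1 M). lra. }
  apply (f_equal (Cmult (K * s * natC (S M) ^ 2))) in H.
  rewrite !Cmult_plus_distr_l, EU, EV, E0, Cmult_0_r in H.
  unfold extra_residues. fold V K s. etransitivity; [|exact H]. ring.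
Qed.
End Poles.

(** * Passage to the limit *)

Lemma vprod_repeat (f : C -> C) (c : C) (A : nat) : vprod (map f (repeat c A)) = f c ^ A.
Proof.
  induction A as [|A IH]; [reflexivity|]. simpl repeat. simpl map. now rewrite vprod_cons, IH, Cpow_S.
Qed.

Lemma Cmod_vprod_le {A : Type} (f : A -> C) (l : list A) (c : R) : (0 <= c)%R ->
  (forall x, In x l -> (Cmod (f x) <= c)%R) -> (Cmod (vprod (map f l)) <= c ^ length l)%R.
Proof.
  intros Hc. induction l as [|x l IH]; intros H.
  - simpl. rewrite Cmod_1. lra.
  - simpl map. rewrite vprod_cons, Cmod_mult. simpl. apply Rmult_le_compat; try apply Cmod_ge_0.
    + apply H. now left.
    + apply IH. intros; apply H; now right.
Qed.

Lemma Cmod_vprod_ge {A : Type} (f : A -> C) (l : list A) (c : R) : (0 <= c)%R ->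
  (forall x, In x l -> (c <= Cmod (f x))%R) -> (c ^ length l <= Cmod (vprod (map f l)))%R.
Proof.
  intros Hc. induction l as [|x l IH]; intros H.
  - simpl. rewrite Cmod_1. lra.
  - simpl map. rewrite vprod_cons, Cmod_mult. simpl. apply Rmult_le_compat; auto.
    + now apply pow_le.
    + apply H. now left.
    + apply IH. intros; apply H; now right.
Qed.

Lemma Im_imag_minus (t : C) (c : R) : Im (t - Ci * RtoC c) = (Im t - c)%R.
Proof. destruct t as [p q]. unfold Im, RtoC, Ci, Cminus, Cplus, Copp, Cmult. cbn [fst snd]. ring. Qed.

Lemma xhat_far (A : nat) (t x : C) : (Rabs (Im t) <= 1 / 2)%R -> In x (xhat A) -> (1 / 2 <= Cmod (t - x))%R.
Proof.
  intros Ht Hx. apply in_xhat in Hx. destruct Hx as [l ->].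
  eapply Rle_trans; [|apply im_le_Cmod]. rewrite Im_imag_minus. pose proof (INR_S_ge1 l).
  apply Rabs_le_between in Ht. rewrite Rabs_left1; lra.
Qed.

Lemma regulator_le (A : nat) (t : C) : (Rabs (Im t) <= 1 / 2)%R ->
  (Cmod (regulator A t) <= (Cmod (t - 1) * Cmod (t + 1)) ^ A * 2 ^ (2 * A + 2))%R.
Proof.
  intros Ht. unfold regulator, nhat. rewrite map_app, vprod_app, !vprod_repeat.
  assert (H0 : forall x, In x (xhat A) -> t - x <> 0).
  { intros x Hx. apply Cmod_gt_0. pose proof (xhat_far A t x Ht Hx). lra. }
  unfold Cdiv. rewrite vprod_inv by exact H0.
  rewrite !Cmod_mult, !Cmod_pow. replace (t - -1) with (t + 1) by ring.
  rewrite <- Rpow_mult_distr. apply Rmult_le_compat_l.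
  { apply pow_le, Rmult_le_pos; apply Cmod_ge_0. }
  rewrite <- length_xhat. apply Cmod_vprod_le; [lra|]. intros x Hx.
  rewrite Cmod_inv by auto. replace 2%R with (/ (1 / 2))%R by field.
  apply Rinv_le_contravar; [lra|]. now apply xhat_far with A.
Qed.

Lemma exp_pow_nat (x : R) (n : nat) : (exp x ^ n = exp (INR n * x))%R.
Proof.
  induction n as [|n IH]; [simpl; now rewrite Rmult_0_l, exp_0|].
  simpl pow. rewrite IH, <- exp_plus, S_INR. f_equal. ring.
Qed.

(** The decay comes from |v0 + k - (M+1)| <= (1 + |v0|)(M-k+1), raised to the power A; the other
    factors stay bounded. Taking sg = -1 only exchanges the zeros 1 and -1. *)
Lemma regulator_upper (A : nat) (v0 : C) (sg : R) : sg = 1%R \/ sg = (-1)%R ->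
  exists (M0 : nat) (B : R), (0 < B)%R /\ forall M k, (M0 <= M)%nat -> (k < M)%nat ->
    (Cmod (regulator A (RtoC sg * (v0 + natC k) / natC (S M)))
     <= B * exp (- INR A * (lnS M - lnS (M - k))))%R.
Proof.
  intros Hs. pose proof (Cmod_ge_0 v0) as Hv0.
  (* This makes |Im t| at most 1/2, which keeps both t and -t at distance at least 1/2 from the
     poles i l. *)
  destruct (nat_above (2 * Cmod v0)) as [M0 HM0].
  exists M0, (((1 + Cmod v0) * (2 + Cmod v0)) ^ A * 2 ^ (2 * A + 2))%R. split.
  { apply Rmult_lt_0_compat; apply pow_lt; nra. }
  intros M k HM Hk. specialize (HM0 M HM).
  set (N := INR (S M)). assert (HN : (1 <= N)%R) by apply INR_S_ge1.
  assert (HNc : RtoC N <> 0) by (apply INR_neq_0; lia).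
  assert (HNM : (2 * Cmod v0 <= N)%R) by (unfold N; rewrite S_INR; lra).
  set (t := (v0 + natC k) / RtoC N).
  assert (Et : RtoC sg * (v0 + natC k) / RtoC N = RtoC sg * t) by (unfold t; field; exact HNc).
  rewrite Et.
  assert (B1 : (Cmod (t - 1) <= (1 + Cmod v0) * exp (lnS (M - k) - lnS M))%R).
  { unfold t. replace ((v0 + natC k) / RtoC N - 1) with ((v0 + RtoC (INR k - N)) / RtoC N)
      by (rewrite RtoC_minus; field; exact HNc).
    rewrite Cmod_div, Cmod_R, (Rabs_pos_eq N) by (auto; lra).
    unfold Rminus at 2. rewrite exp_plus, exp_Ropp, !exp_lnS. fold N. rewrite <- Rmult_assoc.
    apply Rmult_le_compat_r; [left; apply Rinv_0_lt_compat; lra|].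
    eapply Rle_trans; [apply Cmod_triangle|]. rewrite Cmod_R.
    replace (INR k - N)%R with (- INR (S (M - k)))%R.
    2:{ unfold N. replace (S M) with (S (M - k) + k)%nat by lia. rewrite plus_INR. ring. }
    rewrite Rabs_Ropp, Rabs_pos_eq by apply pos_INR. pose proof (INR_S_ge1 (M - k)). nra. }
  assert (Ht : (Cmod t <= 1 + Cmod v0)%R).
  { unfold t. rewrite Cmod_div, Cmod_R, (Rabs_pos_eq N) by (auto; lra).
    apply Rmult_le_reg_r with N; [lra|]. unfold Rdiv. rewrite Rmult_assoc, Rinv_l, Rmult_1_r by lra.
    eapply Rle_trans; [apply Cmod_triangle|]. rewrite Cmod_R, Rabs_pos_eq by apply pos_INR.
    assert (INR k <= N)%R by (apply le_INR; lia). nra. }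
  assert (B2 : (Cmod (t + 1) <= 2 + Cmod v0)%R).
  { eapply Rle_trans; [apply Cmod_triangle|]. rewrite Cmod_1. lra. }
  assert (HIm : (Rabs (Im t) <= 1 / 2)%R).
  { unfold t. replace (Im ((v0 + natC k) / RtoC N)) with (Im v0 / N)%R.
    - unfold Rdiv. rewrite Rabs_mult, Rabs_inv, (Rabs_pos_eq N) by lra.
      apply Rmult_le_reg_r with N; [lra|]. rewrite Rmult_assoc, Rinv_l by lra.
      pose proof (im_le_Cmod v0). lra.
    - destruct v0 as [p q]. unfold Im, RtoC, Cdiv, Cinv, Cplus, Cmult. cbn [fst snd]. field. lra. }
  assert (HImS : (Rabs (Im (RtoC sg * t)) <= 1 / 2)%R).
  { destruct t as [p q]. unfold Im, RtoC, Cmult in *. cbn [fst snd] in *.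
    destruct Hs as [->| ->].
    - replace (1 * q + 0 * p)%R with q by ring. exact HIm.
    - replace (-1 * q + 0 * p)%R with (- q)%R by ring. now rewrite Rabs_Ropp. }
  eapply Rle_trans; [apply regulator_le, HImS|].
  assert (E : (Cmod (RtoC sg * t - 1) * Cmod (RtoC sg * t + 1) = Cmod (t - 1) * Cmod (t + 1))%R).
  { destruct Hs as [->| ->].
    - now rewrite Cmult_1_l.
    - replace (-1 * t - 1) with (- (t + 1)) by ring. replace (-1 * t + 1) with (- (t - 1)) by ring.
      rewrite !Cmod_opp. ring. }
  rewrite E.
  replace (((1 + Cmod v0) * (2 + Cmod v0)) ^ A * 2 ^ (2 * A + 2) * exp (- INR A * (lnS M - lnS (M - k))))%R
    with (((1 + Cmod v0) * exp (lnS (M - k) - lnS M) * (2 + Cmod v0)) ^ A * 2 ^ (2 * A + 2))%R.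
  2:{ rewrite !Rpow_mult_distr, exp_pow_nat.
      replace (INR A * (lnS (M - k) - lnS M))%R with (- INR A * (lnS M - lnS (M - k)))%R by ring. ring. }
  apply Rmult_le_compat_r; [apply pow_le; lra|]. apply pow_incr. split.
  - apply Rmult_le_pos; apply Cmod_ge_0.
  - apply Rmult_le_compat; auto; apply Cmod_ge_0.
Qed.

Lemma xhat_neq_0 (A : nat) (x : C) : In x (xhat A) -> 0 - x <> 0.
Proof.
  intros Hx. apply Cmod_gt_0.
  assert (H : (Rabs (Im 0) <= 1 / 2)%R) by (change (Im (RtoC 0)) with 0%R; rewrite Rabs_R0; lra).
  pose proof (xhat_far A 0 x H Hx). lra.
Qed.

Lemma inv_INR_cv (c : C) : ccv (fun M => c / natC (S M)) 0.
Proof.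
  apply (eq_ind (c * 0) (ccv _)); [|ring]. eapply ccv_ext; [|apply ccv_scal, ccv_RtoC, inv_INR_lim].
  intros n. cbv beta. rewrite RtoC_inv by (apply not_0_INR; lia). reflexivity.
Qed.

Lemma regulator_cv (A : nat) (t : C) : ccv (fun M => regulator A (t / natC (S M))) (regulator A 0).
Proof.
  unfold regulator. apply ccv_div.
  - apply (vprod_cv (fun M n => t / natC (S M) - n)). intros n _.
    apply ccv_minus; [apply inv_INR_cv|apply ccv_const].
  - apply (vprod_cv (fun M n => t / natC (S M) - n)). intros n _.
    apply ccv_minus; [apply inv_INR_cv|apply ccv_const].
  - apply vprod_neq_0. apply xhat_neq_0.
Qed.

Lemma regulator_0_neq_0 (A : nat) : regulator A 0 <> 0.
Proof.
  unfold regulator, Cdiv. apply Cmult_neq_0.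
  - apply vprod_neq_0. intros n Hn. unfold nhat in Hn. apply in_app_or in Hn.
    destruct Hn as [Hn|Hn]; apply repeat_spec in Hn; subst n; rewrite <- RtoC_minus;
      intros E; apply RtoC_inj in E; lra.
  - assert (H : vprod (map (fun x => 0 - x) (xhat A)) <> 0) by (apply vprod_neq_0; apply xhat_neq_0).
    intros E. apply C1_nz. rewrite <- (Cinv_r _ H), E. ring.
Qed.

Lemma Cmod_vsum_le {A : Type} (f : A -> C) (l : list A) (c : R) :
  (forall x, In x l -> (Cmod (f x) <= c)%R) -> (Cmod (vsum (map f l)) <= INR (length l) * c)%R.
Proof.
  induction l as [|x l IH]; intros H.
  - simpl. rewrite Cmod_0. lra.
  - simpl map. rewrite vsum_cons. simpl length. rewrite S_INR. eapply Rle_trans; [apply Cmod_triangle|].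
    pose proof (H x (or_introl eq_refl)). assert (Cmod (vsum (map f l)) <= INR (length l) * c)%R by (apply IH; intros; apply H; now right). lra.
Qed.

Lemma reg_log_denominators (A M : nat) (k : nat) (n : C) : (k < M)%nat ->
  In n (nhat A ++ xhat A) -> (INR (S M) - INR k <= Cmod (natC k - n * natC (S M)))%R.
Proof.
  intros Hk Hn. assert (Hk' : (INR k < INR (S M))%R) by (apply lt_INR; lia). pose proof (pos_INR k).
  apply in_app_or in Hn. destruct Hn as [Hn|Hn].
  - unfold nhat in Hn. apply in_app_or in Hn.
    destruct Hn as [Hn|Hn]; apply repeat_spec in Hn; subst n; rewrite <- RtoC_mult, <- RtoC_minus, Cmod_R.
    + rewrite Rabs_left by lra. lra.
    + rewrite Rabs_pos_eq by lra. lra.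
  - apply in_xhat in Hn. destruct Hn as [l ->].
    eapply Rle_trans; [|apply im_le_Cmod].
    replace (Ci * natC (S l) * natC (S M)) with (Ci * RtoC (INR (S l) * INR (S M)))
      by (rewrite RtoC_mult; ring).
    rewrite Im_imag_minus. change (Im (natC k)) with 0%R.
    pose proof (INR_S_ge1 l). pose proof (INR_S_ge1 M). rewrite Rabs_left; nra.
Qed.

(** No zero or pole of the scaled regulator is nearer to k than M + 1. Hence the bound is uniform
    for k < M and tends to 0 for fixed k. *)
Lemma reg_log_upper (A M k : nat) : (k < M)%nat ->
  (Cmod (reg_log A M (natC k)) <= (4 * INR A + 2) * / (INR (S M) - INR k))%R.
Proof.
  intros Hk. assert (Hk' : (INR k < INR (S M))%R) by (apply lt_INR; lia).
  unfold reg_log. eapply Rle_trans; [apply Cmod_minus_le|].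
  assert (H : forall n, In n (nhat A ++ xhat A) ->
    (Cmod (/ (natC k - n * natC (S M))) <= / (INR (S M) - INR k))%R).
  { intros n Hn. pose proof (reg_log_denominators A M k n Hk Hn) as D.
    rewrite Cmod_inv by (apply Cmod_gt_0; lra). apply Rinv_le_contravar; lra. }
  pose proof (Cmod_vsum_le (fun n => / (natC k - n * natC (S M))) (nhat A) _
    (fun n Hn => H n (in_or_app _ _ _ (or_introl Hn)))) as H1.
  pose proof (Cmod_vsum_le (fun n => / (natC k - n * natC (S M))) (xhat A) _
    (fun n Hn => H n (in_or_app _ _ _ (or_intror Hn)))) as H2.
  rewrite length_nhat in H1. rewrite length_xhat in H2.
  rewrite plus_INR, mult_INR in H2. rewrite mult_INR in H1. simpl (INR 2) in *. lra.
Qed.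

Lemma reg_log_cv (A k : nat) : ccv (fun M => reg_log A M (natC k)) 0.
Proof.
  apply (ccv_shift _ _ (S k)).
  apply (ccv_squeeze _ _ (fun n => (4 * INR A + 2) * / INR (S n))%R O).
  - intros n _. replace (reg_log A (n + S k) (natC k) - 0) with (reg_log A (n + S k) (natC k)) by ring.
    eapply Rle_trans; [apply reg_log_upper; lia|].
    apply Rmult_le_compat_l; [pose proof (pos_INR A); lra|].
    assert (E : (INR (S (n + S k)) - INR k = INR n + 2)%R).
    { rewrite S_INR, plus_INR, S_INR. ring. }
    rewrite E, S_INR. apply Rinv_le_contravar; pose proof (pos_INR n); lra.
  - replace (Finite 0) with (Rbar_mult (4 * INR A + 2)%R 0%R) by (simpl; f_equal; ring).
    apply (is_lim_seq_scal_l (fun m => / INR (S m))%R (4 * INR A + 2)%R 0%R inv_INR_lim).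
Qed.

Definition Lam_lim (U V W X : list C) (k : nat) : C :=
  - vsum (map (fun w => psi (w + natC k)) W)
  + vsum (map (fun x => psi (x - natC k)) X)
  + vsum (map (fun u => psi (u + natC k)) U)
  - vsum (map (fun v => psi (v - natC k)) V).

Lemma vsum_opp_sub {A : Type} (c : C) (f : A -> C) (l : list A) :
  vsum (map (fun x => c - f x) l) = natC (length l) * c - vsum (map f l).
Proof.
  induction l as [|x l IH]; [simpl; ring|]. simpl map. rewrite !vsum_cons, IH. simpl length.
  rewrite S_INR, RtoC_plus. ring.
Qed.

(** Each harmonic sum diverges like ln(M+1); by the length condition these logarithms cancel, which
    allows every sum to be replaced by a convergent [psin]. *)
Lemma Lam_cv (U V W X : list C) (k : nat) :
  (length W + length V = length X + length U)%nat ->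
  ccv (fun M => Lam M U V W X k) (Lam_lim U V W X k).
Proof.
  intros Hlen. apply ccv_ext with (fun M =>
   - vsum (map (fun w => psin M (w + natC k)) W)
   + vsum (map (fun x => psin M (x - natC k)) X)
   + vsum (map (fun u => psin M (u + natC k)) U)
   - vsum (map (fun v => psin M (v - natC k)) V)).
  - intros M. unfold psin. rewrite !vsum_opp_sub. unfold Lam.
    assert (E : natC (length W) + natC (length V) = natC (length X) + natC (length U)).
    { rewrite <- !RtoC_plus, <- !plus_INR. now rewrite Hlen. }
    replace (natC (length W)) with (natC (length X) + natC (length U) - natC (length V))
      by (rewrite <- E; ring).
    ring.
  - unfold Lam_lim. apply ccv_minus; [apply ccv_plus; [apply ccv_plus; [apply ccv_opp|]|]|].
    + apply (vsum_cv (fun M y => psin M (y + natC k))). intros; apply psi_cv.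
    + apply (vsum_cv (fun M y => psin M (y - natC k))). intros; apply psi_cv.
    + apply (vsum_cv (fun M y => psin M (y + natC k))). intros; apply psi_cv.
    + apply (vsum_cv (fun M y => psin M (y - natC k))). intros; apply psi_cv.
Qed.

(** The same cancellation removes ln(M+1) with uniformity in k; what is left is ln(k+1) and the
    logarithm of (M+1)/(M-k+1). *)
Lemma Lam_upper (U V W X : list C) :
  (length W + length V = length X + length U)%nat ->
  exists B, (0 < B)%R /\ forall M k, (k < M)%nat ->
    (Cmod (Lam M U V W X k) <= B * (1 + lnS k + (lnS M - lnS (M - k))))%R.
Proof.
  intros Hlen.
  assert (HP : forall l, exists B, (0 < B)%R /\ forall M k, (k < M)%nat ->
     (Cmod (vsum (map (fun x => hsum (x + natC k) M) l) - RtoC (INR (length l) * lnS M))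
       <= B * (1 + lnS k + (lnS M - lnS (M - k))))%R).
  { intros l. apply (vsum_hsum_upper (fun x M k => hsum (x + natC k) M)). intros x _.
    destruct (hsum_plus_upper x) as [B [P K]]. exists B. split; [exact P|]. intros M k Hk.
    eapply Rle_trans; [now apply K|]. pose proof (lnS_le (M - k) M ltac:(lia)). lra. }
  assert (HM : forall l, exists B, (0 < B)%R /\ forall M k, (k < M)%nat ->
     (Cmod (vsum (map (fun x => hsum (x - natC k) M) l) - RtoC (INR (length l) * lnS M))
       <= B * (1 + lnS k + (lnS M - lnS (M - k))))%R).
  { intros l. apply (vsum_hsum_upper (fun x M k => hsum (x - natC k) M)). intros x _.
    apply hsum_minus_upper. }
  destruct (HP W) as [B1 [P1 K1]]. destruct (HM X) as [B2 [P2 K2]].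
  destruct (HP U) as [B3 [P3 K3]]. destruct (HM V) as [B4 [P4 K4]].
  exists (B1 + B2 + B3 + B4)%R. split; [lra|]. intros M k Hk.
  specialize (K1 M k Hk). specialize (K2 M k Hk). specialize (K3 M k Hk). specialize (K4 M k Hk).
  unfold Lam.
  set (s1 := vsum (map (fun w => hsum (w + natC k) M) W)) in *.
  set (s2 := vsum (map (fun w => hsum (w - natC k) M) X)) in *.
  set (s3 := vsum (map (fun w => hsum (w + natC k) M) U)) in *.
  set (s4 := vsum (map (fun w => hsum (w - natC k) M) V)) in *.
  assert (E : RtoC (INR (length W) * lnS M) + RtoC (INR (length V) * lnS M)
    = RtoC (INR (length X) * lnS M) + RtoC (INR (length U) * lnS M)).
  { rewrite <- !RtoC_plus. f_equal. rewrite <- !Rmult_plus_distr_r, <- !plus_INR. now rewrite Hlen. }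
  replace (s1 - s2 - s3 + s4) with
   ((s1 - RtoC (INR (length W) * lnS M)) + ((s4 - RtoC (INR (length V) * lnS M))
     + (- (s2 - RtoC (INR (length X) * lnS M)) + - (s3 - RtoC (INR (length U) * lnS M))))).
  2:{ replace (RtoC (INR (length W) * lnS M)) with (RtoC (INR (length X) * lnS M) + RtoC (INR (length U) * lnS M) - RtoC (INR (length V) * lnS M)) by (rewrite <- E; ring). ring. }
  set (q := (1 + lnS k + (lnS M - lnS (M - k)))%R) in *.
  eapply Rle_trans; [apply Cmod_triangle|].
  pose proof (Cmod_triangle (s4 - RtoC (INR (length V) * lnS M)) (- (s2 - RtoC (INR (length X) * lnS M)) + - (s3 - RtoC (INR (length U) * lnS M)))).
  pose proof (Cmod_triangle (- (s2 - RtoC (INR (length X) * lnS M))) (- (s3 - RtoC (INR (length U) * lnS M)))).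
  rewrite !Cmod_opp in *. lra.
Qed.

Lemma ccv_csum_scal_inv (f : nat -> C) (c l : C) : c <> 0 ->
  ccv (fun n => csum n (fun k => f k * c)) l -> ccv (fun n => csum n f) (l / c).
Proof.
  intros Hc H. apply (ccv_scal (/ c)) in H. unfold Cdiv. rewrite Cmult_comm.
  eapply ccv_ext; [|exact H]. intros n. cbv beta. rewrite <- csum_scal. apply csum_ext.
  intros k _. field. exact Hc.
Qed.

(** For A >= A0 the regulator absorbs the growth near k = M and (k+1)^(-1-s) is a majorant for
    [Tannery]. The claim for all larger A lets one regulator serve finitely many families at
    once. *)
Lemma family_sum (U V W X : list C) (v0 : C) (m : nat) (s : R) :
  length U = (length W + m)%nat -> length V = (length X + m)%nat ->
  Re (vsum U + vsum V - vsum W - vsum X) = (INR m - 1 - s)%R -> (0 < s)%R ->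
  (forall u, In u U -> notpole (u + v0)) ->
  (forall w, In w W -> notpole (w + v0)) ->
  (forall v, In v V -> v - v0 = 0 \/ nonint (v - v0)) ->
  exists A0 : nat, forall A (sg : R), (A0 <= A)%nat -> sg = 1%R \/ sg = (-1)%R ->
  exists l, ccv (fun n => csum n (term_lim U V W X v0)) l /\
    ccv (fun M => csum M (fun k => term M U V W X v0 k
           * regulator A (RtoC sg * (v0 + natC k) / natC (S M)))) (l * regulator A 0).
Proof.
  intros HlU HlV Hsum Hs HU HW HV.
  destruct (term_upper U V W X v0 m s HlU HlV Hsum HU HW HV) as [A0 [B [HB K]]].
  exists A0. intros A sg HA Hsg.
  destruct (regulator_upper A v0 sg Hsg) as [M0 [B' [HB' K']]].
  destruct (Tannery (fun M k => term M U V W X v0 k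
           * regulator A (RtoC sg * (v0 + natC k) / natC (S M)))
     (fun k => term_lim U V W X v0 k * regulator A 0)
     (fun k => (B * B') * exp ((-1 - s) * lnS k))%R M0) as [l [H1 H2]].
  - intros k. apply ccv_mult; [now apply term_cv|apply regulator_cv].
  - intros M k HM Hk. rewrite Cmod_mult. specialize (K M k Hk). specialize (K' M k HM Hk).
    eapply Rle_trans; [apply Rmult_le_compat; [apply Cmod_ge_0|apply Cmod_ge_0|exact K|exact K']|].
    match goal with |- (B * exp ?a * (B' * exp ?b) <= _)%R =>
      replace (B * exp a * (B' * exp b))%R with (B * B' * exp (a + b))%R by (rewrite exp_plus; ring) end.
    apply Rmult_le_compat_l; [nra|]. apply exp_le_mono.
    pose proof (lnS_le (M - k) M ltac:(lia)). apply le_INR in HA. nra.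
  - apply (ex_series_scal (V := R_NormedModule) (B * B')%R). now apply p_series.
  - exists (l / regulator A 0). split.
    + apply ccv_csum_scal_inv; [apply regulator_0_neq_0|exact H1].
    + replace (l / regulator A 0 * regulator A 0) with l by (field; apply regulator_0_neq_0). exact H2.
Qed.

Lemma x_exp_le (x : R) : (0 <= x)%R -> (x * exp (- x) <= 1)%R.
Proof.
  intros Hx. rewrite exp_Ropp. pose proof (exp_ineq1_le x). pose proof (exp_pos x).
  apply Rmult_le_reg_r with (exp x); [lra|]. rewrite Rmult_assoc, Rinv_l by lra. lra.
Qed.

(** Compared with [family_sum], the logarithmic derivative costs ln(k+1), paid with half of s, and
    the logarithm of (M+1)/(M-k+1), paid with one more order of the regulator: hence [S A0]. *)
Lemma double_sum (U V W X : list C) (m : nat) (s : R) :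
  length U = (length W + m)%nat -> length V = (length X + m)%nat ->
  Re (vsum U + vsum V - vsum W - vsum X) = (INR m - 1 - s)%R -> (0 < s)%R ->
  (forall u, In u U -> notpole u) ->
  (forall w, In w W -> notpole w) ->
  (forall v, In v V -> v = 0 \/ nonint v) ->
  exists A0 : nat, forall A, (A0 <= A)%nat ->
  exists l, ccv (fun n => csum n (fun k => term_lim U V W X 0 k * Lam_lim U V W X k)) l /\
    ccv (fun M => csum M (fun k => term M U V W X 0 k
           * regulator A (natC k / natC (S M))
           * (Lam M U V W X k + reg_log A M (natC k)))) (l * regulator A 0).
Proof.
  intros HlU HlV Hsum Hs HU HW HV.
  assert (HU0 : forall u, In u U -> notpole (u + 0)) by (intros; rewrite Cplus_0_r; auto).
  assert (HW0 : forall w, In w W -> notpole (w + 0)) by (intros; rewrite Cplus_0_r; auto).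
  assert (HV0 : forall v, In v V -> v - 0 = 0 \/ nonint (v - 0)).
  { intros v Hv. replace (v - 0) with v by ring. auto. }
  destruct (term_upper U V W X 0 m s HlU HlV Hsum HU0 HW0 HV0) as [A0 [B [HB K]]].
  exists (S A0). intros A HA.
  destruct (regulator_upper A 0 1 (or_introl eq_refl)) as [M0 [B' [HB' K']]].
  assert (Hlen : (length W + length V = length X + length U)%nat) by lia.
  destruct (Lam_upper U V W X Hlen) as [B'' [HB'' K'']].
  set (c := (B'' + (4 * INR A + 2))%R).
  assert (Hc : (0 < c)%R) by (unfold c; pose proof (pos_INR A); lra).
  (* With x = (s/2) ln(k+1) and N the second logarithm, exp(-x) exp(-N) (1 + (2/s) x + N) <= 1 + 2/s
     + 1, by y exp(-y) <= 1. *)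
  set (cs := (2 + 2 / s)%R).
  destruct (Tannery (fun M k => term M U V W X 0 k
           * regulator A (natC k / natC (S M))
           * (Lam M U V W X k + reg_log A M (natC k)))
     (fun k => term_lim U V W X 0 k * regulator A 0 * Lam_lim U V W X k)
     (fun k => (B * B' * c * cs) * exp ((-1 - s / 2) * lnS k))%R M0) as [l [H1 H2]].
  - intros k. apply ccv_mult; [apply ccv_mult; [now apply term_cv|apply regulator_cv]|].
    apply (eq_ind (Lam_lim U V W X k + 0) (ccv _)); [|ring].
    apply ccv_plus; [now apply Lam_cv|apply reg_log_cv].
  - intros M k HM Hk. rewrite !Cmod_mult. specialize (K M k Hk). specialize (K' M k HM Hk).
    rewrite Cplus_0_l, Cmult_1_l in K'. specialize (K'' M k Hk).
    pose proof (reg_log_upper A M k Hk) as KL. pose proof (lnS_le (M - k) M ltac:(lia)) as HN.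
    pose proof (lnS_ge0 k) as Hk0. pose proof (pos_INR A) as HA0.
    set (N := (lnS M - lnS (M - k))%R) in *. assert (HN0 : (0 <= N)%R) by (unfold N; lra).
    assert (KL' : (Cmod (reg_log A M (natC k)) <= 4 * INR A + 2)%R).
    { eapply Rle_trans; [exact KL|]. rewrite <- (Rmult_1_r (4 * INR A + 2)) at 2.
      apply Rmult_le_compat_l; [lra|]. rewrite <- Rinv_1.
      assert (INR k + 1 <= INR (S M))%R by (rewrite <- S_INR; apply le_INR; lia).
      apply Rinv_le_contravar; lra. }
    assert (KK : (Cmod (Lam M U V W X k + reg_log A M (natC k)) <= c * (1 + lnS k + N))%R).
    { eapply Rle_trans; [apply Cmod_triangle|]. unfold c. nra. }
    eapply Rle_trans.
    { apply Rmult_le_compat; [apply Rmult_le_pos; apply Cmod_ge_0|apply Cmod_ge_0| |exact KK].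
      apply Rmult_le_compat; [apply Cmod_ge_0|apply Cmod_ge_0|exact K|exact K']. }
    match goal with |- (B * exp ?a * (B' * exp ?b) * _ <= _)%R =>
      replace (B * exp a * (B' * exp b) * (c * (1 + lnS k + N)))%R
        with (B * B' * c * (exp (a + b) * (1 + lnS k + N)))%R by (rewrite exp_plus; ring) end.
    rewrite (Rmult_assoc _ cs). apply Rmult_le_compat_l.
    { repeat apply Rmult_le_pos; lra. }
    apply Rle_trans with (exp ((-1 - s) * lnS k + - N) * (1 + lnS k + N))%R.
    { apply Rmult_le_compat_r; [lra|]. apply exp_le_mono. fold N.
      assert (INR A0 + 1 <= INR A)%R by (rewrite <- S_INR; now apply le_INR). nra. }
    rewrite exp_plus.
    replace ((-1 - s) * lnS k)%R with ((-1 - s / 2) * lnS k + - (s / 2 * lnS k))%R by field.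
    rewrite exp_plus.
    pose proof (exp_pos ((-1 - s / 2) * lnS k)) as E0.
    assert (HsL : (0 <= s / 2 * lnS k)%R) by nra.
    set (x := (s / 2 * lnS k)%R) in *.
    replace (lnS k) with (2 / s * x)%R by (unfold x; field; lra).
    pose proof (x_exp_le x HsL) as X1. pose proof (x_exp_le N HN0) as X2.
    assert (X3 : (exp (- x) <= 1)%R) by (rewrite <- exp_0; apply exp_le_mono; lra).
    assert (X4 : (exp (- N) <= 1)%R) by (rewrite <- exp_0; apply exp_le_mono; lra).
    pose proof (exp_pos (- x)) as P1. pose proof (exp_pos (- N)) as P2.
    assert (Hq : (0 < 2 / s)%R) by (apply Rdiv_lt_0_compat; lra).
    assert (T : (exp (- x) * exp (- N) * (1 + 2 / s * x + N) <= cs)%R).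
    { replace (exp (- x) * exp (- N) * (1 + 2 / s * x + N))%R with
        (exp (- x) * exp (- N) + 2 / s * ((x * exp (- x)) * exp (- N)) + exp (- x) * (N * exp (- N)))%R by ring.
      assert (exp (- x) * exp (- N) <= 1 * 1)%R by (apply Rmult_le_compat; lra).
      assert ((x * exp (- x)) * exp (- N) <= 1 * 1)%R by (apply Rmult_le_compat; nra).
      assert (exp (- x) * (N * exp (- N)) <= 1 * 1)%R by (apply Rmult_le_compat; nra).
      unfold cs. nra. }
    replace ((-1 - s / 2) * (2 / s * x))%R with ((-1 - s / 2) * lnS k)%R by (unfold x; field; lra).
    rewrite Rmult_assoc, Rmult_assoc.
    apply Rle_trans with (exp ((-1 - s / 2) * lnS k) * cs)%R; [|lra].
    apply Rmult_le_compat_l; [lra|]. rewrite <- Rmult_assoc. exact T.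
  - apply (ex_series_scal (V := R_NormedModule) (B * B' * c * cs)%R). apply p_series. lra.
  - exists (l / regulator A 0). split.
    + apply ccv_csum_scal_inv; [apply regulator_0_neq_0|].
      eapply ccv_ext; [|exact H1]. intros n. apply csum_ext. intros k _. ring.
    + replace (l / regulator A 0 * regulator A 0) with l by (field; apply regulator_0_neq_0). exact H2.
Qed.

(* On the scale N >= M, shifting each of the M factors by c costs a bounded factor. *)
Lemma cprod_perturb_le (M : nat) (f g : nat -> C) (c N : R) : (0 <= c)%R -> (0 < N)%R -> (INR M <= N)%R ->
  (forall j, (j < M)%nat -> (N <= Cmod (g j))%R /\ (Cmod (f j) <= Cmod (g j) + c)%R) ->
  (Cmod (cprod M f) <= exp c * Cmod (cprod M g))%R.
Proof.
  intros Hc HN HM H.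
  assert (K : (Cmod (cprod M f) <= exp (INR M * (c / N)) * Cmod (cprod M g))%R).
  { clear HM. induction M as [|M IH].
    - simpl. rewrite Cmod_1, Rmult_0_l, exp_0. lra.
    - simpl cprod. rewrite !Cmod_mult, S_INR, Rmult_plus_distr_r, exp_plus, Rmult_1_l.
      destruct (H M ltac:(lia)) as [H1 H2].
      replace (exp (INR M * (c / N)) * exp (c / N) * (Cmod (cprod M g) * Cmod (g M)))%R
        with ((exp (INR M * (c / N)) * Cmod (cprod M g)) * (exp (c / N) * Cmod (g M)))%R by ring.
      apply Rmult_le_compat; try apply Cmod_ge_0; [apply IH; intros; apply H; lia|].
      pose proof (exp_ineq1_le (c / N)).
      assert (c <= c / N * Cmod (g M))%R.
      { assert (0 <= c / N)%R by (apply Rdiv_le_0_compat; lra).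
        apply Rle_trans with (c / N * N)%R; [right; field; lra|]. apply Rmult_le_compat_l; lra. }
      pose proof (Cmod_ge_0 (g M)). nra. }
  eapply Rle_trans; [exact K|]. apply Rmult_le_compat_r; [apply Cmod_ge_0|]. apply exp_le_mono.
  apply Rle_trans with (N * (c / N))%R; [|right; field; lra].
  apply Rmult_le_compat_r; [apply Rdiv_le_0_compat; lra|exact HM].
Qed.

(** The exponent 2c comes from 1 <= (1 - q)(1 + 2q) for 0 <= q = c/N <= 1/2, applied at most N
    times. *)
Lemma cprod_perturb_ge (M : nat) (f g : nat -> C) (c N : R) : (0 <= c)%R -> (0 < N)%R -> (INR M <= N)%R ->
  (2 * c <= N)%R ->
  (forall j, (j < M)%nat -> (N <= Cmod (g j))%R /\ (Cmod (g j) - c <= Cmod (f j))%R) ->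
  (exp (- (2 * c)) * Cmod (cprod M g) <= Cmod (cprod M f))%R.
Proof.
  intros Hc HN HM HcN H.
  assert (K : (Cmod (cprod M g) <= exp (2 * c) * Cmod (cprod M f))%R).
  {
    assert (Hq : (0 <= c / N <= / 2)%R).
    { split; [apply Rdiv_le_0_compat; lra|]. apply Rmult_le_reg_r with N; [lra|].
      unfold Rdiv. rewrite Rmult_assoc, Rinv_l by lra. lra. }
    assert (K : (Cmod (cprod M g) <= exp (INR M * (2 * (c / N))) * Cmod (cprod M f))%R).
    { clear HM. induction M as [|M IH].
      - simpl. rewrite Cmod_1, Rmult_0_l, exp_0. lra.
      - simpl cprod. rewrite !Cmod_mult, S_INR, Rmult_plus_distr_r, exp_plus, Rmult_1_l.
        destruct (H M ltac:(lia)) as [H1 H2]. set (q := (c / N)%R) in *.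
        replace (exp (INR M * (2 * q)) * exp (2 * q) * (Cmod (cprod M f) * Cmod (f M)))%R
          with ((exp (INR M * (2 * q)) * Cmod (cprod M f)) * (exp (2 * q) * Cmod (f M)))%R by ring.
        apply Rmult_le_compat; try apply Cmod_ge_0; [apply IH; intros; apply H; lia|].
        pose proof (exp_ineq1_le (2 * q)).
        assert (c <= q * Cmod (g M))%R.
        { apply Rle_trans with (q * N)%R; [right; unfold q; field; lra|]. apply Rmult_le_compat_l; lra. }
        pose proof (Cmod_ge_0 (g M)).
        assert (G1 : ((1 - q) * Cmod (g M) <= Cmod (f M))%R) by lra.
        assert (G2 : (Cmod (g M) <= (1 + 2 * q) * ((1 - q) * Cmod (g M)))%R) by nra.
        assert (G3 : ((1 + 2 * q) * ((1 - q) * Cmod (g M)) <= exp (2 * q) * Cmod (f M))%R).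
        { apply Rmult_le_compat; nra. }
        lra. }
    eapply Rle_trans; [exact K|]. apply Rmult_le_compat_r; [apply Cmod_ge_0|]. apply exp_le_mono.
    apply Rle_trans with (N * (2 * (c / N)))%R; [|right; field; lra].
    apply Rmult_le_compat_r; lra. }
  apply Rmult_le_reg_l with (exp (2 * c)); [apply exp_pos|].
  rewrite <- Rmult_assoc, <- exp_plus, Rplus_opp_r, exp_0, Rmult_1_l. exact K.
Qed.

(** * Residues at the poles of the regulator *)

Lemma Cmod_pun_ge (y : C) : (Cmod y <= Cmod (pun y))%R.
Proof.
  unfold pun. destruct (Ceq_dec y 0) as [->|]; [rewrite Cmod_0; apply Cmod_ge_0|lra].
Qed.

Lemma Cmod_bound_list (l : list C) : exists c, (0 <= c)%R /\ forall y, In y l -> (Cmod y <= c)%R.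
Proof.
  induction l as [|x l [c [Hc H]]].
  - exists 0%R. split; [lra|intros y []].
  - pose proof (Cmod_ge_0 x). exists (Cmod x + c)%R. split; [lra|]. intros y [<-|Hy]; [lra|].
    specialize (H y Hy). lra.
Qed.

Lemma Cmod_imag (a b : R) : Cmod (Ci * RtoC a + RtoC b) = sqrt (b ^ 2 + a ^ 2).
Proof.
  unfold Cmod. f_equal. unfold Ci, RtoC, Cplus, Cmult. cbn [fst snd]. ring.
Qed.

Lemma Cmod_imag_sym (a b : R) : Cmod (Ci * RtoC a - RtoC b) = Cmod (Ci * RtoC a + RtoC b).
Proof.
  replace (Ci * RtoC a - RtoC b) with (Ci * RtoC a + RtoC (- b)) by (rewrite RtoC_opp; ring).
  rewrite !Cmod_imag. f_equal. ring.
Qed.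

Lemma Cmod_cprod_eq (M : nat) (f g : nat -> C) :
  (forall j, Cmod (f j) = Cmod (g j)) -> Cmod (cprod M f) = Cmod (cprod M g).
Proof. intros H. induction M as [|M IH]; simpl; [easy|]. now rewrite !Cmod_mult, IH, H. Qed.

Lemma Cmod_cprod_ge (M : nat) (f : nat -> C) (c : R) : (0 <= c)%R ->
  (forall j, (c <= Cmod (f j))%R) -> (c ^ M <= Cmod (cprod M f))%R.
Proof.
  intros Hc H. induction M as [|M IH]; simpl; [rewrite Cmod_1; lra|].
  rewrite Cmod_mult, Rmult_comm. apply Rmult_le_compat; auto. now apply pow_le.
Qed.

Lemma fact_le_pow (M : nat) : (INR (fact M) <= INR (S M) ^ M)%R.
Proof.
  assert (H : forall k, (k <= M)%nat -> (INR (fact k) <= INR (S M) ^ k)%R).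
  { induction k as [|k IH]; intros Hk; [simpl; lra|].
    rewrite fact_simpl, mult_INR. change (INR (S M) ^ S k)%R with (INR (S M) * INR (S M) ^ k)%R. apply Rmult_le_compat; try apply pos_INR.
    - apply le_INR. lia.
    - apply IH. lia. }
  now apply H.
Qed.

Lemma NoDup_xhat (A : nat) : NoDup (xhat A).
Proof.
  unfold xhat. apply FinFun.Injective_map_NoDup; [|apply seq_NoDup].
  intros i j E. apply (f_equal Im) in E. unfold Im, RtoC, Ci, Cmult in E. cbn [fst snd] in E.
  ring_simplify in E. apply INR_eq in E. congruence.
Qed.

Lemma xhat_separation (A M : nat) (x : C) : In x (xhat A) ->
  (INR (S M) ^ (2 * A + 1) <= Cmod (vprod (map (fun x' => pun (x * natC (S M) - x' * natC (S M))) (xhat A))))%R.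
Proof.
  intros Hx. set (N := INR (S M)). assert (HN : (1 <= N)%R) by apply INR_S_ge1.
  assert (H : (N ^ length (xhat A) <= Cmod (vprod (map (fun x' => (pun (x * RtoC N - x' * RtoC N) * (if Ceq_dec x' x then RtoC N else RtoC 1))%C) (xhat A))))%R).
  { apply Cmod_vprod_ge; [lra|]. intros x' Hx'. rewrite Cmod_mult. destruct (Ceq_dec x' x) as [->|Hne].
    - replace (x * RtoC N - x * RtoC N) with (RtoC 0) by ring. rewrite pun_0, Cmod_1, Cmod_R, Rabs_pos_eq; lra.
    - rewrite Cmod_1, Rmult_1_r. eapply Rle_trans; [|apply Cmod_pun_ge].
      apply in_xhat in Hx. apply in_xhat in Hx'. destruct Hx as [l ->], Hx' as [l' ->].
      eapply Rle_trans; [|apply im_le_Cmod].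
      replace (Im (Ci * natC (S l) * RtoC N - Ci * natC (S l') * RtoC N))
        with ((INR (S l) - INR (S l')) * N)%R
        by (unfold Im, RtoC, Ci, Cminus, Cplus, Copp, Cmult; cbn [fst snd]; ring).
      rewrite Rabs_mult, (Rabs_pos_eq N) by lra.
      assert (1 <= Rabs (INR (S l) - INR (S l')))%R; [|nra].
      assert (Hll : l <> l') by (intros ->; now apply Hne).
      destruct (Nat.lt_total l l') as [H|[H|H]]; [|contradiction|].
      + rewrite Rabs_left1; [|assert (INR (S l) <= INR (S l'))%R by (apply le_INR; lia); lra].
        assert (INR (S (S l)) <= INR (S l'))%R by (apply le_INR; lia). rewrite (S_INR (S l)) in *. lra.
      + rewrite Rabs_pos_eq; [|assert (INR (S l') <= INR (S l))%R by (apply le_INR; lia); lra].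
        assert (INR (S (S l')) <= INR (S l))%R by (apply le_INR; lia). rewrite (S_INR (S l')) in *. lra. }
  rewrite vprod_mult, vprod_indicator, Cmod_mult, Cmod_R, Rabs_pos_eq, length_xhat in H
    by (try lra; auto using NoDup_xhat).
  replace (2 * A + 2)%nat with (S (2 * A + 1)) in H by lia. simpl pow in H at 1.
  apply Rmult_le_reg_l with N; [lra|]. rewrite (Rmult_comm N (Cmod _)). exact H.
Qed.

(** At a point e of the imaginary axis |e + j| = |e - j|, so every product over a grid is comparable
    with one number D, whatever its direction. Numerator and denominator leave D^(-2m), which M! <=
    D compensates; the regulator contributes (M+1)^(2A) against (M+1)^(2A+1). *)
Lemma extra_value_upper (A : nat) (U V' W X : list C) (m : nat) :
  length U = (length W + m)%nat -> (2 + length V' = length X + m)%nat ->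
  exists (M0 : nat) (B : R), (0 < B)%R /\ forall M x, (M0 <= M)%nat -> In x (xhat A) ->
  (INR (fact M) ^ (2 * m) * INR (S M) * Cmod (punctured_value (zeros M A W X) (poles M A U V') (x * natC (S M))) <= B)%R.
Proof.
  intros HlU HlV. destruct (Cmod_bound_list (U ++ V' ++ W ++ X)) as [c [Hc Hbnd]].
  destruct (nat_above (2 * c)) as [M0 HM0].
  set (a := (length W + length X)%nat).
  set (d := (length U + length V' + 2)%nat). assert (Hd : d = (a + 2 * m)%nat) by (unfold d, a; lia).
  set (E := exp c). set (F := exp (- (2 * c))).
  assert (HE : (0 < E)%R) by apply exp_pos. assert (HF : (0 < F)%R) by apply exp_pos.
  exists M0, (E ^ a * (2 * INR A + 4) ^ (2 * A) * / F ^ d)%R.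
  pose proof (pos_INR A) as HA.
  split.
  { repeat apply Rmult_lt_0_compat; try (apply pow_lt; lra). apply Rinv_0_lt_compat, pow_lt, HF. }
  intros M x HM Hx. specialize (HM0 M HM).
  set (N := INR (S M)). assert (HN : (1 <= N)%R) by apply INR_S_ge1.
  assert (HMN : (INR M <= N)%R) by (apply le_INR; lia).
  assert (HcN : (2 * c <= N)%R) by lra.
  pose proof (xhat_separation A M x Hx) as Hsep. fold N in Hsep.
  apply in_map_iff in Hx. destruct Hx as [l [<- Hl]]. apply in_seq in Hl.
  set (e := Ci * natC (S l) * RtoC N) in *.
  assert (He : e = Ci * RtoC (INR (S l) * N)) by (unfold e; rewrite RtoC_mult; ring).
  set (D := Cmod (cprod M (fun j => e + natC j))).
  assert (Hfar : forall j, (N <= Cmod (e + natC j))%R).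
  { intros j. rewrite He, Cmod_imag. pose proof (INR_S_ge1 l).
    rewrite <- (sqrt_pow2 N) at 1 by lra. apply sqrt_le_1_alt.
    pose proof (pow2_ge_0 (INR j)).
    assert (N ^ 2 <= (INR (S l) * N) ^ 2)%R by (apply pow_incr; nra). lra. }
  assert (Hfar' : forall j, Cmod (e - natC j) = Cmod (e + natC j)).
  { intros j. rewrite He. apply Cmod_imag_sym. }
  assert (HD' : Cmod (cprod M (fun j => e - natC j)) = D) by (apply Cmod_cprod_eq; exact Hfar').
  assert (HDN : (N ^ M <= D)%R) by (apply Cmod_cprod_ge; [lra|exact Hfar]).
  assert (HD : (0 < D)%R) by (eapply Rlt_le_trans; [|exact HDN]; apply pow_lt; lra).
  assert (HfD : (INR (fact M) <= D)%R) by (eapply Rle_trans; [apply fact_le_pow|exact HDN]).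
  rewrite punctured_value_at.
  assert (Hnum : (Cmod (num_at M A W X e) <= (E * D) ^ a * ((2 * INR A + 4) * N) ^ (2 * A))%R).
  { unfold num_at. fold N. rewrite !Cmod_mult. unfold a. rewrite pow_add.
    apply Rmult_le_compat; [apply Rmult_le_pos; apply Cmod_ge_0|apply Cmod_ge_0| |].
    - apply Rmult_le_compat; try apply Cmod_ge_0.
      + apply Cmod_vprod_le; [nra|]. intros w Hw.
        apply cprod_perturb_le with N; auto; [lra|]. intros j _. split; [apply Hfar|].
        replace (e - (- w - natC j)) with ((e + natC j) + w) by ring.
        eapply Rle_trans; [apply Cmod_triangle|].
        assert (Cmod w <= c)%R by (apply Hbnd; rewrite !in_app_iff; tauto). lra.
      + apply Cmod_vprod_le; [nra|]. intros y Hy. rewrite <- HD'.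
        apply cprod_perturb_le with N; auto; [lra|]. intros j _. split; [rewrite Hfar'; apply Hfar|].
        replace (e - (y + natC j)) with ((e - natC j) - y) by ring.
        eapply Rle_trans; [apply Cmod_minus_le|].
        assert (Cmod y <= c)%R by (apply Hbnd; rewrite !in_app_iff; tauto). lra.
    - rewrite <- length_nhat. apply Cmod_vprod_le; [nra|]. intros n Hn.
      eapply Rle_trans; [apply Cmod_minus_le|].
      assert (Hn1 : Cmod n = 1%R).
      { unfold nhat in Hn. apply in_app_or in Hn. destruct Hn as [Hn|Hn]; apply repeat_spec in Hn; subst n.
        - apply Cmod_1.
        - rewrite Cmod_R, Rabs_left; lra. }
      pose proof (INR_S_ge1 l) as Hl1. assert (Hl2 : (0 <= INR (S l) * N)%R) by nra.
      rewrite He, !Cmod_mult, Hn1, Cmod_Ci, !Cmod_R. rewrite (Rabs_pos_eq (INR (S l) * N)), (Rabs_pos_eq N) by lra.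
      assert (INR (S l) <= INR (2 * A + 2))%R by (apply le_INR; lia).
      rewrite plus_INR, mult_INR in H. simpl (INR 2) in H. nra. }
  assert (Hden : ((F * D) ^ d * N ^ (2 * A + 1) <= Cmod (den_at M A U V' e))%R).
  { assert (HFD : (0 <= F * D)%R) by nra.
    assert (Hlow : forall y, (Cmod y <= c)%R ->
       (F * D <= Cmod (cprod M (fun j => pun (e - (y + natC j)))))%R).
    { intros y Hy. rewrite <- HD'. apply cprod_perturb_ge with N; auto; [lra|]. intros j _.
      split; [rewrite Hfar'; apply Hfar|]. eapply Rle_trans; [|apply Cmod_pun_ge].
      replace (e - (y + natC j)) with ((e - natC j) - y) by ring.
      pose proof (Cmod_triangle_minus (e - natC j) y). lra. }
    unfold den_at. fold N. rewrite !Cmod_mult.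
    replace ((F * D) ^ d * N ^ (2 * A + 1))%R with
      ((F * D) ^ length U * (F * D) ^ length V' * N ^ (2 * A + 1) * ((F * D) * (F * D)))%R
      by (unfold d; rewrite !pow_add; simpl; ring).
    assert (P1 : forall n, (0 <= (F * D) ^ n)%R) by (intros; now apply pow_le).
    assert (P2 : (0 <= N ^ (2 * A + 1))%R) by (apply pow_le; lra).
    apply Rmult_le_compat; [repeat apply Rmult_le_pos; auto|nra| |].
    - apply Rmult_le_compat; [repeat apply Rmult_le_pos; auto|auto| |exact Hsep].
      apply Rmult_le_compat; auto.
      + apply Cmod_vprod_ge; auto. intros u Hu.
        apply cprod_perturb_ge with N; auto; [lra|]. intros j _.
        split; [apply Hfar|]. eapply Rle_trans; [|apply Cmod_pun_ge].
        replace (e - (- u - natC j)) with ((e + natC j) - - u) by ring.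
        pose proof (Cmod_triangle_minus (e + natC j) (- u)) as T. rewrite Cmod_opp in T.
        assert (Cmod u <= c)%R by (apply Hbnd; rewrite !in_app_iff; tauto). lra.
      + apply Cmod_vprod_ge; auto. intros v Hv. apply Hlow. apply Hbnd. rewrite !in_app_iff. tauto.
    - assert (L0 : (F * D <= Cmod (cprod M (fun j => pun (e - natC j))))%R).
      { specialize (Hlow 0 ltac:(rewrite Cmod_0; lra)). eapply Rle_trans; [exact Hlow|].
        right. f_equal. apply cprod_ext. intros j _. f_equal. ring. }
      apply Rmult_le_compat; auto. }
  assert (HFDp : (0 < (F * D) ^ d * N ^ (2 * A + 1))%R).
  { apply Rmult_lt_0_compat; apply pow_lt; nra. }
  rewrite Cmod_div by (apply Cmod_gt_0; lra).
  set (nu := Cmod (num_at M A W X e)) in *. set (de := Cmod (den_at M A U V' e)) in *.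
  assert (Hq : (nu / de <= ((E * D) ^ a * ((2 * INR A + 4) * N) ^ (2 * A)) / ((F * D) ^ d * N ^ (2 * A + 1)))%R).
  { unfold Rdiv. apply Rmult_le_compat; [apply Cmod_ge_0| |exact Hnum|apply Rinv_le_contravar; lra].
    left. apply Rinv_0_lt_compat. lra. }
  assert (Hf2 : (INR (fact M) ^ (2 * m) <= D ^ (2 * m))%R).
  { apply pow_incr. split; [apply pos_INR|exact HfD]. }
  apply Rle_trans with (D ^ (2 * m) * N * (((E * D) ^ a * ((2 * INR A + 4) * N) ^ (2 * A)) / ((F * D) ^ d * N ^ (2 * A + 1))))%R.
  - assert (0 <= nu / de)%R.
    { apply Rdiv_le_0_compat; [apply Cmod_ge_0|lra]. }
    apply Rmult_le_compat; auto.
    + apply Rmult_le_pos; [apply pow_le, pos_INR|lra].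
    + apply Rmult_le_compat_r; lra.
  - right. rewrite Hd, !Rpow_mult_distr, !pow_add, pow_1. field.
    repeat split; try (apply pow_nonzero; lra); lra.
Qed.

Lemma exp_lnS_lim (s : R) : (0 < s)%R -> is_lim_seq (fun M => exp (- s * lnS M)) 0%R.
Proof.
  intros Hs. apply is_lim_seq_spec. intros eps. pose proof (cond_pos eps) as He.
  destruct (nat_above (exp (- ln eps / s))) as [N HN]. exists N. intros n Hn. specialize (HN n Hn).
  rewrite Rminus_0_r, Rabs_pos_eq by (left; apply exp_pos).
  rewrite <- (exp_ln eps) by exact He. apply exp_increasing.
  assert (H : (- ln eps / s < lnS n)%R).
  { rewrite <- (ln_exp (- ln eps / s)). apply ln_increasing; [apply exp_pos|]. rewrite S_INR. lra. }
  apply (Rmult_lt_compat_l s) in H; [|exact Hs].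
  replace (s * (- ln eps / s))%R with (- ln eps)%R in H by (field; lra). lra.
Qed.

(** The powers of M + 1 are -m-1-s from [scaling], 2 from the prefactor and -1 from
    [extra_value_upper]; the total -m-s is at most -s. *)
Lemma extra_cv (A : nat) (U V' W X : list C) (m : nat) (s : R) :
  length U = (length W + m)%nat -> (2 + length V' = length X + m)%nat ->
  Re (vsum U + vsum V' - vsum W - vsum X) = (INR m - 1 - s)%R -> (0 < s)%R ->
  ccv (fun M => extra_residues M A U V' W X m) 0.
Proof.
  intros HlU HlV Hsum Hs. destruct (extra_value_upper A U V' W X m HlU HlV) as [M0 [B [HB K]]].
  apply (ccv_squeeze _ _ (fun M => (2 * INR A + 2) * B * exp (- s * lnS M))%R M0).
  - intros M HM. set (N := INR (S M)). assert (HN : (1 <= N)%R) by apply INR_S_ge1.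
    replace (extra_residues M A U V' W X m - 0) with (extra_residues M A U V' W X m) by ring.
    unfold extra_residues, scaling. fold N. rewrite !Cmod_mult, !Cmod_pow, Cmod_Cnatpow.
    assert (Hsg : Cmod (sgn M X V') = 1%R).
    { unfold sgn. rewrite Cmod_mult, !Cmod_pow. replace (Cmod (-1)) with 1%R by (rewrite Cmod_R, Rabs_left; lra).
      rewrite !pow1. lra. }
    rewrite Hsg, !Cmod_R, (Rabs_pos_eq N), (Rabs_pos_eq (INR (fact M))) by (try lra; apply pos_INR).
    assert (HR : Re (vsum U + vsum (RtoC 0 :: RtoC 0 :: V') - vsum W - vsum X - 2 * natC m) = (- INR m - 1 - s)%R).
    { rewrite !vsum_cons. rewrite !Re_minus, !Re_plus in *. rewrite !Re_RtoC.
      replace (Re (2 * natC m)) with (2 * INR m)%R by (unfold Re, RtoC, Cmult; simpl; ring). lra. }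
    rewrite HR.
    pose proof (Cmod_vsum_le (fun x => punctured_value (zeros M A W X) (poles M A U V') (x * RtoC N)) (xhat A)
      (B / (INR (fact M) ^ (2 * m) * N)))%R as HV.
    assert (HfN : (0 < INR (fact M) ^ (2 * m) * N)%R).
    { apply Rmult_lt_0_compat; [apply pow_lt, lt_0_INR, lt_O_fact|lra]. }
    assert (HV' : forall x, In x (xhat A) ->
       (Cmod (punctured_value (zeros M A W X) (poles M A U V') (x * RtoC N)) <= B / (INR (fact M) ^ (2 * m) * N))%R).
    { intros x Hx. specialize (K M x HM Hx). fold N in K.
      apply Rmult_le_reg_l with (INR (fact M) ^ (2 * m) * N)%R; [exact HfN|].
      eapply Rle_trans; [exact K|]. right. field. split; [lra|].
      apply pow_nonzero. apply Rgt_not_eq, lt_0_INR, lt_O_fact. }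
    specialize (HV HV'). rewrite length_xhat, plus_INR, mult_INR in HV. simpl (INR 2) in HV.
    replace ((1 + 1) * INR A + (1 + 1))%R with (2 * INR A + 2)%R in HV by ring.
    eapply Rle_trans.
    { apply Rmult_le_compat_l; [|exact HV].
      pose proof (exp_pos ((- INR m - 1 - s) * lnS M)).
      assert (0 < INR (fact M) ^ m)%R by (apply pow_lt, lt_0_INR, lt_O_fact).
      assert (0 < N ^ 2)%R by (apply pow_lt; lra).
      left. repeat apply Rmult_lt_0_compat; lra. }
    set (f := (INR (fact M) ^ m)%R). assert (Hf : (0 < f)%R) by (apply pow_lt, lt_0_INR, lt_O_fact).
    replace (INR (fact M) ^ (2 * m))%R with (f * f)%R
      by (unfold f; rewrite <- pow_add; f_equal; lia).
    replace (f * f * exp ((- INR m - 1 - s) * lnS M) * 1 * N ^ 2 * ((2 * INR A + 2) * (B / (f * f * N))))%R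
      with ((2 * INR A + 2) * B * (exp ((- INR m - 1 - s) * lnS M) * N))%R by (field; lra).
    apply Rmult_le_compat_l; [pose proof (pos_INR A); apply Rmult_le_pos; lra|].
    unfold N. rewrite <- (exp_lnS M), <- exp_plus. apply exp_le_mono.
    pose proof (pos_INR m). pose proof (lnS_ge0 M). nra.
  - replace (Finite 0) with (Rbar_mult ((2 * INR A + 2) * B)%R 0%R) by (simpl; f_equal; ring).
    apply (is_lim_seq_scal_l (fun M => exp (- s * lnS M)) ((2 * INR A + 2) * B)%R 0%R).
    now apply exp_lnS_lim.
Qed.

Lemma uniform_nat {A : Type} (P : A -> nat -> Prop) (l : list A) :
  (forall x, In x l -> exists n0, forall n, (n0 <= n)%nat -> P x n) ->
  exists n0, forall n, (n0 <= n)%nat -> forall x, In x l -> P x n.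
Proof.
  induction l as [|x l IH]; intros H.
  - exists O. intros n _ x [].
  - destruct (H x (or_introl eq_refl)) as [n1 H1].
    destruct IH as [n2 H2]; [intros; apply H; now right|].
    exists (max n1 n2). intros n Hn y [<-|Hy]; [apply H1; lia|apply H2; auto; lia].
Qed.

(** One A above the thresholds of all families is fixed; then every limit carries the same nonzero
    factor [regulator A 0], which divides out. The sum S0 does not enter the relation; it is
    provided to split the cotangents off the double-pole series later. *)
Theorem sum_of_residues (U V' W X : list C) (m : nat) :
  let V := RtoC 0 :: RtoC 0 :: V' in
  length U = (length W + m)%nat -> (2 + length V' = length X + m)%nat ->
  (Re (vsum U + vsum V' - vsum W - vsum X) < INR m - 1)%R ->
  generic U -> generic (RtoC 0 :: V') ->
  (forall u v, In u U -> In v (RtoC 0 :: V') -> notpole (u + v)) ->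
  (forall w v, In w W -> In v (RtoC 0 :: V') -> notpole (w + v)) ->
  (forall x u, In x X -> In u U -> notpole (x + u)) ->
  (forall x, In x X -> nonint x) ->
  exists S0 Sd : C, exists SU SV : C -> C,
    ccv (fun n => csum n (term_lim U V W X 0)) S0 /\
    ccv (fun n => csum n (fun k => term_lim U V W X 0 k * Lam_lim U V W X k)) Sd /\
    (forall u, In u U -> ccv (fun n => csum n (term_lim V U X W u)) (SU u)) /\
    (forall v, In v V' -> ccv (fun n => csum n (term_lim U V W X v)) (SV v)) /\
    Sd + vsum (map SU U) - vsum (map SV V') = 0.
Proof.
  intros V HlU HlV Hre HU HV HUV HWV HXU HX.
  set (s := (INR m - 1 - Re (vsum U + vsum V' - vsum W - vsum X))%R).
  assert (Hs : (0 < s)%R) by (unfold s; lra).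
  assert (HsV' : Re (vsum U + vsum V' - vsum W - vsum X) = (INR m - 1 - s)%R) by (unfold s; lra).
  assert (EV : vsum V = vsum V') by (unfold V; rewrite !vsum_cons; ring).
  assert (HsV : Re (vsum U + vsum V - vsum W - vsum X) = (INR m - 1 - s)%R) by (rewrite EV; exact HsV').
  assert (HsV2 : Re (vsum V + vsum U - vsum X - vsum W) = (INR m - 1 - s)%R).
  { rewrite <- HsV. f_equal. ring. }
  assert (HlVV : length V = (length X + m)%nat) by exact HlV.
  assert (HVin : forall v, In v V -> In v (RtoC 0 :: V')).
  { intros v [Hv|Hv]; [now left|exact Hv]. }
  assert (HVV : forall v0 v, In v0 (RtoC 0 :: V') -> In v V -> v - v0 = 0 \/ nonint (v - v0)).
  { intros v0 v H0 Hv. destruct (Ceq_dec v v0) as [->|Hne]; [left; ring|]. right. apply HV; auto. }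
  assert (HUU : forall u0 u, In u0 U -> In u U -> u - u0 = 0 \/ nonint (u - u0)).
  { intros u0 u H0 Hv. destruct (Ceq_dec u u0) as [->|Hne]; [left; ring|]. right. apply HU; auto. }
  destruct (double_sum U V W X m s HlU HlVV HsV Hs) as [Ad KD].
  { intros u Hu. rewrite <- (Cplus_0_r u). apply HUV; auto. now left. }
  { intros w Hw. rewrite <- (Cplus_0_r w). apply HWV; auto. now left. }
  { intros v Hv. destruct (HVV 0 v) as [E|E]; auto; [now left| |].
    - left. rewrite <- E. ring.
    - right. replace v with (v - 0) by ring. exact E. }
  assert (FV : forall v0, In v0 (RtoC 0 :: V') -> exists A0 : nat, forall A, (A0 <= A)%nat -> forall sg : R, sg = 1%R \/ sg = (-1)%R ->
    exists l, ccv (fun n => csum n (term_lim U V W X v0)) l /\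
    ccv (fun M => csum M (fun k => term M U V W X v0 k
           * regulator A (RtoC sg * (v0 + natC k) / natC (S M)))) (l * regulator A 0)).
  { intros v0 H0. destruct (family_sum U V W X v0 m s HlU HlVV HsV Hs) as [A0 K]; auto. exists A0. auto. }
  assert (FU : forall u0, In u0 U -> exists A0 : nat, forall A, (A0 <= A)%nat -> forall sg : R, sg = 1%R \/ sg = (-1)%R ->
    exists l, ccv (fun n => csum n (term_lim V U X W u0)) l /\
    ccv (fun M => csum M (fun k => term M V U X W u0 k
           * regulator A (RtoC sg * (u0 + natC k) / natC (S M)))) (l * regulator A 0)).
  { intros u0 H0. destruct (family_sum V U X W u0 m s HlVV HlU HsV2 Hs) as [A0 K]; auto.
    - intros v Hv. rewrite Cplus_comm. auto.
    - exists A0. auto. }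
  destruct (uniform_nat _ _ FV) as [Av KV]. destruct (uniform_nat _ _ FU) as [Au KU].
  set (A := max Ad (max Av Au)).
  destruct (KD A ltac:(lia)) as [Sd [Sd1 Sd2]].
  specialize (KV A ltac:(lia)). specialize (KU A ltac:(lia)).
  set (SV := fun v => CSeries (term_lim U V W X v)). set (SU := fun u => CSeries (term_lim V U X W u)).
  assert (HSV : forall v0, In v0 (RtoC 0 :: V') -> ccv (fun n => csum n (term_lim U V W X v0)) (SV v0) /\
    ccv (fun M => csum M (fun k => term M U V W X v0 k
           * regulator A ((v0 + natC k) / natC (S M)))) (SV v0 * regulator A 0)).
  { intros v0 H0. destruct (KV v0 H0 1%R (or_introl eq_refl)) as [l [L1 L2]].
    unfold SV. rewrite (CSeries_ccv _ _ L1). split; [exact L1|].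
    eapply ccv_ext; [|exact L2]. intros M. apply csum_ext. intros k _. now rewrite Cmult_1_l. }
  assert (HSU : forall u0, In u0 U -> ccv (fun n => csum n (term_lim V U X W u0)) (SU u0) /\
    ccv (fun M => csum M (fun k => term M V U X W u0 k
           * regulator A ((- u0 - natC k) / natC (S M)))) (SU u0 * regulator A 0)).
  (* These poles lie at t = -(u + k), hence sg = -1. *)
  { intros v0 H0. destruct (KU v0 H0 (-1)%R (or_intror eq_refl)) as [l [L1 L2]].
    unfold SU. rewrite (CSeries_ccv _ _ L1). split; [exact L1|].
    eapply ccv_ext; [|exact L2]. intros M. apply csum_ext. intros k _. do 3 f_equal. ring. }
  exists (SV 0), Sd, SU, SV.
  split; [apply HSV; now left|]. split; [exact Sd1|].
  split; [intros; now apply HSU|]. split; [intros; apply HSV; now right|].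
  assert (Hlim : ccv (fun M =>
    csum M (fun k => term M U V W X 0 k * regulator A (natC k / natC (S M))
            * (Lam M U V W X k + reg_log A M (natC k)))
    + vsum (map (fun u => csum M (fun k => term M V U X W u k
              * regulator A ((- u - natC k) / natC (S M)))) U)
    - vsum (map (fun v => csum M (fun k => term M U V W X v k
              * regulator A ((v + natC k) / natC (S M)))) V')
    + extra_residues M A U V' W X m)
    (Sd * regulator A 0 + vsum (map (fun u => SU u * regulator A 0) U)
      - vsum (map (fun v => SV v * regulator A 0) V') + 0)).
  { apply ccv_plus; [apply ccv_minus; [apply ccv_plus|]|].
    - exact Sd2.
    - apply (vsum_cv (fun M u => csum M (fun k => term M V U X W u k
              * regulator A ((- u - natC k) / natC (S M))))). intros u Hu. now apply HSU.
    - apply (vsum_cv (fun M v => csum M (fun k => term M U V W X v k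
              * regulator A ((v + natC k) / natC (S M))))). intros v Hv. apply HSV. now right.
    - now apply extra_cv with s. }
  destruct (Cmod_bound_list (U ++ V')) as [c [Hc Hb]]. destruct (nat_above c) as [M0 HM0].
  assert (H0 : ccv (fun M =>
    csum M (fun k => term M U V W X 0 k * regulator A (natC k / natC (S M))
            * (Lam M U V W X k + reg_log A M (natC k)))
    + vsum (map (fun u => csum M (fun k => term M V U X W u k
              * regulator A ((- u - natC k) / natC (S M)))) U)
    - vsum (map (fun v => csum M (fun k => term M U V W X v k
              * regulator A ((v + natC k) / natC (S M)))) V')
    + extra_residues M A U V' W X m) 0).
  { apply ccv_ext_loc with (u := fun _ => RtoC 0) (N := M0); [|apply ccv_const].
    intros M HM. symmetry. apply finite_identity; auto.
    - intros y Hy. specialize (Hb y Hy). specialize (HM0 M HM). rewrite S_INR. lra.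
    - intros w Hw. rewrite <- (Cplus_0_r w). apply HWV; auto. now left. }
  pose proof (ccv_unique _ _ _ Hlim H0) as E.
  assert (ES : forall (f : C -> C) l, vsum (map (fun v => f v * regulator A 0) l) = regulator A 0 * vsum (map f l)).
  { intros f l. rewrite <- vsum_scal. apply vsum_ext. intros; ring. }
  rewrite !ES in E. pose proof (regulator_0_neq_0 A) as HR.
  transitivity ((Sd * regulator A 0 + regulator A 0 * vsum (map SU U) - regulator A 0 * vsum (map SV V') + 0) / regulator A 0).
  - field. exact HR.
  - rewrite E. unfold Cdiv. ring.
Qed.

(** * The hypergeometric identity *)

(** With / 0 = 0 this includes y = 0, which starts the induction in [psi_minus_nat]. *)
Lemma psi_S (y : C) : psi (y + 1) = psi y + / y.
Proof.
  assert (H : ccv (fun n => psin (S n) y) (psi (y + 1) + 0 - / y)).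
  { apply ccv_ext with (fun n => psin n (y + 1) + RtoC (lnS (S n) - lnS n) - / y).
    - intros n. unfold psin. rewrite <- (Nat.add_1_l n), (hsum_add y 1 n).
      unfold hsum at 2. simpl csum. rewrite Nat.add_1_l, RtoC_minus.
      replace (y + RtoC 0) with y by ring. simpl (INR 1). ring.
    - apply ccv_minus; [|apply ccv_const]. apply ccv_plus; [apply psi_cv|].
      apply ccv_RtoC. apply is_lim_seq_le_le with (fun _ => 0%R) (fun n => / INR (S n))%R.
      + intros n. destruct (lnS_gap n) as [H _]. exact H.
      + apply is_lim_seq_const.
      + apply inv_INR_lim. }
  pose proof (ccv_unique _ _ _ H (ccv_subseq (fun n => psin n y) _ S (fun n => ltac:(auto)) (psi_cv y))) as E.
  rewrite <- E. ring.
Qed.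

(** The regular part of digamma at its pole -k. It turns the contribution of the two zeros of V into
    digamma values at 1 + k. *)
Lemma psi_minus_nat (k : nat) : psi (0 - natC k) = psi (1 + natC k).
Proof.
  induction k as [|k IH].
  - simpl. replace (0 - 0) with (RtoC 0) by ring. replace (1 + 0) with (RtoC 0 + 1) by ring.
    rewrite psi_S, Cinv_0. ring.
  - pose proof (psi_S (0 - natC (S k))) as E1.
    pose proof (psi_S (1 + natC k)) as E2.
    replace (0 - natC (S k) + 1) with (0 - natC k) in E1 by (rewrite S_INR, RtoC_plus; ring).
    replace (1 + natC k + 1) with (1 + natC (S k)) in E2 by (rewrite S_INR, RtoC_plus; ring).
    rewrite E2, <- IH, E1.
    replace (0 - natC (S k)) with (- (1 + natC k)) at 3 by (rewrite S_INR, RtoC_plus; ring).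
    rewrite Cinv_opp. ring.
Qed.

(** The cotangent has period pi, so it does not see k; the recurrence [psi_S] on both sides replaces
    a proof of periodicity. *)
Lemma psi_reflection_shift (y : C) (k : nat) : nonint y ->
  psi (1 - y - natC k) = psi (y + natC k) + RtoC PI * Ccot (RtoC PI * y).
Proof.
  intros Hy. rewrite <- psi_reflection by exact Hy. induction k as [|k IH].
  - simpl. replace (1 - y - 0) with (1 - y) by ring. replace (y + 0) with y by ring. ring.
  - pose proof (psi_S (1 - y - natC (S k))) as E1. pose proof (psi_S (y + natC k)) as E2.
    replace (1 - y - natC (S k) + 1) with (1 - y - natC k) in E1 by (rewrite S_INR, RtoC_plus; ring).
    replace (y + natC k + 1) with (y + natC (S k)) in E2 by (rewrite S_INR, RtoC_plus; ring).
    replace (1 - y - natC (S k)) with (- (y + natC k)) in E1 at 2 by (rewrite S_INR, RtoC_plus; ring).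
    rewrite Cinv_opp in E1. rewrite E2.
    replace (psi (1 - y - natC (S k))) with (psi (1 - y - natC k) + / (y + natC k)) by (rewrite E1; ring).
    rewrite IH. ring.
Qed.

(** The part of [prG] independent of k; the value 1 is the derivative of 1/Gamma at 0. *)
Definition rGp (y : C) : C := if Ceq_dec y 0 then 1 else rG y.

(** This is [term_lim] at k = 0, the coefficient in front of a hypergeometric series. *)
Definition term_const (U V W X : list C) (v0 : C) : C :=
  vprod (map (fun w => rG (w + v0)) W) * vprod (map (fun x => rG (x - v0)) X)
  / (vprod (map (fun u => rG (u + v0)) U) * vprod (map (fun v => rGp (v - v0)) V)).

Lemma prG_form (y : C) (k : nat) : prG y k = (-1) ^ k * (poch (1 - y) k * rGp y).
Proof.
  unfold prG, rGp. destruct (Ceq_dec y 0) as [->|H].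
  - replace (poch (1 - 0) k) with (poch 1 k) by (f_equal; ring). rewrite poch_1_fact. ring.
  - rewrite rG_minus. ring.
Qed.

Lemma sign_square_pow (k n : nat) : ((-1) ^ k) ^ n * ((-1) ^ k) ^ n = 1.
Proof. rewrite <- !Cpow_mult_r. apply m1_pow_sq. Qed.

Lemma term_lim_form (U V W X : list C) (v0 : C) (k : nat) :
  (forall u, In u U -> notpole (u + v0)) ->
  (forall w, In w W -> notpole (w + v0)) ->
  (forall v, In v V -> v - v0 = 0 \/ nonint (v - v0)) ->
  term_lim U V W X v0 k = term_const U V W X v0
   * (((-1) ^ k) ^ length X * ((-1) ^ k) ^ length V
      * (vprod (map (fun u => poch (u + v0) k) U) * vprod (map (fun x => poch (1 - x + v0) k) X)
      / (vprod (map (fun w => poch (w + v0) k) W) * vprod (map (fun v => poch (1 - v + v0) k) V)))).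
Proof.
  intros HU HW HV. unfold term_lim, term_const.
  assert (EW : vprod (map (fun w => rG (w + v0)) W)
     = vprod (map (fun w => poch (w + v0) k) W) * vprod (map (fun w => rG (w + v0 + natC k)) W)).
  { rewrite <- vprod_mult. apply vprod_ext. intros w _. apply rG_poch. }
  assert (EU : vprod (map (fun w => rG (w + v0)) U)
     = vprod (map (fun w => poch (w + v0) k) U) * vprod (map (fun w => rG (w + v0 + natC k)) U)).
  { rewrite <- vprod_mult. apply vprod_ext. intros w _. apply rG_poch. }
  assert (EX : vprod (map (fun x => rG (x - v0 - natC k)) X)
     = ((-1) ^ k) ^ length X * (vprod (map (fun x => poch (1 - x + v0) k) X) * vprod (map (fun x => rG (x - v0)) X))).
  { rewrite <- vprod_const, <- !vprod_mult. apply vprod_ext. intros x _. rewrite rG_minus.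
    replace (1 - (x - v0)) with (1 - x + v0) by ring. ring. }
  assert (EV : vprod (map (fun v => prG (v - v0) k) V)
     = ((-1) ^ k) ^ length V * (vprod (map (fun x => poch (1 - x + v0) k) V) * vprod (map (fun x => rGp (x - v0)) V))).
  { rewrite <- vprod_const, <- !vprod_mult. apply vprod_ext. intros x _. rewrite prG_form.
    replace (1 - (x - v0)) with (1 - x + v0) by ring. ring. }
  rewrite EW, EU, EX, EV.
  assert (N1 : vprod (map (fun w => poch (w + v0) k) W) <> 0)
    by (apply vprod_neq_0; intros; apply poch_neq_0; auto).
  assert (N2 : vprod (map (fun w => poch (w + v0) k) U) <> 0)
    by (apply vprod_neq_0; intros; apply poch_neq_0; auto).
  assert (N3 : vprod (map (fun w => rG (w + v0 + natC k)) U) <> 0)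
    by (apply vprod_neq_0; intros; apply rG_neq_0, notpole_plus; auto).
  assert (N4 : vprod (map (fun x => poch (1 - x + v0) k) V) <> 0).
  { apply vprod_neq_0. intros v Hv. apply poch_neq_0. destruct (HV v Hv) as [E|E].
    - replace (1 - v + v0) with (1 - (v - v0)) by ring. rewrite E. intros j Ej.
      apply (f_equal Re) in Ej. unfold Re, RtoC, Cminus, Cplus, Copp in Ej. cbn [fst] in Ej.
      pose proof (pos_INR j). lra.
    - replace (1 - v + v0) with (1 - (v - v0)) by ring. now apply nonint_notpole, nonint_1_minus. }
  assert (N5 : vprod (map (fun x => rGp (x - v0)) V) <> 0).
  { apply vprod_neq_0. intros v Hv. unfold rGp. destruct (Ceq_dec (v - v0) 0) as [E|E]; [apply C1_nz|].
    destruct (HV v Hv) as [E'|E']; [contradiction|]. now apply rG_neq_0, nonint_notpole. }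
  assert (N6 : ((-1) ^ k) ^ length V <> 0) by (apply Cpow_nz, m1_pow_neq_0).
  pose proof (sign_square_pow k (length V)) as Hs.
  assert (S2 : ((-1) ^ k) ^ length V = / ((-1) ^ k) ^ length V).
  { rewrite <- (Cmult_1_r (((-1) ^ k) ^ length V)) at 1. rewrite <- (Cinv_r _ N6), Cmult_assoc, Hs. ring. }
  rewrite S2 at 2. field. repeat split; auto.
Qed.

Lemma m1_pow_even (N : nat) : (-1) ^ N = if Nat.even N then RtoC 1 else RtoC (-1).
Proof.
  induction N as [|N IH]; [reflexivity|]. rewrite Cpow_S, IH, Nat.even_succ, <- Nat.negb_even.
  destruct (Nat.even N); simpl; ring.
Qed.

Lemma sign_pow (i j N k : nat) (z : C) : Nat.even (i + j) = Nat.even N ->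
  z = (if Nat.even N then RtoC 1 else RtoC (-1)) ->
  ((-1) ^ k) ^ i * ((-1) ^ k) ^ j = z ^ k.
Proof.
  intros H ->. rewrite <- H, <- m1_pow_even, <- !Cpow_mult_r, <- Cpow_add_r. f_equal. lia.
Qed.

Lemma distinct_generic (l : list C) : distinct_modZ l -> generic l.
Proof.
  intros H. split.
  - apply (NoDup_nth l (RtoC 0)). intros i j Hi Hj E. destruct (Nat.eq_dec i j) as [|Hne]; [assumption|].
    exfalso. apply (H i j Hi Hj Hne 0%Z). rewrite E. ring.
  - intros x y Hx Hy Hne. apply (In_nth _ _ (RtoC 0)) in Hx, Hy.
    destruct Hx as [i [Hi <-]], Hy as [j [Hj <-]]. apply H; auto. intros ->. now apply Hne.
Qed.

Lemma vsum_nth (f : C -> C) (l : list C) : vsum (map f l) = csum (length l) (fun k => f (nth k l 0)).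
Proof.
  induction l as [|x l IH]; [reflexivity|]. simpl map. rewrite vsum_cons, IH.
  simpl length. rewrite <- (Nat.add_1_l (length l)), csum_add. simpl. ring.
Qed.

Lemma vprod_removeAt (f : C -> C) (i : nat) (l : list C) : (i < length l)%nat ->
  vprod (map f l) = f (nth i l 0) * vprod (map f (removeAt i l)).
Proof.
  revert i. induction l as [|x l IH]; intros i Hi; [simpl in Hi; lia|].
  destruct i as [|i].
  - unfold removeAt. simpl. reflexivity.
  - assert (E : removeAt (S i) (x :: l) = x :: removeAt i l) by reflexivity.
    rewrite E. simpl map. rewrite !vprod_cons. simpl nth. rewrite (IH i) by (simpl in Hi; lia). ring.
Qed.

Lemma in_removeAt (y : C) (i : nat) (l : list C) : In y (removeAt i l) -> In y l.
Proof.
  revert i. induction l as [|x l IH]; intros i H.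
  - unfold removeAt in H. rewrite firstn_nil, skipn_nil in H. exact H.
  - destruct i as [|i]; [now right|].
    assert (E : removeAt (S i) (x :: l) = x :: removeAt i l) by reflexivity.
    rewrite E in H. destruct H as [H|H]; [now left|]. right. now apply (IH i).
Qed.

Lemma nth_not_in_removeAt (i : nat) (l : list C) : (i < length l)%nat -> NoDup l ->
  ~ In (nth i l 0) (removeAt i l).
Proof.
  revert i. induction l as [|x l IH]; intros i Hi Hnd; [simpl in Hi; lia|].
  inversion Hnd; subst. destruct i as [|i]; [assumption|].
  assert (E : removeAt (S i) (x :: l) = x :: removeAt i l) by reflexivity.
  rewrite E. simpl nth. simpl in Hi. intros [H|H].
  - subst x. apply H1. apply nth_In. lia.
  - revert H. apply IH; auto. lia.
Qed.

Lemma removeAt_app_r (l m : list C) (k : nat) : removeAt (length l + k) (l ++ m) = l ++ removeAt k m.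
Proof.
  induction l as [|x l IH]; [reflexivity|].
  change (x :: removeAt (length l + k) (l ++ m) = x :: (l ++ removeAt k m)). now rewrite IH.
Qed.

Lemma removeAt_app_l (l m : list C) (k : nat) : (k < length l)%nat ->
  removeAt k (l ++ m) = removeAt k l ++ m.
Proof.
  revert k. induction l as [|x l IH]; intros k Hk; [simpl in Hk; lia|].
  destruct k as [|k]; [reflexivity|].
  change (x :: removeAt k (l ++ m) = x :: (removeAt k l ++ m)). rewrite IH; [reflexivity|]. simpl in Hk. lia.
Qed.

Lemma rGp_removeAt (g : C -> C) (i : nat) (l : list C) : (i < length l)%nat -> NoDup l ->
  (forall x y, In x l -> In y l -> g x = g y -> x = y) ->
  vprod (map (fun v => rGp (g v - g (nth i l 0))) l) = vprod (map (fun v => rG (g v - g (nth i l 0))) (removeAt i l)).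
Proof.
  intros Hi Hnd Hg. rewrite (vprod_removeAt _ i) by exact Hi.
  replace (g (nth i l 0) - g (nth i l 0)) with (RtoC 0) by ring.
  unfold rGp at 1. destruct (Ceq_dec 0 0) as [_|H]; [|congruence]. rewrite Cmult_1_l.
  apply vprod_ext. intros v Hv. unfold rGp.
  destruct (Ceq_dec (g v - g (nth i l 0)) 0) as [E|E]; [|reflexivity].
  exfalso. apply (proj2 (Ceq_minus _ _)) in E. apply Hg in E.
  - subst v. revert Hv. now apply nth_not_in_removeAt.
  - now apply in_removeAt with i.
  - now apply nth_In.
Qed.

Lemma vGamma_rG (l : list C) : (forall y, In y l -> notpole y) -> vGamma l = / vprod (map rG l).
Proof.
  intros H. unfold vGamma. rewrite vprod_inv by (intros; apply rG_neq_0; auto).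
  apply vprod_ext. intros; apply CGamma_rG; auto.
Qed.

Lemma vprod_rG_neq_0 (l : list C) : (forall y, In y l -> notpole y) -> vprod (map rG l) <> 0.
Proof. intros H. apply vprod_neq_0. intros; apply rG_neq_0; auto. Qed.

Lemma notpole_1 : notpole 1.
Proof.
  intros j E. apply (f_equal Re) in E. unfold Re, RtoC, Copp in E. cbn [fst] in E. pose proof (pos_INR j). lra.
Qed.

Definition flip (l : list C) : list C := map (fun x => 1 - x) l.

Lemma vpoch_app (l m : list C) (k : nat) : vpoch (l ++ m) k = vpoch l k * vpoch m k.
Proof. unfold vpoch. now rewrite map_app, vprod_app. Qed.

Lemma vpoch_cons (x : C) (l : list C) (k : nat) : vpoch (x :: l) k = poch x k * vpoch l k.
Proof. reflexivity. Qed.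

Lemma vpoch_neq_0 (l : list C) (k : nat) : (forall y, In y l -> notpole y) -> vpoch l k <> 0.
Proof. intros H. unfold vpoch. apply vprod_neq_0. intros y Hy. apply poch_neq_0. auto. Qed.

Lemma vpoch_map (g : C -> C) (l : list C) (k : nat) : vpoch (map g l) k = vprod (map (fun y => poch (g y) k) l).
Proof. unfold vpoch. now rewrite map_map. Qed.

Lemma vprod_poch_flip (g h : C -> C) (l : list C) (k : nat) :
  (forall y, g (1 - y) = h y) ->
  vprod (map (fun y => poch (g y) k) (flip l)) = vpoch (map h l) k.
Proof.
  intros H. unfold flip. rewrite map_map, vpoch_map. apply vprod_ext. intros y _. now rewrite H.
Qed.

Lemma vpoch_map_ext (g h : C -> C) (l : list C) (k : nat) :
  (forall y, g y = h y) -> vprod (map (fun y => poch (g y) k) l) = vpoch (map h l) k.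
Proof. intros H. rewrite vpoch_map. apply vprod_ext. intros y _. now rewrite H. Qed.

Lemma pFq_scaled (t : nat -> C) (as_ bs : list C) (z c S : C) :
  (forall k, t k = c * hyp_term as_ bs z k) -> ccv (fun n => csum n t) S ->
  S = c * pFq as_ bs z.
Proof.
  (* For c = 0 convergence of t says nothing about the hypergeometric series, but its value is
     multiplied by 0. *)
  intros H HS. destruct (Ceq_dec c 0) as [->|Hc].
  - rewrite Cmult_0_l. apply (ccv_unique _ _ _ HS). eapply ccv_ext; [|apply (ccv_const 0)].
    intros n. rewrite (csum_ext n t (fun _ => 0 * 0)) by (intros; rewrite H; ring).
    rewrite csum_scal. ring.
  - unfold pFq. rewrite (CSeries_ccv _ (S / c)); [field; exact Hc|].
    apply ccv_csum_scal_inv; [exact Hc|]. eapply ccv_ext; [|exact HS].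
    intros n. apply csum_ext. intros k _. rewrite H. ring.
Qed.

Lemma vprod_opp_flip (l : list C) : vprod (map (fun y => y - 1) l) = (-1) ^ length l * vprod (map (fun y => 1 - y) l).
Proof. rewrite <- vprod_const, <- vprod_mult. apply vprod_ext. intros; ring. Qed.

(** * Specialisation to the hypergeometric parameters *)

Section Assembly.
Variables (p n s : nat) (a1 a2 b1 b2 : list C) (z : C).
Hypothesis (Hp : (1 <= p)%nat) (Hn : (n <= p)%nat) (Hs : (s <= p - 1)%nat) (Hkappa : (n <= s + 2)%nat).
Hypothesis (Ha1len : length a1 = n) (Ha2len : length a2 = (p - n)%nat)
  (Hb1len : length b1 = s) (Hb2len : length b2 = (p - 1 - s)%nat).
Hypothesis (Ha1 : forall x, In x a1 -> nonint x) (Hb1 : forall x, In x b1 -> nonint x).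
Hypothesis (Ha2 : forall x, In x a2 -> nonint x).
Hypothesis (Ha2d : generic a2) (Hb1d : generic b1).
Hypothesis (Hg1 : forall y, In y b2 -> notpole y).
Hypothesis (Hg2 : forall x, In x a2 -> forall y, In y b1 -> notpole (1 - y + x)).
Hypothesis (Hg3 : forall x, In x a2 -> forall y, In y b2 -> notpole (y - x)).
Hypothesis (Hg4 : forall x, In x a2 -> forall y, In y a1 -> notpole (1 - y + x)).
Hypothesis (Hg6 : forall x, In x b1 -> forall y, In y a1 -> notpole (x - y)).
Hypothesis (Hg7 : forall x, In x b1 -> forall y, In y b2 -> notpole (1 - x + y)).
Hypothesis (Hz : z = if Nat.even (s + n) then RtoC 1 else RtoC (-1)).

Let U := RtoC 1 :: a2.
Let V := RtoC 0 :: RtoC 0 :: flip b1.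
Let X := flip a1.

Lemma nonint_2_minus (x : C) : nonint x -> nonint (2 - x).
Proof.
  intros H. replace (2 - x) with (1 - x + natC 1) by (simpl; ring).
  now apply nonint_plus_nat, nonint_1_minus.
Qed.

Lemma in_flip (y : C) (l : list C) : In y (flip l) -> exists x, In x l /\ y = 1 - x.
Proof. intros H. apply in_map_iff in H. destruct H as [x [E Hx]]. eauto. Qed.

Lemma length_flip (l : list C) : length (flip l) = length l.
Proof. apply length_map. Qed.

Lemma generic_U : generic U.
Proof.
  unfold U. destruct Ha2d as [Hnd Hd]. split.
  - constructor; [|exact Hnd]. intros H. apply (Ha2 _ H 1%Z). reflexivity.
  - intros x y [<-|Hx] [<-|Hy] Hne; [now contradiction Hne| | |now apply Hd].
    + apply nonint_1_minus. auto.
    + replace (x - 1) with (- (1 - x)) by ring. apply nonint_opp, nonint_1_minus. auto.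
Qed.

Lemma generic_V : generic (RtoC 0 :: flip b1).
Proof.
  destruct Hb1d as [Hnd Hd]. split.
  - constructor.
    + intros H. apply in_flip in H. destruct H as [x [Hx E]]. apply (Hb1 x Hx 1%Z).
      transitivity (1 - (1 - x)); [ring|]. rewrite <- E. ring.
    + unfold flip. apply FinFun.Injective_map_NoDup; [|exact Hnd]. intros x y E.
      transitivity (1 - (1 - x)); [ring|]. rewrite E. ring.
  - intros x y [<-|Hx] [<-|Hy] Hne; [now contradiction Hne| | |].
    + apply in_flip in Hy. destruct Hy as [b [Hb ->]].
      replace (0 - (1 - b)) with (- (1 - b)) by ring. apply nonint_opp, nonint_1_minus. auto.
    + apply in_flip in Hx. destruct Hx as [b [Hb ->]].
      replace (1 - b - 0) with (1 - b) by ring. apply nonint_1_minus. auto.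
    + apply in_flip in Hx, Hy. destruct Hx as [b [Hb ->]], Hy as [b' [Hb' ->]].
      replace (1 - b - (1 - b')) with (b' - b) by ring. apply Hd; auto. intros ->. now apply Hne.
Qed.

Lemma notpole_UV u v : In u U -> In v (RtoC 0 :: flip b1) -> notpole (u + v).
Proof.
  intros [<-|Hu] [<-|Hv].
  - rewrite Cplus_0_r. apply notpole_1.
  - apply in_flip in Hv. destruct Hv as [b [Hb ->]].
    replace (1 + (1 - b)) with (2 - b) by ring. apply nonint_notpole, nonint_2_minus. auto.
  - rewrite Cplus_0_r. apply nonint_notpole. auto.
  - apply in_flip in Hv. destruct Hv as [b [Hb ->]]. rewrite Cplus_comm. auto.
Qed.

Lemma notpole_WV w v : In w b2 -> In v (RtoC 0 :: flip b1) -> notpole (w + v).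
Proof.
  intros Hw [<-|Hv]; [rewrite Cplus_0_r; auto|].
  apply in_flip in Hv. destruct Hv as [b [Hb ->]]. rewrite Cplus_comm. auto.
Qed.

Lemma notpole_XU x u : In x X -> In u U -> notpole (x + u).
Proof.
  intros Hx. apply in_flip in Hx. destruct Hx as [a [Ha ->]]. intros [<-|Hu]; [|auto].
  replace (1 - a + 1) with (2 - a) by ring. apply nonint_notpole, nonint_2_minus. auto.
Qed.

Lemma V_differences v0 v : In v0 (RtoC 0 :: flip b1) -> In v V -> v - v0 = 0 \/ nonint (v - v0).
Proof.
  intros H0 Hv. destruct (Ceq_dec v v0) as [->|Hne]; [left; ring|]. right. apply generic_V; auto.
  destruct Hv as [Hv|Hv]; [now left|exact Hv].
Qed.

Lemma U_differences u0 u : In u0 U -> In u U -> u - u0 = 0 \/ nonint (u - u0).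
Proof.
  intros H0 Hv. destruct (Ceq_dec u u0) as [->|Hne]; [left; ring|]. right. apply generic_U; auto.
Qed.

Lemma in_V v : In v V -> In v (RtoC 0 :: flip b1).
Proof. intros [H|H]; [now left|exact H]. Qed.

Lemma sign_V k : ((-1) ^ k) ^ length X * ((-1) ^ k) ^ length V = z ^ k.
Proof.
  apply sign_pow with (s + n)%nat; [|exact Hz]. unfold X, V. simpl length. rewrite !length_flip, Ha1len, Hb1len.
  replace (n + S (S s))%nat with (s + n + 2 * 1)%nat by lia. apply Nat.even_add_mul_2.
Qed.

(** The exponent is |b2| + |U| = 2p - s - n, of the parity of s + n; the case distinction only
    serves the truncated subtraction. *)
Lemma sign_U k : ((-1) ^ k) ^ length b2 * ((-1) ^ k) ^ length U = z ^ k.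
Proof.
  apply sign_pow with (s + n)%nat; [|exact Hz]. unfold U. simpl length. rewrite Ha2len, Hb2len.
  replace (s + n)%nat with (s + n + 2 * 0)%nat by lia. rewrite Nat.even_add_mul_2.
  destruct (Nat.Even_or_Odd (s + n)) as [[q E]|[q E]].
  - assert (E1 : (p - 1 - s + S (p - n) = 0 + 2 * (p - q))%nat) by lia.
    rewrite E1, Nat.even_add_mul_2, E. symmetry. apply Nat.even_mul.
  - assert (E1 : (p - 1 - s + S (p - n) = 1 + 2 * (p - q - 1))%nat) by lia.
    rewrite E1, Nat.even_add_mul_2, E, Nat.add_comm, Nat.even_add_mul_2. reflexivity.
Qed.

Lemma term_lim_0 k : term_lim U V b2 X 0 k
  = term_const U V b2 X 0 * hyp_term (a1 ++ a2) (b1 ++ b2) z k.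
Proof.
  rewrite term_lim_form.
  - f_equal. rewrite sign_V. unfold U, V, X. rewrite !map_cons, !vprod_cons.
    rewrite (vprod_poch_flip (fun x => 1 - x + 0) (fun x => x)) by (intros; ring).
    rewrite (vprod_poch_flip (fun x => 1 - x + 0) (fun x => x)) by (intros; ring).
    rewrite !(vpoch_map_ext (fun x => x + 0) (fun x => x)) by (intros; ring). rewrite !map_id.
    replace (1 + 0) with (RtoC 1) by ring. replace (1 - 0 + 0) with (RtoC 1) by ring.
    unfold hyp_term. rewrite !vpoch_app, poch_1_fact.
    field. repeat split; try apply fact_neq_0_C; apply vpoch_neq_0; auto.
    intros y Hy. apply nonint_notpole. auto.
  - intros u Hu. apply notpole_UV; auto. now left.
  - intros w Hw. apply notpole_WV; auto. now left.
  - intros v Hv. apply V_differences; auto. now left.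
Qed.

Lemma term_lim_1 k : term_lim V U X b2 1 k
  = term_const V U X b2 1
    * hyp_term (RtoC 1 :: RtoC 1 :: map (fun x => 2 - x) (b1 ++ b2)) (map (fun x => 2 - x) (a1 ++ a2)) z k.
Proof.
  rewrite term_lim_form.
  - f_equal. rewrite sign_U. unfold U, V, X. rewrite !map_cons, !vprod_cons.
    rewrite (vprod_poch_flip (fun x => x + 1) (fun x => 2 - x)) by (intros; ring).
    rewrite (vprod_poch_flip (fun x => x + 1) (fun x => 2 - x)) by (intros; ring).
    rewrite !(vpoch_map_ext (fun x => 1 - x + 1) (fun x => 2 - x)) by (intros; ring).
    replace (0 + 1) with (RtoC 1) by ring. replace (1 - 1 + 1) with (RtoC 1) by ring.
    unfold hyp_term. rewrite !map_app, !vpoch_cons, !vpoch_app, poch_1_fact.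
    field. repeat split; try apply fact_neq_0_C; apply vpoch_neq_0;
      intros y Hy; apply in_map_iff in Hy; destruct Hy as [x [<- Hx]]; apply nonint_notpole, nonint_2_minus; auto.
  - intros u Hu. rewrite Cplus_comm. apply notpole_UV; [now left|now apply in_V].
  - intros w Hw. apply notpole_XU; auto. now left.
  - intros v Hv. apply U_differences; auto. now left.
Qed.

Lemma term_lim_a i k : (i < length a2)%nat -> let ak := nth i a2 0 in
  term_lim V U X b2 ak k
  = term_const V U X b2 ak
    * hyp_term (ak :: map (fun x => 1 - x + ak) (b1 ++ b2)) (map (fun x => 1 - x + ak) (removeAt (n + i) (a1 ++ a2))) z k.
Proof.
  intros Hi ak. assert (Hak : In ak a2) by now apply nth_In.
  rewrite term_lim_form.
  - f_equal. rewrite sign_U. rewrite <- Ha1len, removeAt_app_r.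
    unfold U, V, X. rewrite !map_cons, !vprod_cons.
    rewrite (vprod_poch_flip (fun x => x + ak) (fun x => 1 - x + ak)) by (intros; ring).
    rewrite (vprod_poch_flip (fun x => x + ak) (fun x => 1 - x + ak)) by (intros; ring).
    (* The component a_k produces (1)_k = k!, which must be separated from the lower parameters. *)
    rewrite (vprod_removeAt (fun v => poch (1 - v + ak) k) i a2) by exact Hi. fold ak.
    rewrite !(vpoch_map_ext (fun x => 1 - x + ak) (fun x => 1 - x + ak)) by (intros; ring).
    replace (0 + ak) with ak by ring. replace (1 - 1 + ak) with ak by ring.
    replace (1 - ak + ak) with (RtoC 1) by ring.
    unfold hyp_term. rewrite !map_app, !vpoch_cons, !vpoch_app, poch_1_fact.
    field. repeat split; try apply fact_neq_0_C; try apply vpoch_neq_0; try (apply poch_neq_0, nonint_notpole; auto);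
      intros y Hy; apply in_map_iff in Hy; destruct Hy as [x [<- Hx]]; auto.
    destruct (U_differences ak x) as [E|E]; [now right|right; now apply in_removeAt with i| |].
    + exfalso. apply (proj2 (Ceq_minus _ _)) in E. subst x. revert Hx. apply nth_not_in_removeAt; auto. apply Ha2d.
    + replace (1 - x + ak) with (1 - (x - ak)) by ring. now apply nonint_notpole, nonint_1_minus.
  - intros u Hu. rewrite Cplus_comm. apply notpole_UV; [now right|now apply in_V].
  - intros w Hw. apply notpole_XU; auto. now right.
  - intros v Hv. apply U_differences; auto. now right.
Qed.

Lemma term_lim_b i k : (i < length b1)%nat -> let bk := nth i b1 0 in
  term_lim U V b2 X (1 - bk) k
  = term_const U V b2 X (1 - bk)
    * hyp_term (map (fun x => 1 - bk + x) (a1 ++ a2)) ((2 - bk) :: map (fun x => 1 - bk + x) (removeAt i (b1 ++ b2))) z k.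
Proof.
  intros Hi bk. assert (Hbk : In bk b1) by now apply nth_In.
  assert (Hv0 : In (1 - bk) (RtoC 0 :: flip b1)) by (right; apply in_map_iff; exists bk; auto).
  rewrite term_lim_form.
  - f_equal. rewrite sign_V. rewrite removeAt_app_l by exact Hi.
    unfold U, V, X. rewrite !map_cons, !vprod_cons.
    rewrite (vprod_poch_flip (fun x => 1 - x + (1 - bk)) (fun x => 1 - bk + x)) by (intros; ring).
    rewrite (vprod_poch_flip (fun x => 1 - x + (1 - bk)) (fun x => 1 - bk + x)) by (intros; ring).
    rewrite !(vpoch_map_ext (fun x => x + (1 - bk)) (fun x => 1 - bk + x)) by (intros; ring).
    rewrite (vpoch_map (fun x => 1 - bk + x) b1).
    rewrite (vprod_removeAt (fun v => poch (1 - bk + v) k) i b1) by exact Hi. fold bk.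
    rewrite (vpoch_map_ext (fun x => 1 - bk + x) (fun x => 1 - bk + x) (removeAt i b1)) by (intros; ring).
    replace (1 + (1 - bk)) with (2 - bk) by ring. replace (1 - 0 + (1 - bk)) with (2 - bk) by ring.
    replace (1 - bk + bk) with (RtoC 1) by ring.
    unfold hyp_term. rewrite !map_app, !vpoch_cons, !vpoch_app, poch_1_fact.
    field. repeat split; try apply fact_neq_0_C; try apply vpoch_neq_0;
      try (apply poch_neq_0, nonint_notpole, nonint_2_minus; auto);
      intros y Hy; apply in_map_iff in Hy; destruct Hy as [x [<- Hx]]; auto.
    assert (Hxb : x <> bk).
    { intros ->. revert Hx. apply nth_not_in_removeAt; auto. apply Hb1d. }
    apply in_removeAt in Hx. replace (1 - bk + x) with (1 - (bk - x)) by ring.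
    apply nonint_notpole, nonint_1_minus. apply Hb1d; auto.
  - intros u Hu. apply notpole_UV; auto.
  - intros w Hw. apply notpole_WV; auto.
  - intros v Hv. apply V_differences; auto.
Qed.

Let C0 := vGamma (flip a1) * vGamma b2 / (vGamma (flip b1) * vGamma a2).

Lemma notpole_flip (l : list C) : (forall x, In x l -> nonint x) -> forall y, In y (flip l) -> notpole y.
Proof. intros H y Hy. apply in_flip in Hy. destruct Hy as [x [Hx ->]]. apply nonint_notpole, nonint_1_minus. auto. Qed.

Lemma vprod_rG_ext (g : C -> C) (l : list C) : (forall y, g y = y) -> vprod (map (fun y => rG (g y)) l) = vprod (map rG l).
Proof. intros H. apply vprod_ext. intros y _. now rewrite H. Qed.

Lemma rG_products_neq_0 : vprod (map rG b2) <> 0 /\ vprod (map rG (flip a1)) <> 0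
  /\ vprod (map rG a2) <> 0 /\ vprod (map rG (flip b1)) <> 0.
Proof.
  repeat apply conj; apply vprod_rG_neq_0.
  - exact Hg1.
  - apply notpole_flip, Ha1.
  - intros y Hy. apply nonint_notpole. auto.
  - apply notpole_flip, Hb1.
Qed.

Lemma C0_rG : C0 = vprod (map rG (flip b1)) * vprod (map rG a2) / (vprod (map rG (flip a1)) * vprod (map rG b2)).
Proof.
  destruct rG_products_neq_0 as [N1 [N2 [N3 N4]]].
  unfold C0. rewrite !vGamma_rG; [field; auto| | | |]; auto.
  - intros y Hy. apply nonint_notpole. auto.
  - apply notpole_flip, Hb1.
  - apply notpole_flip, Ha1.
Qed.

Lemma rGp_id (y : C) : y <> 0 -> rGp y = rG y.
Proof. intros H. unfold rGp. destruct (Ceq_dec y 0); [contradiction|reflexivity]. Qed.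

Lemma rGp_0 : rGp 0 = 1.
Proof. unfold rGp. destruct (Ceq_dec 0 0); [reflexivity|congruence]. Qed.

(** The prefactor of the theorem is the inverse of the constant at the double poles: the residue
    relation is multiplied by it and divided by pi. *)
Lemma const_0 : C0 * term_const U V b2 X 0 = 1.
Proof.
  destruct rG_products_neq_0 as [N1 [N2 [N3 N4]]]. rewrite C0_rG.
  unfold term_const, U, V, X. rewrite !map_cons, !vprod_cons.
  rewrite !(vprod_rG_ext (fun y => y + 0)) by (intros; ring).
  rewrite (vprod_rG_ext (fun y => y - 0)) by (intros; ring).
  rewrite (vprod_ext (fun v => rGp (v - 0)) rG (flip b1)).
  - replace (1 + 0) with (RtoC 1) by ring. replace (0 - 0) with (RtoC 0) by ring.
    rewrite rG_1, rGp_0. field. auto.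
  - intros v Hv. replace (v - 0) with v by ring. apply rGp_id. intros ->.
    apply in_flip in Hv. destruct Hv as [x [Hx E]]. apply (nonint_1_minus x (Hb1 x Hx) 0%Z). now rewrite <- E.
Qed.

Lemma rG_shift_up (l : list C) : vprod (map rG l) = vprod l * vprod (map (fun y => rG (y + 1)) l).
Proof. rewrite <- (map_id l) at 2. rewrite <- vprod_mult. apply vprod_ext. intros y _. apply rG_S. Qed.

Lemma rG_shift_down (l : list C) : vprod (map (fun y => rG (y - 1)) l) = vprod (map (fun y => y - 1) l) * vprod (map rG l).
Proof.
  rewrite <- vprod_mult. apply vprod_ext. intros y _. rewrite (rG_S (y - 1)). f_equal. f_equal. ring.
Qed.

Lemma m1_parity : (-1) ^ length b2 = - z * (-1) ^ length a2.
Proof.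
  pose proof (sign_U 1) as H. rewrite !Cpow_1_r in H. unfold U in H. simpl length in H. rewrite Cpow_S in H.
  rewrite <- H. pose proof (m1_pow_sq (length a2)) as E.
  transitivity ((-1) ^ length b2 * ((-1) ^ length a2 * (-1) ^ length a2)); [rewrite E; ring|ring].
Qed.

Lemma flip_neq_0 (l : list C) : (forall x, In x l -> nonint x) -> vprod (flip l) <> 0.
Proof.
  intros H. apply vprod_neq_0. intros x Hx. apply nonint_neq_0, nonint_1_minus. auto.
Qed.

(** Moving the arguments of [rG] by one turns the Gamma quotient into the products of 1 - b and 1 -
    a; the sign -z is the parity statement [m1_parity]. *)
Lemma const_1 : C0 * term_const V U X b2 1
  = - z * vprod (map (fun x => 1 - x) (b1 ++ b2)) / vprod (map (fun x => 1 - x) (a1 ++ a2)).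
Proof.
  destruct rG_products_neq_0 as [N1 [N2 [N3 N4]]]. rewrite C0_rG.
  unfold term_const, U, V, X. rewrite !map_cons, !vprod_cons, rG_shift_down.
  rewrite (vprod_ext (fun v => rGp (v - 1)) (fun v => rG (v - 1)) a2).
  2:{ intros v Hv. apply rGp_id. intros E. apply (Ha2 v Hv 1%Z). now apply Ceq_minus. }
  rewrite rG_shift_down, !vprod_opp_flip, m1_parity, !map_app, !vprod_app.
  fold (flip a1) (flip b1) (flip a2) (flip b2).
  replace (0 + 1) with (RtoC 1) by ring. replace (1 - 1) with (RtoC 0) by ring. rewrite rG_1, rGp_0.
  rewrite (rG_shift_up (flip a1)), (rG_shift_up (flip b1)) in *.
  pose proof (flip_neq_0 a1 Ha1) as N5. pose proof (flip_neq_0 a2 Ha2) as N6. pose proof (flip_neq_0 b1 Hb1) as N7.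
  set (r1 := vprod (map (fun y => rG (y + 1)) (flip a1))) in *.
  set (r2 := vprod (map (fun y => rG (y + 1)) (flip b1))) in *.
  assert (M1 : r1 <> 0) by (intros E; apply N2; rewrite E; ring).
  assert (M2 : r2 <> 0) by (intros E; apply N4; rewrite E; ring).
  pose proof (m1_pow_neq_0 (length a2)) as N8.
  field. repeat split; auto.
Qed.

(** The two zeros of V contribute [rG ak] twice and the entry 1 of U contributes [rG (1 - ak)]. One
    pair becomes sin(pi a_k) / pi by reflection, the other factor is the Gamma(a_k) in the
    numerator. *)
Lemma const_a i : (i < length a2)%nat -> let ak := nth i a2 0 in
  term_const V U X b2 ak / RtoC PI
  = CGamma ak * vGamma (map (fun x => x - ak) (removeAt i a2)) * vGamma (map (fun x => 1 - x + ak) b1)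
    / (Csin (RtoC PI * ak) * vGamma (map (fun x => x - ak) b2) * vGamma (map (fun x => 1 - x + ak) a1)).
Proof.
  intros Hi ak. assert (Hak : In ak a2) by now apply nth_In. pose proof (Ha2 ak Hak) as Hnak.
  assert (Hnp : notpole ak) by now apply nonint_notpole.
  assert (Hnp1 : notpole (1 - ak)) by now apply nonint_notpole, nonint_1_minus.
  assert (Hdiff : forall y, In y (removeAt i a2) -> notpole (y - ak)).
  { intros y Hy. apply nonint_notpole. apply Ha2d; auto; [now apply in_removeAt with i|].
    intros ->. revert Hy. apply nth_not_in_removeAt; auto. apply Ha2d. }
  unfold term_const, U, V, X. rewrite !map_cons, !vprod_cons.
  pose proof (rGp_removeAt (fun x => x) i a2 Hi (proj1 Ha2d) (fun x y _ _ E => E)) as E. cbv beta in E.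
  fold ak in E. rewrite E. clear E.
  rewrite (CGamma_rG ak Hnp).
  rewrite !vGamma_rG.
  2-5: intros y Hy; apply in_map_iff in Hy; destruct Hy as [x [<- Hx]]; auto.
  unfold flip. rewrite !map_map.
  rewrite (rGp_id (1 - ak)) by (apply nonint_neq_0, nonint_1_minus; auto).
  replace (0 + ak) with ak by ring.
  pose proof (rG_reflection ak) as HR. pose proof (Csin_neq_0 ak Hnak) as HS. pose proof PI_neq_0_C as HPI.
  assert (HR' : Csin (RtoC PI * ak) = RtoC PI * (rG ak * rG (1 - ak))) by (rewrite HR; field; exact HPI).
  rewrite HR'. pose proof (rG_neq_0 _ Hnp). pose proof (rG_neq_0 _ Hnp1).
  assert (Q1 : vprod (map (fun x => rG (x - ak)) (removeAt i a2)) <> 0)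
    by (apply vprod_neq_0; intros; apply rG_neq_0; auto).
  assert (Q2 : vprod (map (fun x => rG (1 - x + ak)) b1) <> 0)
    by (apply vprod_neq_0; intros; apply rG_neq_0; auto).
  assert (Q3 : vprod (map (fun x => rG (x - ak)) b2) <> 0)
    by (apply vprod_neq_0; intros; apply rG_neq_0; auto).
  assert (Q4 : vprod (map (fun x => rG (1 - x + ak)) a1) <> 0)
    by (apply vprod_neq_0; intros; apply rG_neq_0; auto).
  field. repeat split; auto.
Qed.

(** As in [const_a], but the pair is [rG (bk - 1)] and [rG (2 - bk)], shifted by one against
    reflection, which changes the sign of the sine. This minus cancels the one in front of the V'
    family. *)
Lemma const_b i : (i < length b1)%nat -> let bk := nth i b1 0 in
  - (term_const U V b2 X (1 - bk) / RtoC PI)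
  = CGamma (bk - 1) * vGamma (map (fun x => bk - x) (removeAt i b1)) * vGamma (map (fun x => 1 - bk + x) a2)
    / (Csin (RtoC PI * bk) * vGamma (map (fun x => bk - x) a1) * vGamma (map (fun x => 1 - bk + x) b2)).
Proof.
  intros Hi bk. assert (Hbk : In bk b1) by now apply nth_In. pose proof (Hb1 bk Hbk) as Hnb.
  assert (Hnb1 : nonint (bk - 1)) by (apply (nonint_minus_nat bk 1); auto).
  assert (Hnp2 : notpole (2 - bk)) by now apply nonint_notpole, nonint_2_minus.
  assert (Hdiff : forall y, In y (removeAt i b1) -> notpole (bk - y)).
  { intros y Hy. apply nonint_notpole. apply Hb1d; auto; [now apply in_removeAt with i|].
    intros <-. revert Hy. apply nth_not_in_removeAt; auto. apply Hb1d. }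
  unfold term_const, U, V, X. rewrite !map_cons, !vprod_cons. unfold flip. rewrite !map_map.
  pose proof (rGp_removeAt (fun x => 1 - x) i b1 Hi (proj1 Hb1d)) as E. cbv beta in E. fold bk in E.
  rewrite E. 2:{ intros x y _ _ Exy. transitivity (1 - (1 - x)); [ring|]. rewrite Exy. ring. }
  clear E.
  rewrite (vprod_ext (fun x => rG (1 - x - (1 - bk))) (fun x => rG (bk - x)) (removeAt i b1)) by (intros; f_equal; ring).
  rewrite (vprod_ext (fun x => rG (1 - x - (1 - bk))) (fun x => rG (bk - x)) a1) by (intros; f_equal; ring).
  rewrite (vprod_ext (fun x => rG (x + (1 - bk))) (fun x => rG (1 - bk + x)) a2) by (intros; f_equal; ring).
  rewrite (vprod_ext (fun x => rG (x + (1 - bk))) (fun x => rG (1 - bk + x)) b2) by (intros; f_equal; ring).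
  replace (1 + (1 - bk)) with (2 - bk) by ring. replace (0 - (1 - bk)) with (bk - 1) by ring.
  rewrite (rGp_id (bk - 1)) by now apply nonint_neq_0.
  assert (Hnpm : notpole (bk - 1)) by now apply nonint_notpole.
  rewrite (CGamma_rG (bk - 1) Hnpm).
  assert (Hab : forall x, In x a2 -> notpole (1 - bk + x)) by (intros; auto).
  rewrite !vGamma_rG.
  2-5: intros y Hy; apply in_map_iff in Hy; destruct Hy as [x [<- Hx]]; auto.
  rewrite !map_map.
  pose proof (rG_reflection bk) as HR. pose proof (Csin_neq_0 bk Hnb) as HS. pose proof PI_neq_0_C as HPI.
  assert (HR' : Csin (RtoC PI * bk) = - RtoC PI * (rG (bk - 1) * rG (2 - bk))).
  { pose proof (rG_S (bk - 1)) as E1. replace (bk - 1 + 1) with bk in E1 by ring.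
    pose proof (rG_S (1 - bk)) as E2. replace (1 - bk + 1) with (2 - bk) in E2 by ring.
    rewrite E1. transitivity (RtoC PI * (rG bk * rG (1 - bk))); [rewrite HR; field; exact HPI|].
    rewrite E2. ring. }
  rewrite HR'. pose proof (rG_neq_0 _ Hnpm). pose proof (rG_neq_0 _ Hnp2).
  assert (Q1 : vprod (map (fun x => rG (bk - x)) (removeAt i b1)) <> 0)
    by (apply vprod_neq_0; intros; apply rG_neq_0; auto).
  assert (Q2 : vprod (map (fun x => rG (1 - bk + x)) a2) <> 0)
    by (apply vprod_neq_0; intros; apply rG_neq_0; auto).
  assert (Q3 : vprod (map (fun x => rG (1 - bk + x)) b2) <> 0)
    by (apply vprod_neq_0; intros; apply rG_neq_0; auto).
  assert (Q4 : vprod (map (fun x => rG (bk - x)) a1) <> 0)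
    by (apply vprod_neq_0; intros; apply rG_neq_0; auto).
  field. repeat split; auto.
Qed.

Lemma vsum_map_plus (f g : C -> C) (l : list C) :
  vsum (map (fun x => f x + g x) l) = vsum (map f l) + vsum (map g l).
Proof. induction l as [|x l IH]; [simpl; ring|]. simpl map. rewrite !vsum_cons, IH. ring. Qed.

(** The entry 1 of U gives psi(1+k) once and the zeros of V subtract it twice, leaving a single
    digamma (1 + k). The flipped lists are reflected and give the cotangents. *)
Lemma Lam_lim_digamma k : Lam_lim U V b2 X k
  = RtoC PI * (vsum (map (fun x => Ccot (RtoC PI * x)) a1) - vsum (map (fun x => Ccot (RtoC PI * x)) b1))
    - (vsum (map (fun x => digamma (x + natC k)) (b1 ++ b2))
       + digamma (1 + natC k)
       - vsum (map (fun x => digamma (x + natC k)) (a1 ++ a2))).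
Proof.
  unfold Lam_lim, U, V, X. rewrite !map_cons, !vsum_cons, !psi_minus_nat, !map_app, !vsum_app.
  assert (EF : forall l, (forall x, In x l -> nonint x) ->
    vsum (map (fun x => psi (x - natC k)) (flip l))
    = vsum (map (fun x => psi (x + natC k)) l) + RtoC PI * vsum (map (fun x => Ccot (RtoC PI * x)) l)).
  { intros l Hl. unfold flip. rewrite map_map, <- vsum_scal, <- vsum_map_plus. apply vsum_ext.
    intros x Hx. apply psi_reflection_shift. auto. }
  assert (ED : forall l, (forall x, In x l -> notpole x) ->
    vsum (map (fun x => digamma (x + natC k)) l) = vsum (map (fun x => psi (x + natC k)) l)).
  { intros l Hl. apply vsum_ext. intros x Hx. apply digamma_psi, notpole_plus. auto. }
  rewrite !EF, !ED, digamma_psi; auto using nonint_notpole.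
  - ring.
  - apply notpole_plus, notpole_1.
Qed.

Hypothesis (Hre : (0 < Re (vsum (b1 ++ b2) - vsum (a1 ++ a2)))%R).

Lemma vsum_flip (l : list C) : vsum (flip l) = natC (length l) - vsum l.
Proof.
  unfold flip. rewrite (vsum_opp_sub 1 (fun x => x)), map_id. ring.
Qed.

Lemma digamma_series :
  is_series
    (fun k : nat =>
       vpoch (a1 ++ a2) k * z ^ k / (RtoC PI * vpoch (b1 ++ b2) k * natC (fact k))
       * (vsum (map (fun x => digamma (x + natC k)) (b1 ++ b2))
          + digamma (1 + natC k)
          - vsum (map (fun x => digamma (x + natC k)) (a1 ++ a2))))
    ( (vsum (map (fun x => Ccot (RtoC PI * x)) a1)
         - vsum (map (fun x => Ccot (RtoC PI * x)) b1)) * pFq (a1 ++ a2) (b1 ++ b2) z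
      - z * vprod (map (fun x => 1 - x) (b1 ++ b2))
          / (RtoC PI * vprod (map (fun x => 1 - x) (a1 ++ a2)))
          * pFq (RtoC 1 :: RtoC 1 :: map (fun x => 2 - x) (b1 ++ b2)) (map (fun x => 2 - x) (a1 ++ a2)) z
      + C0 * csum (length a2) (fun k =>
          let ak := nth k a2 0 in
          CGamma ak * vGamma (map (fun x => x - ak) (removeAt k a2))
            * vGamma (map (fun x => 1 - x + ak) b1)
          / (Csin (RtoC PI * ak) * vGamma (map (fun x => x - ak) b2)
             * vGamma (map (fun x => 1 - x + ak) a1))
          * pFq (ak :: map (fun x => 1 - x + ak) (b1 ++ b2))
                (map (fun x => 1 - x + ak) (removeAt (n + k) (a1 ++ a2))) z)
      + C0 * csum (length b1) (fun k =>
          let bk := nth k b1 0 in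
          CGamma (bk - 1) * vGamma (map (fun x => bk - x) (removeAt k b1))
            * vGamma (map (fun x => 1 - bk + x) a2)
          / (Csin (RtoC PI * bk) * vGamma (map (fun x => bk - x) a1)
             * vGamma (map (fun x => 1 - bk + x) b2))
          * pFq (map (fun x => 1 - bk + x) (a1 ++ a2))
                ((2 - bk) :: map (fun x => 1 - bk + x) (removeAt k (b1 ++ b2))) z) ).
Proof.
  (* m = kappa + 2; [Hkappa] makes the subtraction exact. *)
  destruct (sum_of_residues U (flip b1) b2 X (s + 2 - n)) as [S0 [Sd [SU [SV [H0 [Hd [HU [HV Hsum]]]]]]]].
  - unfold U. simpl length. lia.
  - unfold X. rewrite !length_flip. lia.
  (* The flips and the entry 1 contribute 1 + s - n = m - 1, so the condition is exactly Re(sum b -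
     sum a) > 0. *)
  - unfold U, X. rewrite vsum_cons, !vsum_flip, Ha1len, Hb1len, minus_INR, plus_INR by lia.
    rewrite !vsum_app in Hre. rewrite !Re_minus, !Re_plus in *. rewrite ?Re_minus, !Re_RtoC in *. simpl (INR 2). lra.
  - apply generic_U.
  - apply generic_V.
  - apply notpole_UV.
  - apply notpole_WV.
  - apply notpole_XU.
  - intros x Hx. apply in_flip in Hx. destruct Hx as [y [Hy ->]]. apply nonint_1_minus. auto.
  - fold V in H0, Hd, HU, HV.
    set (c0 := term_const U V b2 X 0) in *.
    pose proof const_0 as Ec0. fold c0 in Ec0. pose proof PI_neq_0_C as HPI.
    assert (Hc0 : c0 <> 0) by (intros E; apply C1_nz; rewrite <- Ec0, E; ring).
    assert (HC0 : C0 = / c0) by (rewrite <- (Cmult_1_l (/ c0)), <- Ec0; field; exact Hc0).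
    pose proof (pFq_scaled _ _ _ z c0 S0 term_lim_0 H0) as E0.
    pose proof (pFq_scaled _ _ _ z _ _ term_lim_1 (HU 1 (or_introl eq_refl))) as E1.
    set (F0 := pFq (a1 ++ a2) (b1 ++ b2) z) in *.
    set (F1 := pFq (RtoC 1 :: RtoC 1 :: map (fun x => 2 - x) (b1 ++ b2)) (map (fun x => 2 - x) (a1 ++ a2)) z) in *.
    set (cots := vsum (map (fun x => Ccot (RtoC PI * x)) a1) - vsum (map (fun x => Ccot (RtoC PI * x)) b1)) in *.
    unfold U in Hsum. rewrite map_cons, vsum_cons in Hsum.
    match goal with |- is_series _ (_ + C0 * ?A + C0 * ?B) =>
      assert (EA : C0 * A = C0 * (vsum (map SU a2) / RtoC PI));
      [|assert (EB : C0 * B = - (C0 * (vsum (map SV (flip b1)) / RtoC PI)))] end.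
    { f_equal. rewrite vsum_nth.
      transitivity (/ RtoC PI * csum (length a2) (fun k => SU (nth k a2 0))); [|field; exact HPI].
      rewrite <- csum_scal. apply csum_ext.
      intros i Hi. cbv zeta. rewrite <- (const_a i Hi).
      rewrite (pFq_scaled _ _ _ z _ _ (fun k => term_lim_a i k Hi) (HU _ (or_intror (nth_In _ _ Hi)))).
      field. exact HPI. }
    { replace (- (C0 * (vsum (map SV (flip b1)) / RtoC PI))) with (C0 * (- / RtoC PI * vsum (map SV (flip b1)))) by (field; exact HPI).
      f_equal. unfold flip. rewrite map_map, vsum_nth, <- csum_scal. apply csum_ext.
      intros i Hi. cbv zeta. rewrite <- (const_b i Hi).
      assert (Hin : In (1 - nth i b1 0) (flip b1)) by (apply in_map_iff; exists (nth i b1 0); split; [reflexivity|now apply nth_In]).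
      rewrite (pFq_scaled _ _ _ z _ _ (fun k => term_lim_b i k Hi) (HV _ Hin)).
      field. exact HPI. }
    rewrite EA, EB. clear EA EB.
    assert (EC : z * vprod (map (fun x => 1 - x) (b1 ++ b2)) / (RtoC PI * vprod (map (fun x => 1 - x) (a1 ++ a2))) * F1
      = - (C0 * (SU 1 / RtoC PI))).
    { rewrite E1. transitivity (- (C0 * term_const V U X b2 1) * F1 / RtoC PI); [|field; exact HPI].
      rewrite const_1. field. split; [|exact HPI].
      rewrite map_app, vprod_app. apply Cmult_neq_0; [apply (flip_neq_0 a1 Ha1)|apply (flip_neq_0 a2 Ha2)]. }
    rewrite EC.
    apply is_series_ccv.
    (* By [Lam_lim_digamma] the digamma term is C0 times the double-pole term with pi times the
       cotangents split off, divided by -pi; the residue relation solved for Sd identifies the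
       limit. *)
    match goal with |- ccv _ ?L => assert (EL : L = cots / c0 * S0 - C0 / RtoC PI * Sd) end.
    { replace Sd with (vsum (map SV (flip b1)) - (SU 1 + vsum (map SU a2)))
        by (transitivity (vsum (map SV (flip b1)) - (SU 1 + vsum (map SU a2))
              + (Sd + (SU 1 + vsum (map SU a2)) - vsum (map SV (flip b1)))); [rewrite Hsum; ring|ring]).
      rewrite E0. field. auto. }
    rewrite EL. clear EL.
    eapply ccv_ext; [|apply ccv_minus; [apply ccv_scal, H0|apply ccv_scal, Hd]].
    intros N. cbv beta. rewrite <- !csum_scal.
    match goal with |- csum N ?f - csum N ?g = _ => transitivity (csum N f + -1 * csum N g); [ring|] end.
    rewrite <- csum_scal, <- csum_plus. apply csum_ext. intros k _.
    rewrite Lam_lim_digamma. fold cots. rewrite term_lim_0. fold c0. rewrite HC0. unfold hyp_term.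
    assert (Hb : vpoch (b1 ++ b2) k <> 0).
    { rewrite vpoch_app. apply Cmult_neq_0; apply vpoch_neq_0; auto using nonint_notpole. }
    field. repeat split; auto. apply fact_neq_0_C.
Qed.
End Assembly.

Theorem mainTheorem5
  (p n s : nat) (a1 a2 b1 b2 : list C)
  (Hp : (1 <= p)%nat) (Hn : (n <= p)%nat) (Hs : (s <= p - 1)%nat)
  (Hkappa : (n <= s + 2)%nat)   (* kappa = s - n >= -2 *)
  (Ha1len : length a1 = n) (Ha2len : length a2 = (p - n)%nat)
  (Hb1len : length b1 = s) (Hb2len : length b2 = (p - 1 - s)%nat)
  (Ha1 : forall x, In x a1 -> nonint x)
  (Hb1 : forall x, In x b1 -> nonint x)
  (Hre : (0 < Re (vsum (b1 ++ b2) - vsum (a1 ++ a2)))%R)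
  (* genericity *)
  (Ha2 : forall x, In x a2 -> nonint x)
  (Ha2d : distinct_modZ a2)
  (Hb1d : distinct_modZ b1)
  (* all Gamma factors finite *)
  (Hg1 : forall y, In y b2 -> notpole y)
  (Hg2 : forall x, In x a2 -> forall y, In y b1 -> notpole (1 - y + x))
  (Hg3 : forall x, In x a2 -> forall y, In y b2 -> notpole (y - x))
  (Hg4 : forall x, In x a2 -> forall y, In y a1 -> notpole (1 - y + x))
  (Hg5 : forall x, In x b1 -> forall y, In y a2 -> notpole (1 - x + y))
  (Hg6 : forall x, In x b1 -> forall y, In y a1 -> notpole (x - y))
  (Hg7 : forall x, In x b1 -> forall y, In y b2 -> notpole (1 - x + y)) :
  let a := a1 ++ a2 in
  let b := b1 ++ b2 in
  let z : C := if Nat.even (s + n) then 1 else -1 in   (* z = (-1)^(s-n) *)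
  let C0 := vGamma (map (fun x => 1 - x) a1) * vGamma b2
            / (vGamma (map (fun x => 1 - x) b1) * vGamma a2) in
  is_series
    (fun k : nat =>
       vpoch a k * z ^ k / (RtoC PI * vpoch b k * RtoC (INR (fact k)))
       * (vsum (map (fun x => digamma (x + RtoC (INR k))) b)
          + digamma (1 + RtoC (INR k))
          - vsum (map (fun x => digamma (x + RtoC (INR k))) a)))
    ( (vsum (map (fun x => Ccot (RtoC PI * x)) a1)
         - vsum (map (fun x => Ccot (RtoC PI * x)) b1)) * pFq a b z
      - z * vprod (map (fun x => 1 - x) b)
          / (RtoC PI * vprod (map (fun x => 1 - x) a))
          * pFq (RtoC 1 :: RtoC 1 :: map (fun x => 2 - x) b) (map (fun x => 2 - x) a) z
      + C0 * csum (length a2) (fun k =>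
          let ak := nth k a2 0 in
          CGamma ak * vGamma (map (fun x => x - ak) (removeAt k a2))
            * vGamma (map (fun x => 1 - x + ak) b1)
          / (Csin (RtoC PI * ak) * vGamma (map (fun x => x - ak) b2)
             * vGamma (map (fun x => 1 - x + ak) a1))
          * pFq (ak :: map (fun x => 1 - x + ak) b)
                (map (fun x => 1 - x + ak) (removeAt (n + k) a)) z)
      + C0 * csum (length b1) (fun k =>
          let bk := nth k b1 0 in
          CGamma (bk - 1) * vGamma (map (fun x => bk - x) (removeAt k b1))
            * vGamma (map (fun x => 1 - bk + x) a2)
          / (Csin (RtoC PI * bk) * vGamma (map (fun x => bk - x) a1)
             * vGamma (map (fun x => 1 - bk + x) b2))
          * pFq (map (fun x => 1 - bk + x) a)
                ((2 - bk) :: map (fun x => 1 - bk + x) (removeAt k b)) z) ).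
Proof.
  intros a b z C0.
  apply (digamma_series p n s a1 a2 b1 b2 z); auto using distinct_generic.
Qed.
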